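(* Let $R=k[x_1,\ldots,x_n]$ ($n\ge 3$) be a standard graded polynomial ring over a field $k$, and let $J\subset R$ be an ideal. The following conditions are equivalent: (i) $J$ is an almost Cohen--Macaulay ideal of codimension $2$ generated by three forms of the same degree $d\geq 2$. (ii) There exist latent data $(d,m,\underline{\delta},\underline{\epsilon})$ and a $(d,m,\underline{\delta},\underline{\epsilon})$-level matrix $\eta$ over $R$ such that $J$ is generated by the maximal minors of $\eta$ fixing its lower block consisting of $m-2$ rows.
   Context: An ideal $J\subset R$ of codimension (height) $2$ is called almost Cohen--Macaulay here if its homological (projective) dimension as an $R$-module is exactly $2$ (equivalently, $R/J$ has projective dimension $3$). For a matrix $M$ over $R$, $I_t(M)$ denotes the ideal generated by the $t\times t$ minors of $M$, and $\mathrm{ht}$ denotes height (codimension). The zero polynomial is considered homogeneous of any degree. Latent data $(d,m,\underline{\delta},\underline{\epsilon})$: integers $d\ge 1$, $m\ge 3$, $1\le\delta_1\le\cdots\le\delta_m$ and $\epsilon_1,\ldots,\epsilon_{m-2}\ge 1$ such that (1) $\delta_3+\epsilon_1\le\delta_4+\epsilon_2\le\cdots\le\delta_m+\epsilon_{m-2}$; (2) $\delta_1+\delta_2=d+\sum_{j=1}^{m-2}\epsilon_j$; (3) $\delta_i+\delta_j\ge d+1$ for every $1\le i<j\le m$; (4) $\delta_3\le d$. Level matrix: given latent data $(d,m,\underline{\delta},\underline{\epsilon})$, an $(m+1)\times m$ vertical block matrix $\eta=\begin{bmatrix}A\\ B\end{bmatrix}$ over $R$ is $(d,m,\underline{\delta},\underline{\epsilon})$-level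 if (a) $A=(a_{i,j})$ is a $3\times m$ matrix such that $a_{i,j}$ is a homogeneous polynomial of degree $d-\delta_j$ if $d-\delta_j\ge 0$, and $a_{i,j}=0$ if $d-\delta_j<0$; (b) $B=(b_{i,j})$ is an $(m-2)\times m$ matrix such that $b_{i,j}$ is a homogeneous polynomial of degree $\delta_{i+2}-\delta_j+\epsilon_i$ if $\delta_{i+2}-\delta_j+\epsilon_i>0$, and $b_{i,j}=0$ if $\delta_{i+2}-\delta_j+\epsilon_i\le 0$; (c) $\mathrm{ht}\,I_m(\eta)=2$ and $\mathrm{ht}\,I_{m-2}(B)=3$. The maximal minors of $\eta$ fixing the lower block $B$ are the three $m\times m$ minors of $\eta$ that involve all rows of $B$, i.e. those obtained by omitting one of the three rows of $A$. *)

(* Defs.v *)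
From HB Require Import structures.
From mathcomp Require Import all_boot all_order all_algebra.
From mathcomp Require Export mpoly.

Set Implicit Arguments.
Unset Strict Implicit.
Unset Printing Implicit Defensive.

Import GRing.Theory.
Local Open Scope ring_scope.

(* An ideal of a commutative ring R is a submodule of the regular module R^o;
   unlike [idealr R] of ring_quotient, this does not exclude the unit ideal. *)
Notation ideal R := (submodClosed R^o).

Section IdealModule.
Variables (R : comNzRingType) (J : ideal R).

Definition ideal_mod : Type := {x : R^o | x \in J}.

HB.instance Definition _ := [isSub of ideal_mod for @sval _ _].
HB.instance Definition _ := [Choice of ideal_mod by <:].
HB.instance Definition _ := [SubChoice_isSubLmodule of ideal_mod by <:].

End IdealModule.

Section Ideals.
Variable R : comNzRingType.

Definition ideal_gen (S : R -> Prop) (x : R) : Prop :=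
  exists (r : nat) (c f : 'I_r -> R),
    (forall i, S (f i)) /\ x = \sum_(i < r) c i * f i.

Definition generated_by (J : ideal R) (S : R -> Prop) : Prop :=
  forall x : R, x \in J <-> ideal_gen S x.

Definition strict_subset (I J : {pred R}) : Prop :=
  {subset I <= J} /\ exists2 x, x \in J & x \notin I.

Definition prime_chain (h : nat) (P : prime_idealr R) : Prop :=
  exists p : 'I_h.+1 -> prime_idealr R,
    p ord_max =i P /\ forall i j : 'I_h.+1, (i < j)%N -> strict_subset (p i) (p j).

Definition prime_height (P : prime_idealr R) (h : nat) : Prop :=
  prime_chain h P /\ forall h', prime_chain h' P -> (h' <= h)%N.

(* [has_height I h] is [ht I = h]; it is false for every h if I is the unit
   ideal, which no prime contains. *)
Definition has_height (I : R -> Prop) (h : nat) : Prop :=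
  (exists P : prime_idealr R,
     (forall x, I x -> x \in P) /\ prime_height P h) /\
  (forall (P : prime_idealr R) (h' : nat),
     (forall x, I x -> x \in P) -> prime_height P h' -> (h <= h')%N).

Definition increasing (a b : nat) (f : 'I_a -> 'I_b) : Prop :=
  {homo f : i j / (i < j)%N}.

Definition is_minor (t p q : nat) (M : 'M[R]_(p, q)) (x : R) : Prop :=
  exists (f : 'I_t -> 'I_p) (g : 'I_t -> 'I_q),
    [/\ increasing f, increasing g & x = \det (mxsub f g M)].

Definition minors_ideal (t p q : nat) (M : 'M[R]_(p, q)) : R -> Prop :=
  ideal_gen (is_minor t M).

(* The m x m minors of eta involving all of its last b rows. *)
Definition is_fixing_minor (a b m : nat) (eta : 'M[R]_(a + b, m)) (x : R) : Prop :=
  exists f : 'I_m -> 'I_(a + b),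
    [/\ increasing f,
        forall i : 'I_b, exists j : 'I_m, f j = rshift a i
      & x = \det (rowsub f eta)].

End Ideals.

Section ProjectiveDimension.
Variable R : nzRingType.

Definition projective (P : lmodType R) : Prop :=
  forall (M N : lmodType R) (g : {linear M -> N}) (f : {linear P -> N}),
    (forall y, exists x, g x = y) ->
    exists h : {linear P -> M}, forall x, g (h x) = f x.

(* M has a projective resolution 0 -> P_l -> ... -> P_0 -> M -> 0. *)
Definition proj_resolution (M : lmodType R) (l : nat) : Prop :=
  exists (P : nat -> lmodType R) (d : forall i, {linear P i.+1 -> P i})
         (e : {linear P 0%N -> M}),
    (forall i, projective (P i)) /\
    (forall i, (l < i)%N -> forall x : P i, x = 0) /\
    (forall y, exists x, e x = y) /\
    (forall x, e x = 0 <-> exists z, d 0%N z = x) /\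
    (forall i x, d i x = 0 <-> exists z, d i.+1 z = x).

Definition has_pdim (M : lmodType R) (l : nat) : Prop :=
  proj_resolution M l /\ forall l', proj_resolution M l' -> (l <= l')%N.

End ProjectiveDimension.

Section LevelMatrices.

(* The families delta_1, ..., delta_m and epsilon_1, ..., epsilon_(m-2) are
   1-indexed functions on nat; their other values are irrelevant. *)
Record latent_data (d m : nat) (delta eps : nat -> nat) : Prop := LatentData {
  latent_d : (1 <= d)%N;
  latent_m : (3 <= m)%N;
  latent_delta1 : (1 <= delta 1)%N;
  latent_delta_le : forall i, (1 <= i < m)%N -> (delta i <= delta i.+1)%N;
  latent_eps : forall i, (1 <= i <= m - 2)%N -> (1 <= eps i)%N;
  latent_sum_le : forall i, (1 <= i < m - 2)%N ->
    (delta (i + 2) + eps i <= delta (i + 3) + eps (i + 1))%N;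
  latent_sum : (delta 1 + delta 2 = d + \sum_(1 <= j < (m - 2).+1) eps j)%N;
  latent_pair : forall i j, (1 <= i)%N -> (i < j)%N -> (j <= m)%N ->
    (d + 1 <= delta i + delta j)%N;
  latent_delta3 : (delta 3 <= d)%N
}.

Variables (k : fieldType) (n : nat).
Local Notation R := {mpoly k[n]}.

(* Matrix indices are 0-based, so that column j : 'I_m carries delta j.+1 and
   row i : 'I_(m - 2) of the lower block carries delta (i + 3) + eps i.+1.
   Each truncated subtraction below occurs under a hypothesis making it exact,
   and m + 1 = 3 + (m - 2). *)
Record level_matrix (d m : nat) (delta eps : nat -> nat)
    (eta : 'M[R]_(3 + (m - 2), m)) : Prop := LevelMatrix {
  level_upper : forall (i : 'I_3) (j : 'I_m),
    ((delta j.+1 <= d)%N -> usubmx eta i j \is (d - delta j.+1)%N.-homog) /\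
    ((d < delta j.+1)%N -> usubmx eta i j = 0);
  level_lower : forall (i : 'I_(m - 2)) (j : 'I_m),
    ((delta j.+1 < delta (i + 3) + eps i.+1)%N ->
       dsubmx eta i j \is (delta (i + 3) + eps i.+1 - delta j.+1)%N.-homog) /\
    ((delta (i + 3) + eps i.+1 <= delta j.+1)%N -> dsubmx eta i j = 0);
  level_height : has_height (minors_ideal m eta) 2;
  level_height_lower : has_height (minors_ideal (m - 2) (dsubmx eta)) 3
}.

Definition almost_CM_codim2 (J : ideal R) : Prop :=
  has_height (fun x => x \in J) 2 /\ has_pdim (ideal_mod J) 2.

End LevelMatrices.

(* Main.v *)
Require Import Defs.
From HB Require Import structures.
From mathcomp Require Import all_boot all_order all_algebra.
From mathcomp Require Import ring_quotient perm fraction generic_quotient.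
From mathcomp Require Import ring zify.
From mathcomp Require boolp classical_sets.

(** Write eta as the block column of A (3 rows) and B (r = m - 2 rows), and let S be
the alternating m x m matrix whose (p, q) entry is, up to sign, the maximal minor
of B that omits the columns p and q. Everything rests on the chain of maps

    R^r --B^T--> R^m --S--> R^m --B--> R^r,

the Buchsbaum-Rim complex of B, and on the fact that the three minors of eta
fixing B are, up to sign, the entries of the alternating 3 x 3 matrix A S A^T
(upper_minors_skew). When the ideal of maximal minors of B has grade 3, the
complex is exact in the middle and B^T is injective (exact_skew_B,
exact_B_skew).

From a level matrix to the ideal. The Hilbert-Burch theorem for eta describes
the syzygies of all maximal minors of eta; a syzygy of the three minors f fixing
B is therefore A v with B v = 0, and v = S z by exactness. Hence

    0 -> R^r --B^T--> R^m --A S--> R^3 --f--> J -> 0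

is exact and J has projective dimension at most 2. It is not smaller: otherwise
B^T would split, so it would remain injective modulo every prime, which McCoy's
theorem forbids modulo a prime containing the minors of B. Since
I_r(B) I_m(eta) is contained in J and J in I_m(eta), the heights of J and I_m(eta)
agree (level_ideal_height).

From the ideal to a level matrix. Let 0 -> R^r --C--> R^m --Phi--> R^3 --f--> J
be a minimal graded resolution (minimal_resolution) and put B = C^T. Counting
ranks over the fraction field gives m = r + 2. The ideal of maximal minors of B
has height 3 (lower_block_height): it is not more because four regular elements
would make B surjective, whereas the entries of B have no constant term; it is
not less because C stays injective modulo a regular sequence s of length at most
2, so that a minimal prime of (s) cannot contain the minors. Since Phi C = 0, the
columns of Phi^T are killed by B, so exactness writes Phi as A S. The matrix S
has rank two, which yields

    (Phi u) x (Phi v) = (u^T S v) w,   w the axial vector of A S A^T,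

for all u and v (wedge_skewm). The left side is parallel to f, so w = c f; taking
for Phi u and Phi v two Koszul syzygies of f shows that c divides f, so c is a
unit because J has grade 2. Up to a unit, f is thus the row of minors of the
block matrix of A and B fixing B. The same identity, read in degrees, gives the
numerical conditions: delta_j is the degree of the j-th column of Phi, and
delta_(i+2) + epsilon_i that of the i-th column of C. Positivity of epsilon_i
(lower_degree_gt) comes from applying Hilbert-Burch to the first i columns of C.

Two general facts make this elementary. A proper ideal of height h in a
polynomial ring over a field contains a regular sequence of length h
(has_height_regular); this is Noether normalization combined with a bound on
chains of primes by transcendence degree. And two resolutions are compared by
lifting maps through projective modules, so that a short projective resolution
makes a kernel in any free resolution a direct summand
(matrix_kernel_splits1, matrix_kernel_splits2). *)

Set Implicit Arguments.
Unset Strict Implicit.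
Unset Printing Implicit Defensive.

Import GRing.Theory.
Local Open Scope ring_scope.

(** * Ideals, regular sequences and chains of primes *)

Section RegularSequences.
Variable R : comNzRingType.
Implicit Types (I Q T : R -> Prop) (P : prime_idealr R) (s : seq R).

Definition is_ideal I : Prop :=
  [/\ I 0, forall x y, I x -> I y -> I (x + y) & forall a x, I x -> I (a * x)].

Lemma is_idealN I x : is_ideal I -> I x -> I (- x).
Proof. by move=> II Ix; case: II => _ _ IM; rewrite -mulN1r; apply: IM. Qed.

Lemma is_idealB I x y : is_ideal I -> I x -> I y -> I (x - y).
Proof. by move=> II Ix Iy; case: (II) => _ ID _; apply: ID => //; apply: is_idealN. Qed.

Lemma is_ideal_sum I (A : Type) (r : seq A) (p : pred A) (F : A -> R) :
  is_ideal I -> (forall i, p i -> I (F i)) -> I (\sum_(i <- r | p i) F i).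
Proof. by case=> I0 ID _ IF; apply: (big_ind I). Qed.

Lemma ideal_gen_is_ideal (S : R -> Prop) : is_ideal (ideal_gen S).
Proof.
split.
- by exists 0%N, (fun=> 0), (fun=> 0); split; [case | rewrite big_ord0].
- move=> _ _ [r [c [f [Sf ->]]]] [r' [c' [f' [Sf' ->]]]].
  pose glue (u : 'I_r -> R) (v : 'I_r' -> R) i :=
    match split i with inl j => u j | inr j => v j end.
  exists (r + r')%N, (glue c c'), (glue f f'); split=> [i|].
    by rewrite /glue; case: (split i).
  rewrite big_split_ord /=; congr (_ + _); apply: eq_bigr => i _.
    by rewrite /glue (unsplitK (inl i)).
  by rewrite /glue (unsplitK (inr i)).
- move=> a _ [r [c [f [Sf ->]]]]; exists r, (fun i => a * c i), f; split=> //.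
  by rewrite mulr_sumr; apply: eq_bigr => i _; rewrite mulrA.
Qed.

Lemma ideal_gen_sub (S : R -> Prop) x : S x -> ideal_gen S x.
Proof.
move=> Sx; exists 1%N, (fun=> 1), (fun=> x); split=> //.
by rewrite big_ord1 mul1r.
Qed.

Lemma ideal_gen_min (S I : R -> Prop) x :
  is_ideal I -> (forall y, S y -> I y) -> ideal_gen S x -> I x.
Proof.
move=> II SI [r [c [f [Sf ->]]]]; apply: is_ideal_sum => // i _.
by case: II => _ _; apply; apply: SI.
Qed.

(** A structural recursion on the list, so that the statements on regular
    sequences are proved by induction on the same list. *)
Fixpoint gens s (x : R) : Prop :=
  if s is g :: s' then exists a y, gens s' y /\ x = a * g + y else x = 0.

Lemma gens_ideal s : is_ideal (gens s).
Proof.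
elim: s => [|g s [s0 sD sM]] /=.
  by split=> [|x y -> ->|a x ->] //; rewrite ?addr0 ?mulr0.
split.
- by exists 0, 0; rewrite mul0r addr0.
- move=> _ _ [a [y [sy ->]]] [b [z [sz ->]]]; exists (a + b), (y + z).
  by split; [apply: sD | rewrite mulrDl addrACA].
- move=> c _ [a [y [sy ->]]]; exists (c * a), (c * y).
  by split; [apply: sM | rewrite mulrDr mulrA].
Qed.

Lemma gens_mem s x : x \in s -> gens s x.
Proof.
elim: s => //= g s IHs; rewrite inE => /orP [/eqP -> | /IHs sx].
  by exists 1, 0; rewrite mul1r addr0; split=> //; case: (gens_ideal s).
by exists 0, x; rewrite mul0r add0r.
Qed.

Lemma gens_sub s I :
  is_ideal I -> {in s, forall g, I g} -> forall x, gens s x -> I x.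
Proof.
move=> II; elim: s => [_ x -> | g s IHs sI x [a [y [sy ->]]]]; first by case: II.
case: (II) => _ ID IM; apply: ID; first by apply: IM; apply: sI; apply: mem_head.
by apply: IHs => // h sh; apply: sI; rewrite inE sh orbT.
Qed.

(** The sequence is listed backwards: the head g is the last element, required
    to be a nonzerodivisor modulo the earlier ones, which form the tail. *)
Fixpoint regular s : Prop :=
  if s is g :: s' then
    regular s' /\ forall x, gens s' (g * x) -> gens s' x
  else True.

Lemma regular_drop i s : regular s -> regular (drop i s).
Proof.
elim: s i => [|g s IHs] [|i] //= [rs _]; exact: IHs.
Qed.

Lemma regular_gensX g s j x :
  regular (g :: s) -> gens s (x * g ^+ j) -> gens s x.
Proof.
move=> [_ gs]; elim: j => [|j IHj]; first by rewrite expr0 mulr1.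
by rewrite exprS mulrCA => /gs.
Qed.

(** Turns a predicate in Prop into a packed prime ideal, the boolean
    membership being decided classically. *)
Lemma prime_of_predicate (Q : R -> Prop) :
  is_ideal Q -> ~ Q 1 -> (forall u v, Q (u * v) -> Q u \/ Q v) ->
  exists P, forall x, x \in P <-> Q x.
Proof.
move=> QI Q1 Qprime; have [Q0 QD QM] := QI.
pose S : {pred R} := fun x => boolp.asbool (Q x).
have SP x : reflect (Q x) (x \in S) by apply: boolp.asboolP.
have Scl : idealr_closed S.
  split=> [||a u v /SP Qu /SP Qv]; [exact/SP | exact/SP | apply/SP].
  by apply: QD => //; apply: QM.
have Spr : prime_idealr_closed S.
  by move=> u v /SP /Qprime [] ?; apply/orP; [left | right]; apply/SP.
pose P : prime_idealr R :=
  HB.pack S (isIdealr.Build R S Scl) (isPrimeIdealrClosed.Build R S Spr).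
by exists P => x; split=> /SP.
Qed.

Lemma prime_is_ideal P : is_ideal (fun x => x \in P).
Proof.
split=> [|x y Px Py|a x Px]; [exact: rpred0 | exact: rpredD | exact: idealMr].
Qed.

Lemma prime1 P : 1 \notin P.
Proof. by rewrite idealr1. Qed.

(** Krull: an ideal maximal among those that contain I and miss the
    multiplicative set T is prime, since adjoining u or v outside it meets T,
    and the product of the two elements of T found in this way would lie in it
    as soon as u v does. *)
Lemma prime_disjoint I T :
  is_ideal I -> T 1 -> (forall x y, T x -> T y -> T (x * y)) ->
  (forall x, T x -> ~ I x) ->
  exists P, (forall x, I x -> x \in P) /\ (forall x, T x -> x \notin P).
Proof.
move=> II T1 TM TI.
pose good (A : R -> Prop) :=
  [/\ is_ideal A, forall x, I x -> A x & forall x, T x -> ~ A x].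
(* The empty set is a candidate because it is the union of the empty chain. *)
pose cand (A : classical_sets.set R) := (forall x, ~ A x) \/ good A.
have [F FP Ftot|A [Acand Amax]] := @classical_sets.Zorn_bigcup R cand.
  have [[A [FA [a Aa]]]|noA] :=
      boolp.pselect (exists A, F A /\ exists a, A a); last first.
    by left=> x [A FA Ax]; apply: noA; exists A; split=> //; exists x.
  have goodF B : F B -> forall b, B b -> good B.
    by move=> FB b Bb; case: (FP B FB) => // nB; case: (nB b).
  right; have [AI IA TA] := goodF A FA a Aa; split.
  - split.
    + by exists A => //; case: AI.
    + move=> x y [B FB Bx] [C FC Cy].
      have [[_ BD _] _ _] := goodF B FB x Bx.
      have [[_ CD _] _ _] := goodF C FC y Cy.
      case: (Ftot B C FB FC) => BC.
        by exists C => //; apply: CD => //; apply: BC.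
      by exists B => //; apply: BD => //; apply: BC.
    + move=> b x [B FB Bx]; have [[_ _ BM] _ _] := goodF B FB x Bx.
      by exists B => //; apply: BM.
  - by move=> x Ix; exists A => //; apply: IA.
  - by move=> x Tx [B FB Bx]; have [_ _ /(_ x Tx)] := goodF B FB x Bx.
have [Aempty|[AI IA TA]] := Acand.
  case: (Amax I); last by right; split.
  split=> [x /Aempty //|/(_ 0)]; case: (II) => I0 _ _ /(_ I0).
  exact: Aempty.
have [A0 AD AM] := AI.
pose ext u x := exists a r, A a /\ x = a + r * u.
have ext_ideal u : is_ideal (ext u).
  split.
  - by exists 0, 0; rewrite mul0r addr0.
  - move=> _ _ [a [r [Aa ->]]] [b [t [Ab ->]]]; exists (a + b), (r + t).
    by split; [apply: AD | rewrite mulrDl addrACA].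
  - move=> c _ [a [r [Aa ->]]]; exists (c * a), (c * r).
    by split; [apply: AM | rewrite mulrDr mulrA].
have meet u : ~ A u -> exists x, T x /\ ext u x.
  move=> nAu; apply: boolp.contrapT => noT; case: (Amax (ext u)).
    split=> [x Ax|/(_ u) Au]; first by exists x, 0; rewrite mul0r addr0.
    by apply/nAu/Au; exists 0, 1; rewrite mul1r add0r.
  right; split=> // x.
    by move=> Ix; exists x, 0; rewrite mul0r addr0; split=> //; apply: IA.
  by move=> Tx ex; apply: noT; exists x.
have [|u v Auv|P PA] := prime_of_predicate AI; first exact: TA.
  have [|nAu] := boolp.pselect (A u); first by left.
  have [|nAv] := boolp.pselect (A v); first by right.
  have [x [Tx [a [r [Aa xE]]]]] := meet u nAu.
  have [y [Ty [b [t [Ab yE]]]]] := meet v nAv.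
  case: (TA _ (TM _ _ Tx Ty)); rewrite xE yE mulrDl !mulrDr.
  have -> : r * u * (t * v) = r * t * (u * v) by rewrite mulrACA.
  by apply AD; apply AD; rewrite ?[a * _]mulrC; apply AM.
by exists P; split=> x; [move/IA/PA | move=> /TA nAx; apply/negP => /PA].
Qed.

(** The multiplicative set of all c g^j with c outside P misses the ideal (s),
    because g is regular modulo s and (s) lies in P. A prime over (s) missing
    it is contained in P and does not contain g. *)
Lemma prime_below_regular P g s :
  regular (g :: s) -> {in g :: s, forall x, x \in P} ->
  exists Q : prime_idealr R,
    {in s, forall x, x \in Q} /\ strict_subset Q P.
Proof.
move=> gsreg gsP; have gP : g \in P by apply/gsP/mem_head.
have sP x : gens s x -> x \in P.
  apply: gens_sub (prime_is_ideal P) _ x => h sh.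
  by apply: gsP; rewrite inE sh orbT.
pose T t := exists c j, c \notin P /\ t = c * g ^+ j.
have [||x [c [j [cP ->]]]|Q [sQ TQ]] := @prime_disjoint (gens s) T (gens_ideal s).
- by exists 1, 0%N; rewrite prime1 mulr1.
- move=> _ _ [c [i [cP ->]]] [c' [j [cP' ->]]]; exists (c * c'), (i + j)%N.
  by rewrite prime_idealrM negb_or cP cP' exprD mulrACA.
- by move/(regular_gensX gsreg)/sP; apply/negP.
exists Q; split=> [x xs|]; first by apply/sQ/gens_mem.
split=> [x|]; last first.
  by exists g => //; apply: TQ; exists 1, 1%N; rewrite prime1 mul1r expr1.
apply: contraLR => xP; apply: TQ.
by exists x, 0%N; rewrite expr0 mulr1.
Qed.

Lemma prime_chain0 P : prime_chain 0 P.
Proof. by exists (fun=> P); split=> // i j; rewrite !ord1. Qed.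

Lemma prime_chainS h (Q P : prime_idealr R) :
  prime_chain h Q -> strict_subset Q P -> prime_chain h.+1 P.
Proof.
move=> [p [pQ pinc]] [QP [z zP zQ]].
exists (fun i => if unlift ord_max i is Some j then p j else P).
split; first by move=> x; rewrite unlift_none.
move=> i j; case: (unliftP ord_max j) => [j'|] ->; case: (unliftP ord_max i) => [i'|] ->.
- by rewrite !lift_max => /pinc.
- by rewrite lift_max => lt; have := leq_trans lt (ltnW (ltn_ord j')); rewrite ltnn.
- move=> _; have [->|i'max] := eqVneq i' ord_max.
    split=> [x|]; first by rewrite pQ => /QP.
    by exists z => //; rewrite pQ.
  have lti : (i' < @ord_max h)%N.
    by rewrite ltn_neqAle -ltnS ltn_ord andbT; move: i'max; rewrite -val_eqE.
  have [sub [y yQ yi]] := pinc _ _ lti.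
  split=> [x /sub|]; first by rewrite pQ => /QP.
  by exists y => //; apply: QP; rewrite -pQ.
- by rewrite ltnn.
Qed.

Lemma prime_chain_pred h P :
  prime_chain h.+1 P ->
  exists Q : prime_idealr R, prime_chain h Q /\ strict_subset Q P.
Proof.
move=> [p [pP pinc]]; pose i0 : 'I_h.+2 := lift ord_max ord_max.
have lt0 : (i0 < @ord_max h.+1)%N by rewrite lift_max.
exists (p i0); split.
  exists (fun i => p (lift ord_max i)); split=> // i j ij.
  by apply: pinc; rewrite !lift_max.
have [sub [y yP yi]] := pinc _ _ lt0; split=> [x /sub|]; rewrite ?pP //.
by exists y => //; rewrite -pP.
Qed.

(** Half of the comparison of height and grade: each element of a regular
    sequence in P buys one more prime below P. *)
Lemma prime_chain_regular s P :
  regular s -> {in s, forall x, x \in P} -> prime_chain (size s) P.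
Proof.
elim: s P => [|g s IHs] P; first by move=> _ _; apply: prime_chain0.
move=> gsreg gsP; have [Q [sQ QP]] := prime_below_regular gsreg gsP.
by apply: prime_chainS QP; apply: IHs => //; case: gsreg.
Qed.

Lemma has_height_uniq I h h' : has_height I h -> has_height I h' -> h = h'.
Proof.
move=> [[P [IP Ph]] hmin] [[P' [IP' Ph']] hmin'].
by apply/eqP; rewrite eqn_leq (hmin P') // (hmin' P).
Qed.

Lemma eq_has_height I I' h :
  (forall x, I x <-> I' x) -> has_height I h -> has_height I' h.
Proof.
move=> II' [[P [IP Ph]] hmin]; split.
  by exists P; split=> // x /II'/IP.
by move=> P' h' IP'; apply: hmin => x /II'/IP'.
Qed.

Lemma has_height_proper I h : is_ideal I -> has_height I h -> ~ I 1.
Proof. by move=> II [[P [IP _]] _] /IP; apply/negP/prime1. Qed.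

Lemma height_ge_regular s I P h :
  regular s -> {in s, forall x, I x} -> (forall x, I x -> x \in P) ->
  prime_height P h -> (size s <= h)%N.
Proof.
move=> sreg sI IP [_]; apply; apply: prime_chain_regular => // x /sI; exact: IP.
Qed.

End RegularSequences.

(** * Monic polynomials and a change of variables *)

Section RegularTransport.

Lemma gens_rmorph (R S : comNzRingType) (phi : {rmorphism R -> S}) s x :
  gens s x -> gens (map phi s) (phi x).
Proof.
elim: s x => [x ->|g s IHs _ [a [y [/IHs sy ->]]]]; first by rewrite /= rmorph0.
by exists (phi a), (phi y); rewrite rmorphD rmorphM.
Qed.

Lemma regular_rmorph (R S : comNzRingType) (phi : {rmorphism R -> S})
    (psi : {rmorphism S -> R}) s :
  cancel phi psi -> cancel psi phi -> regular s -> regular (map phi s).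
Proof.
move=> phiK psiK; elim: s => //= g s IHs [/IHs rs gs]; split=> // x gx.
rewrite -(psiK x); apply: gens_rmorph; apply: gs.
have -> : s = map psi (map phi s) by rewrite -map_comp (eq_map phiK) map_id.
by rewrite -(phiK g) -rmorphM; apply: gens_rmorph.
Qed.

Variable S : comNzRingType.
Implicit Types (s : seq S) (p f : {poly S}).

Lemma gens_polyC s p : gens (map polyC s) p <-> forall i, gens s p`_i.
Proof.
split.
  elim: s p => [p -> i|g s IHs _ [a [y [/IHs sy ->]]] i] /=; first by rewrite coef0.
  by exists a`_i, y`_i; rewrite coefD coefMC.
have [s0 sD sM] := gens_ideal (map polyC s).
move=> sp; rewrite -[p]coefK poly_def; apply: (big_ind (gens (map polyC s))) => // i _.
by rewrite -mul_polyC mulrC; apply: sM; apply: gens_rmorph.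
Qed.

Lemma regular_polyC s : regular s -> regular (map polyC s).
Proof.
elim: s => //= g s IHs [/IHs rs gs]; split=> // p /gens_polyC gp.
by apply/gens_polyC => i; apply: gs; rewrite -coefCM.
Qed.

(** A polynomial with invertible leading coefficient is regular modulo the
    extension of (s): the leading coefficient of p lies in (s), and p can be
    replaced by p minus its leading term. *)
Lemma gens_polyC_monic s f u p :
  u * lead_coef f = 1 -> gens (map polyC s) (f * p) -> gens (map polyC s) p.
Proof.
move=> uf; have [_ _ sM] := gens_ideal s; have sI := gens_ideal (map polyC s).
have [s0 sD sM'] := sI.
have [n] := ubnP (size p); elim: n p => // n IHn p /ltnSE-ltpn sfp.
have [->|p0] := eqVneq p 0; first exact: s0.
have slp : gens s (lead_coef p).
  rewrite -[lead_coef p]mul1r -uf -mulrA mul_lead_coef; apply: sM.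
  by move/gens_polyC: sfp; apply.
pose t := (lead_coef p)%:P * 'X^((size p).-1).
have st : gens (map polyC s) t by rewrite /t mulrC; apply: sM'; apply: gens_rmorph.
rewrite -(subrK t p); apply: sD => //; apply: IHn.
  apply: leq_trans ltpn; rewrite ltnNge; apply/negP => le_sz.
  have sz : (size (p - t)%R <= size p)%N.
    rewrite (leq_trans (size_polyD _ _)) // geq_max leqnn size_polyN.
    rewrite /t mul_polyC (leq_trans (size_scale_leq _ _)) // size_polyXn.
    by rewrite prednK // size_poly_gt0.
  have/eqP szE : size (p - t)%R == size p by rewrite eqn_leq sz.
  have : lead_coef (p - t) = 0.
    by rewrite lead_coefE szE coefB /t coefCM coefXn eqxx mulr1 subrr.
  by move/eqP; rewrite lead_coef_eq0 -size_poly_eq0 szE size_poly_eq0 (negPf p0).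
by rewrite mulrBr; apply: is_idealB => //; apply: sM'.
Qed.

End RegularTransport.

Lemma radix_inj n B (a b : 'I_n -> nat) :
  (forall i, a i < B)%N -> (forall i, b i < B)%N ->
  (\sum_i a i * B ^ i = \sum_i b i * B ^ i)%N -> a =1 b.
Proof.
elim: n a b => [|n IHn] a b aB bB; first by move=> _ [].
rewrite !big_ord_recl expn0 !muln1.
have shift (c : 'I_n.+1 -> nat) : (\sum_(i < n) c (lift ord0 i) * B ^ lift ord0 i =
    (\sum_(i < n) c (lift ord0 i) * B ^ i) * B)%N.
  by rewrite big_distrl /=; apply: eq_bigr => i _; rewrite /bump add1n expnSr mulnA.
have B0 : (0 < B)%N by apply: leq_ltn_trans (aB ord0).
rewrite !shift => eqab.
have eq0 : a ord0 = b ord0.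
  move/(congr1 (modn^~ B)): eqab; rewrite ![(_ ord0 + _)%N]addnC !modnMDl.
  by rewrite !modn_small.
move/eqP: eqab; rewrite eq0 eqn_add2l eqn_pmul2r // => /eqP /IHn eqS.
move=> i; case: (unliftP ord0 i) => [j|] -> //.
by apply: (eqS) => j'; [apply: aB | apply: bB].
Qed.

Section Substitution.
Variable k : fieldType.

Definition subst n e (y : 'I_e -> {mpoly k[n]}) : {mpoly k[e]} -> {mpoly k[n]} :=
  mmap (@mpolyC n k) y.

HB.instance Definition _ n e (y : 'I_e -> {mpoly k[n]}) :=
  GRing.RMorphism.on (subst y).

Lemma rmorph_mmap (A B : comNzRingType) (phi : {rmorphism A -> B}) n
    (f : {rmorphism k -> A}) (h : 'I_n -> A) p :
  phi (mmap f h p) = mmap (phi \o f) (phi \o h) p.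
Proof.
rewrite /mmap rmorph_sum /=; apply: eq_bigr => m _.
rewrite rmorphM /mmap1 rmorph_prod; congr (_ * _).
by apply: eq_bigr => i _; rewrite rmorphXn.
Qed.

Lemma eq_mmap (A : comNzRingType) n (f f' : k -> A) (h h' : 'I_n -> A) p :
  f =1 f' -> h =1 h' -> mmap f h p = mmap f' h' p.
Proof.
move=> ff' hh'; rewrite /mmap; apply: eq_bigr => m _.
by rewrite ff' (mmap1_eq _ hh').
Qed.

Lemma mmap_id n (p : {mpoly k[n]}) : mmap (@mpolyC n k) (fun i => 'X_i) p = p.
Proof.
rewrite [RHS]mpolyE /mmap; apply: eq_bigr => m _.
by rewrite mmap1_id mul_mpolyC.
Qed.

Variables (n : nat) (h : 'I_n -> {poly k}).
Local Notation S := {mpoly k[n]}.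
Local Notation R := {mpoly k[n.+1]}.

Definition liftC : {poly k} -> {poly S} := map_poly (@mpolyC n k).

Definition to_poly_var (i : 'I_n.+1) : {poly S} :=
  if unlift ord0 i is Some j then ('X_j)%:P + liftC (h j) else 'X.

(** Singling out the variable of index 0, after the triangular change of
    variables that sends x_(j+1) to x_(j+1) + h_j(x_0); of_poly is its
    inverse. *)
Definition to_poly : R -> {poly S} := mmap (polyC \o @mpolyC n k) to_poly_var.

HB.instance Definition _ := GRing.RMorphism.on to_poly.

Definition of_poly_coef : S -> R :=
  subst (fun j => 'X_(lift ord0 j) - (map_poly (@mpolyC n.+1 k) (h j)).['X_ord0]).

HB.instance Definition _ := GRing.RMorphism.on of_poly_coef.

Definition of_poly : {poly S} -> R := horner_eval 'X_ord0 \o map_poly of_poly_coef.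

HB.instance Definition _ := GRing.RMorphism.on of_poly.

Lemma to_polyC c : to_poly c%:MP = c%:MP%:P.
Proof. by rewrite /to_poly mmapC. Qed.

Lemma to_polyX i : to_poly 'X_i = to_poly_var i.
Proof. by rewrite /to_poly mmapX mmap1U. Qed.

Lemma of_poly_coefC c : of_poly_coef c%:MP = c%:MP.
Proof. by rewrite /of_poly_coef /subst mmapC. Qed.

Lemma of_poly_coefX j : of_poly_coef 'X_j =
  'X_(lift ord0 j) - (map_poly (@mpolyC n.+1 k) (h j)).['X_ord0].
Proof. by rewrite /of_poly_coef /subst mmapX mmap1U. Qed.

Lemma of_polyC c : of_poly c%:P = of_poly_coef c.
Proof. by rewrite /of_poly /= map_polyC /horner_eval hornerC. Qed.

Lemma of_polyX : of_poly 'X = 'X_ord0.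
Proof. by rewrite /of_poly /= map_polyX /horner_eval hornerX. Qed.

Lemma to_polyK : cancel to_poly of_poly.
Proof.
move=> p; rewrite /to_poly rmorph_mmap -[RHS]mmap_id; apply: eq_mmap => [c|i] /=.
  by rewrite of_polyC of_poly_coefC.
rewrite /to_poly_var; case: unliftP => [j|] -> ; last by rewrite of_polyX.
rewrite rmorphD /= of_polyC of_poly_coefX /of_poly /= /liftC -map_poly_comp.
rewrite /horner_eval (@eq_map_poly _ _ _ (@mpolyC n.+1 k)) ?subrK // => c /=.
exact: of_poly_coefC.
Qed.

Lemma to_of_poly_coef c : to_poly (of_poly_coef c) = c%:P.
Proof.
rewrite /of_poly_coef /subst rmorph_mmap -[in RHS](mmap_id c).
rewrite (rmorph_mmap (polyC : {rmorphism S -> {poly S}})).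
apply: eq_mmap => [a|j] /=; first exact: to_polyC.
rewrite rmorphB /= to_polyX /to_poly_var liftK.
suff -> : to_poly (map_poly (@mpolyC n.+1 k) (h j)).['X_ord0] = liftC (h j).
  by rewrite addrK.
rewrite -horner_map /= to_polyX /to_poly_var unlift_none -map_poly_comp.
rewrite (@eq_map_poly _ _ _ (polyC \o @mpolyC n k)) => [|a]; last exact: to_polyC.
by rewrite map_poly_comp -/liftC -[RHS]comp_polyXr.
Qed.

Lemma of_polyK : cancel of_poly to_poly.
Proof.
move=> q; rewrite /of_poly /= /horner_eval -horner_map /= -map_poly_comp.
rewrite (@eq_map_poly _ _ _ polyC) => [|c]; last exact: to_of_poly_coef.
by rewrite to_polyX /to_poly_var unlift_none -[RHS]comp_polyXr.
Qed.

End Substitution.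

(** * Heights in a polynomial ring are attained by regular sequences *)

Section Normalization.
Variable k : fieldType.

(** The change of variables of Nagata: with h_j = X^(B^(j+1)) and B larger
    than all exponents of f, the monomial m becomes monic in x_0 of degree
    sum_i m_i B^i. These degrees are pairwise distinct, being expansions in
    base B, so exactly one monomial contributes to the leading coefficient. *)
Lemma to_poly_unit_lead n (f : {mpoly k[n.+1]}) : f != 0 ->
  exists h : 'I_n -> {poly k},
  exists u : {mpoly k[n]}, u * lead_coef (to_poly h f) = 1.
Proof.
move=> f0; pose B := msize f; pose h (j : 'I_n) : {poly k} := 'X^(B ^ j.+1).
pose wt (m : 'X_{1..n.+1}) := (\sum_i m i * B ^ i)%N.
exists h; have varE i : to_poly_var h i \is monic /\ size (to_poly_var h i) = (B ^ i).+1.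
  rewrite /to_poly_var; case: unliftP => [j|] ->; last first.
    by rewrite monicX size_polyX expn0.
  rewrite /liftC map_polyXn lift0.
  have B0 : (0 < B)%N by rewrite /B lt0n msize_poly_eq0.
  have lt_sz : (size (('X_j)%:P : {poly {mpoly k[n]}}) < size ('X^(B ^ j.+1) : {poly {mpoly k[n]}}))%N.
    by rewrite size_polyXn ltnS (leq_trans (size_polyC_leq1 _)) // expn_gt0 B0.
  by rewrite monicE addrC lead_coefDl // lead_coefXn size_polyDl // size_polyXn.
pose T m := mmap1 (to_poly_var h) m.
have TE m : T m \is monic /\ size (T m) = (wt m).+1.
  rewrite /T /mmap1 /wt; elim/big_rec2: _ => [|i w q _ [qm sq]].
    by rewrite monic1 size_poly1.
  have [vm sv] := varE i; split; first by rewrite monicMl // monic_exp.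
  rewrite size_monicM ?monic_exp // -?size_poly_gt0 ?sq // addnS /=.
  by rewrite -(prednK (_ : 0 < size (to_poly_var h i ^+ m i))%N) ?size_poly_gt0 ?monic_neq0 ?monic_exp // size_exp sv /= mulnC addSn addnC.
have : msupp f != [::] by rewrite msupp_eq0.
rewrite -size_eq0 -lt0n -has_predT => /hasP [m1 m1f _].
have Bm m i : m \in msupp f -> (m i < B)%N.
  move/msize_mdeg_lt; apply: leq_ltn_trans; rewrite mdegE (bigD1 i) //=.
  exact: leq_addr.
have wt_inj : {in msupp f &, injective wt}.
  by move=> m m' mf m'f E; apply/mnmP; apply: radix_inj E => i; apply: Bm.
pose ms := [arg max_(i > SeqSub m1f) wt (val i)].
have msmax m : m \in msupp f -> (wt m <= wt (val ms))%N.
  by move=> mf; rewrite /ms; case: arg_maxnP => //= i _ /(_ (SeqSub mf)); apply.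
have msf : val ms \in msupp f := valP ms.
have toE : to_poly h f = (f@_(val ms))%:MP%:P * T (val ms) +
    \sum_(m <- msupp f | m != val ms) (f@_m)%:MP%:P * T m.
  by rewrite /to_poly /mmap (bigD1_seq (val ms)) ?msupp_uniq.
have fms : f@_(val ms) != 0 by rewrite -mcoeff_msupp.
have fmsP : ((f@_(val ms))%:MP : {mpoly k[n]}) != 0 by rewrite mpolyC_eq0.
exists ((f@_(val ms))^-1)%:MP; rewrite toE lead_coefDl.
  rewrite mul_polyC lead_coefZ; have [/monicP -> _] := TE (val ms).
  by rewrite mulr1 -mpolyCM mulVf.
rewrite mul_polyC size_scale //; have [_ ->] := TE (val ms).
rewrite ltnS big_seq_cond; apply: (leq_trans (size_sum _ _ _)).
apply/bigmax_leqP_seq => m _ /andP [mf mms].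
rewrite mul_polyC (leq_trans (size_scale_leq _ _)) //; have [_ ->] := TE m.
rewrite ltn_neqAle msmax // andbT; apply: contra mms => /eqP E.
by apply/eqP/wt_inj.
Qed.

(** For I = 0 this is algebraic independence; in general it says that k[y]
    meets I only in 0. *)
Definition indep n e (y : 'I_e -> {mpoly k[n]}) (I : {mpoly k[n]} -> Prop) :=
  forall F, I (subst y F) -> F = 0.

(** Induction on n. A nonzero f in I may be assumed monic in x_0 by a change
    of variables; the induction hypothesis applies to the contraction of I to
    k[x_1, ..., x_n], and f is regular modulo the extension of any ideal of
    that ring. *)
Theorem noether_normalization n (I : {mpoly k[n]} -> Prop) :
  is_ideal I -> ~ I 1 ->
  exists (s : seq {mpoly k[n]}) (e : nat) (y : 'I_e -> {mpoly k[n]}),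
    [/\ regular s, {in s, forall x, I x}, (size s + e = n)%N & indep y I].
Proof.
elim: n I => [|n IHn] I II I1; have [I0 ID IM] := II.
all: have [[f [If f0]]|nof] := boolp.pselect (exists f, I f /\ f != 0).
2,4: exists [::], _, (fun i => 'X_i); split=> // F; rewrite /subst mmap_id => IF;
  have [//|F0] := eqVneq F 0; case: nof; by exists F.
- case: I1; have -> : 1 = (f@_0)^-1%:MP * f; last exact: IM.
  have fE : f = (f@_0)%:MP by rewrite mpolyKC.
  by rewrite {2}fE -mpolyCM mulVf //; apply: contraNneq f0; rewrite {2}fE => ->; rewrite mpolyC0.
have [h [u uf]] := to_poly_unit_lead f0.
pose I' (c : {mpoly k[n]}) := I (of_poly h c%:P).
have I'I : is_ideal I'.
  split; rewrite /I'; first by rewrite polyC0 (rmorph0 (of_poly h)).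
    by move=> x y Ix Iy; rewrite (polyCD x y) (rmorphD (of_poly h)); exact: ID Ix Iy.
  by move=> a x Ix; rewrite polyCM (rmorphM (of_poly h)); exact: IM Ix.
have [|s [e [y [sreg sI se yI]]]] := IHn I' I'I; first by rewrite /I' polyC1 rmorph1.
exists (map (of_poly h) (to_poly h f :: map polyC s)), e.
exists (fun i => of_poly h (y i)%:P); split.
- apply: (regular_rmorph (@of_polyK _ _ h) (@to_polyK _ _ h)).
  split; first exact: regular_polyC.
  by move=> x; apply: gens_polyC_monic uf.
- move=> x; rewrite /= inE => /orP [/eqP ->|]; first by rewrite to_polyK.
  by rewrite -map_comp => /mapP [g /sI I'g ->].
- by rewrite /= !size_map addSn se.
- move=> F IF; apply: yI; rewrite /I'; suff -> : of_poly h (subst y F)%:P =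
    subst (fun i => of_poly h (y i)%:P) F by [].
  apply: etrans (rmorph_mmap (of_poly h \o polyC) _ _ _) _.
  by apply: eq_mmap => c //=; rewrite of_polyC of_poly_coefC.
Qed.

(** The nonzero elements of k[y] form a multiplicative set that misses I. *)
Lemma indep_prime n e (y : 'I_e -> {mpoly k[n]}) I :
  is_ideal I -> indep y I ->
  exists P : prime_idealr {mpoly k[n]},
    (forall x, I x -> x \in P) /\ indep y (fun x => x \in P).
Proof.
move=> II yI; pose T x := exists F, F != 0 /\ x = subst y F.
have [||x [F [F0 ->]] /yI/eqP|P [IP TP]] := @prime_disjoint _ I T II.
- by exists 1; rewrite oner_neq0 rmorph1.
- move=> _ _ [F [F0 ->]] [G [G0 ->]]; exists (F * G).
  by rewrite mulf_neq0 // rmorphM.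
- by rewrite (negPf F0).
exists P; split=> // F; apply: contraTeq => F0; apply: TP.
by exists F.
Qed.

(** An element c of P outside Q can be added to y: in a relation F(y, c) in Q,
    reduction modulo P shows that the constant term in c vanishes, and then c
    can be cancelled because Q is prime. *)
Lemma indep_extend n e (y : 'I_e -> {mpoly k[n]})
    (Q P : prime_idealr {mpoly k[n]}) :
  strict_subset Q P -> indep y (fun x => x \in P) ->
  exists y' : 'I_e.+1 -> {mpoly k[n]}, indep y' (fun x => x \in Q).
Proof.
move=> [QP [c cP cQ]] yP.
pose y' i := if unlift ord0 i is Some j then y j else c; exists y' => F.
pose ev (q : {poly {mpoly k[e]}}) := (map_poly (subst y) q).[c].
have -> : subst y' F = ev (to_poly (fun=> 0) F).
  apply: esym; apply: etrans (rmorph_mmap (horner_eval c \o map_poly (subst y)) _ _ _) _.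
  apply: eq_mmap => [a|i] /=.
    by rewrite map_polyC /horner_eval hornerC /= /subst mmapC.
  rewrite /to_poly_var /y'; case: unliftP => [j|] _.
    rewrite /liftC map_poly0 addr0 map_polyC /horner_eval hornerC /= /subst.
    by rewrite mmapX mmap1U.
  by rewrite map_polyX /horner_eval hornerX.
move=> evQ; apply: (can_inj (@to_polyK k e (fun=> 0))); rewrite rmorph0.
move: (to_poly _ F) evQ => q; elim/poly_ind: q => // q a IHq evQ.
have evE : ev (q * 'X + a%:P) = ev q * c + subst y a.
  rewrite /ev rmorphD rmorphM /= map_polyX map_polyC /=.
  by rewrite hornerD hornerM hornerX hornerC.
have a0 : a = 0.
  apply: yP; have -> : subst y a = ev (q * 'X + a%:P) - ev q * c.
    by rewrite evE addrAC subrr add0r.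
  by rewrite rpredB ?idealMr //; apply: QP.
rewrite a0 addr0 IHq ?mul0r //; move: evQ; rewrite evE a0 rmorph0 addr0.
by rewrite prime_idealrM (negPf cQ) orbF.
Qed.

Lemma msize_mul_leS n (p q : {mpoly k[n]}) a b :
  (msize p <= a.+1 -> msize q <= b.+1 -> msize (p * q) <= (a + b).+1)%N.
Proof.
have [->|p0] := eqVneq p 0; first by rewrite mul0r msize0.
have [->|q0] := eqVneq q 0; first by rewrite mulr0 msize0.
move=> pa qb; rewrite msizeM // -subn1 leq_subLR.
by rewrite (leq_trans (leq_add pa qb)) // addSn addnS.
Qed.

(** More than n polynomials in n variables are algebraically dependent. The
    monomials with exponents below T in N letters are T^N in number, and
    substituting y turns them into combinations of monomials with exponents
    below M, of which there are only M^n; linear algebra gives a relation as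
    soon as M^n < T^N. *)
Lemma subst_dependent n N (y : 'I_N -> {mpoly k[n]}) :
  (n < N)%N -> exists F, F != 0 /\ subst y F = 0.
Proof.
move=> ltnN; pose D := (\max_i msize (y i))%N.
(* D bounds the degrees of the y_i, so a monomial with exponents below T is
   sent to degree below M; T exceeds (N D + 1)^n, so that M^n = T^n (N D +
   1)^n < T^(n + 1). *)
pose T := ((N * D).+1 ^ n).+1; pose M := (T * (N * D).+1)%N.
pose A := {ffun 'I_N -> 'I_T}; pose B := {ffun 'I_n -> 'I_M}.
pose expA (a : A) : 'X_{1..N} := [multinom (a i : nat) | i < N].
pose expB (b : B) : 'X_{1..n} := [multinom (b i : nat) | i < n].
pose C : 'M[k]_(#|{: A}|, #|{: B}|) :=
  \matrix_(i, j) (subst y 'X_[expA (enum_val i)])@_(expB (enum_val j)).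
have ltBA : (#|{: B}| < #|{: A}|)%N.
  rewrite !card_ffun !card_ord /M expnMn.
  apply: (@leq_trans (T ^ n.+1)%N); last by rewrite leq_pexp2l.
  by rewrite expnSr ltn_pmul2l ?expn_gt0.
have : kermx C != 0.
  rewrite -mxrank_eq0 mxrank_ker subn_eq0 -ltnNge.
  exact: leq_ltn_trans (rank_leq_col C) ltBA.
case/rowV0Pn => v /sub_kermxP vC v0.
pose F := \sum_i v 0 i *: 'X_[expA (enum_val i)].
have expA_inj : injective expA.
  by move=> a a' /mnmP E; apply/ffunP => i; apply/val_inj; have := E i; rewrite !mnmE.
exists F; split.
  case/rV0Pn: v0 => i vi; apply: contraNneq vi => F0.
  have : F@_(expA (enum_val i)) = 0 by rewrite F0 mcoeff0.
  rewrite /F raddf_sum /= (bigD1 i) //= big1 ?addr0 => [|j ji].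
    by rewrite mcoeffZ mcoeffX eqxx mulr1 => ->.
  rewrite mcoeffZ mcoeffX (_ : _ == _ = false) ?mulr0 //.
  by apply: contraNF ji => /eqP /expA_inj /enum_val_inj ->.
have substE : subst y F = \sum_i v 0 i *: subst y 'X_[expA (enum_val i)].
  by rewrite rmorph_sum; apply: eq_bigr => i _; rewrite /= /subst mmapZ mul_mpolyC.
have size_term a : (msize (subst y 'X_[expA a]) <= M)%N.
  rewrite /subst mmapX /mmap1; apply: (@leq_trans (\sum_i (a i * D)).+1).
    elim/big_rec2: _ => [|i w q _ IHq]; first by rewrite msize1.
    have yD : (msize (y i) <= D.+1)%N by rewrite leqW // /D (bigmax_sup i).
    have pow j : (msize (y i ^+ j) <= (j * D).+1)%N.
      elim: j => [|j IHj]; first by rewrite expr0 msize1.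
      by rewrite exprS mulSn; apply: msize_mul_leS.
    by rewrite mnmE; apply: msize_mul_leS.
  rewrite /M mulnS -add1n leq_add //.
  have -> : (T * (N * D) = \sum_(i < N) T * D)%N.
    by rewrite sum_nat_const card_ord mulnCA.
  by apply: leq_sum => i _; rewrite leq_mul2r ltnW ?orbT.
apply/mpolyP => m; rewrite mcoeff0 substE raddf_sum /=.
have [mM|] := boolP [forall i, m i < M]%N.
  pose b : B := [ffun i => Ordinal (forallP mM i)].
  have mE : m = expB b by apply/mnmP => i; rewrite mnmE ffunE.
  have := congr1 (fun u : 'M_(_, _) => u 0 (enum_rank b)) vC; rewrite !mxE => vCb.
  rewrite -[RHS]vCb; by apply: eq_bigr => i _; rewrite mcoeffZ mxE enum_rankK mE.
rewrite negb_forall => /existsP [i]; rewrite -leqNgt => Mm.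
apply: big1 => j _; rewrite mcoeffZ (_ : _@_m = 0) ?mulr0 //.
apply/eqP; rewrite mcoeff_eq0; apply: msize_mdeg_ge.
rewrite (leq_trans (size_term _)) // (leq_trans Mm) // mdegE (bigD1 i) //=.
exact: leq_addr.
Qed.

(** Going down a chain of primes ending at P, the number of elements
    independent modulo the prime increases by at least one at each step, and
    it never exceeds n. *)
Lemma prime_chain_indep n e h (y : 'I_e -> {mpoly k[n]})
    (P : prime_idealr {mpoly k[n]}) :
  prime_chain h P -> indep y (fun x => x \in P) -> (h + e <= n)%N.
Proof.
elim: h e y P => [|h IHh] e y P.
  move=> _ yP; rewrite add0n leqNgt; apply/negP => lt_ne.
  have [F [/eqP F0 Fy]] := subst_dependent y lt_ne.
  by apply: F0; apply: yP; rewrite Fy rpred0.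
move=> /prime_chain_pred [Q [Qh QP]] yP.
by have [y' /(IHh _ _ _ Qh)] := indep_extend QP yP; rewrite addnS addSn.
Qed.

(** Noether normalization provides a regular sequence s in I and n - size s
    elements independent modulo I. The first bounds the height of all primes
    over I from below; a prime over I modulo which the second remain
    independent has height at most size s. *)
Theorem has_height_regular n (I : {mpoly k[n]} -> Prop) :
  is_ideal I -> ~ I 1 ->
  exists s, [/\ regular s, {in s, forall x, I x} & has_height I (size s)].
Proof.
move=> II I1; have [s [e [y [sreg sI se yI]]]] := noether_normalization II I1.
exists s; split=> //; split.
  have [P [IP yP]] := indep_prime II yI; exists P; split=> //; split.
    by apply: prime_chain_regular => // x /sI /IP.
  by move=> h' /prime_chain_indep /(_ yP) le_n; rewrite -(leq_add2r e) se.
move=> P h' IP Ph; exact: height_ge_regular sreg sI IP Ph.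
Qed.

Lemma has_height_seq n (I : {mpoly k[n]} -> Prop) h :
  is_ideal I -> has_height I h ->
  exists s, [/\ regular s, {in s, forall x, I x} & size s = h].
Proof.
move=> II Ih; have I1 := has_height_proper II Ih.
have [s [sreg sI sh]] := has_height_regular II I1.
by exists s; split=> //; apply: has_height_uniq sh Ih.
Qed.

End Normalization.

(** * Noetherian rings and minimal primes *)

Section Span.
Variables (R : comNzRingType) (V : lmodType R).
Implicit Types (s : seq V) (Z : V -> Prop).

Definition is_submodule Z : Prop :=
  [/\ Z 0, forall x y, Z x -> Z y -> Z (x + y) & forall (a : R) x, Z x -> Z (a *: x)].

Fixpoint lspan s (x : V) : Prop :=
  if s is v :: s' then exists (a : R) y, lspan s' y /\ x = a *: v + y else x = 0.

Lemma lspan_submodule s : is_submodule (lspan s).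
Proof.
elim: s => [|g s [s0 sD sM]] /=.
  by split=> [|x y -> ->|a x ->] //; rewrite ?addr0 ?scaler0.
split.
- by exists 0, 0; rewrite scale0r addr0.
- move=> _ _ [a [y [sy ->]]] [b [z [sz ->]]]; exists (a + b), (y + z).
  by split; [apply: sD | rewrite scalerDl addrACA].
- move=> c _ [a [y [sy ->]]]; exists (c * a), (c *: y).
  by split; [apply: sM | rewrite scalerDr scalerA].
Qed.

Lemma lspan_mem s x : x \in s -> lspan s x.
Proof.
elim: s => //= g s IHs; rewrite inE => /orP [/eqP -> | /IHs sx].
  by exists 1, 0; rewrite scale1r addr0; split=> //; case: (lspan_submodule s).
by exists 0, x; rewrite scale0r add0r.
Qed.

Lemma lspan_sub s Z :
  is_submodule Z -> {in s, forall v, Z v} -> forall x, lspan s x -> Z x.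
Proof.
move=> II; elim: s => [_ x -> | g s IHs sI x [a [y [sy ->]]]]; first by case: II.
case: (II) => _ ID IM; apply: ID; first by apply: IM; apply: sI; apply: mem_head.
by apply: IHs => // h sh; apply: sI; rewrite inE sh orbT.
Qed.

Lemma submodule_sum Z (A : Type) (r : seq A) (p : pred A) (F : A -> V) :
  is_submodule Z -> (forall i, p i -> Z (F i)) -> Z (\sum_(i <- r | p i) F i).
Proof. by case=> I0 ID _ IF; apply: (big_ind Z). Qed.

End Span.

Definition noetherian (R : comNzRingType) : Prop :=
  forall I : R -> Prop, is_ideal I ->
  exists2 s, {in s, forall x, I x} & forall x, I x -> gens s x.

Section HilbertBasis.
Variable S : comNzRingType.

(** Elements of an ideal generated by leading coefficients of polynomials in I
    of degree at most N are again coefficients of elements of I, in every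
    degree j >= N: the polynomials are shifted to degree j before being
    combined. *)
Lemma lift_leading_coefs (I : {poly S} -> Prop) N (s : seq S) :
  {in s, forall a, exists f j, [/\ I f, (j <= N)%N, (size f <= j.+1)%N & f`_j = a]} ->
  exists2 t, {in t, forall f, I f} &
    forall c j, gens s c -> (N <= j)%N ->
    exists f, [/\ gens t f, (size f <= j.+1)%N & f`_j = c].
Proof.
elim: s => [_|a s IHs aN].
  by exists [::] => // c j -> _; exists 0; rewrite size_poly0 coef0.
have [|t tI tP] := IHs; first by move=> b bs; apply: aN; rewrite inE bs orbT.
have [f [i [If iN szf fi]]] := aN a (mem_head _ _).
exists (f :: t) => [g|]; first by rewrite inE => /orP [/eqP ->|/tI].
move=> _ j [b [c [/tP sc ->]]] Nj; have [g [tg szg gj]] := sc j Nj.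
have ij : (i <= j)%N := leq_trans iN Nj.
exists (b%:P * 'X^(j - i) * f + g); split.
- by exists (b%:P * 'X^(j - i)), g.
- rewrite (leq_trans (size_polyD _ _)) // geq_max szg andbT -mulrA mul_polyC.
  rewrite (leq_trans (size_scale_leq _ _)) // mulrC.
  have [->|f0] := eqVneq f 0; first by rewrite mul0r size_poly0.
  by rewrite size_mulXn // -(subnK ij) addnK -addnS leq_add2l.
- rewrite coefD gj -mulrA coefCM ['X^_ * _]mulrC coefMXn.
  by rewrite ltnNge leq_subr /= subKn // fi.
Qed.

(** A finite set of generators of the ideal of all leading coefficients
    reduces every polynomial of I to degree below some N; below N the ideals
    of leading coefficients in each single degree are treated one by one. *)
Theorem hilbert_basis : noetherian S -> noetherian {poly S}.
Proof.
move=> noethS I II; have [I0 ID IM] := II.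
have lead_ideal (D : nat -> Prop) : (exists j, D j) ->
    (forall i j, D i -> D j -> exists m, [/\ D m, (i <= m)%N & (j <= m)%N]) ->
    is_ideal (fun c => exists f j, [/\ I f, D j, (size f <= j.+1)%N & f`_j = c]).
  move=> [j0 Dj0] Dmax; split.
  - by exists 0, j0; rewrite size_poly0 coef0.
  - move=> _ _ [f [i [If Di szf <-]]] [g [j [Ig Dj szg <-]]].
    have [m [Dm im jm]] := Dmax i j Di Dj.
    have shift (u : {poly S}) l : (l <= m)%N -> (size u <= l.+1)%N ->
        (size (u * 'X^(m - l))%R <= m.+1)%N /\ (u * 'X^(m - l))`_m = u`_l.
      move=> lm szu; rewrite coefMXn ltnNge leq_subr /= subKn //; split=> //.
      have [->|u0] := eqVneq u 0; first by rewrite mul0r size_poly0.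
      by rewrite size_mulXn // -{2}(subnK lm) -addnS leq_add2l.
    have [szf' f'm] := shift f i im szf; have [szg' g'm] := shift g j jm szg.
    exists (f * 'X^(m - i) + g * 'X^(m - j)), m; split=> //.
    + by apply: ID; rewrite mulrC; apply: IM.
    + by rewrite (leq_trans (size_polyD _ _)) // geq_max szf'.
    + by rewrite coefD f'm g'm.
  - move=> a _ [f [j [If Dj szf <-]]]; exists (a%:P * f), j; split=> //.
    + exact: IM.
    + by rewrite mul_polyC (leq_trans (size_scale_leq _ _)).
    + by rewrite coefCM.
have [N [t tI tP]] : exists N, exists2 t, {in t, forall f, I f} &
    forall f j, I f -> (size f <= j.+1)%N -> (N <= j)%N ->
    exists g, [/\ gens t g, (size g <= j.+1)%N & g`_j = f`_j].
  have [||s sI sP] := noethS _ (lead_ideal (fun=> True) _ _).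
  - by exists 0%N.
  - by move=> i j _ _; exists (maxn i j); rewrite leq_maxl leq_maxr.
  have [N sN] : exists N, {in s, forall a, exists f j,
      [/\ I f, (j <= N)%N, (size f <= j.+1)%N & f`_j = a]}.
    elim: s sI {sP} => [|a s IHs] sI; first by exists 0%N.
    have [|N sN] := IHs; first by move=> b bs; apply: sI; rewrite inE bs orbT.
    have [f [j [If _ szf fj]]] := sI a (mem_head _ _).
    exists (maxn j N) => b; rewrite inE => /orP [/eqP ->|/sN [g [i [Ig iN szg gi]]]].
      by exists f, j; rewrite leq_maxl.
    by exists g, i; split=> //; rewrite leq_max iN orbT.
  exists N; have [t tI tP] := lift_leading_coefs sN; exists t => // f j If szf Nj.
  by apply: tP => //; apply: sP; exists f, j.
have [t' t'I t'P] : exists2 t', {in t', forall f, I f} &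
    forall f, I f -> (size f <= N)%N -> gens t' f.
  elim: N {tP} => [|m [t' t'I t'P]].
    exists [::] => // f _; rewrite leqn0 size_poly_eq0 => /eqP ->; by [].
  have [||s sI sP] := noethS _ (lead_ideal (fun j => j = m) _ _).
  - by exists m.
  - by move=> i j -> ->; exists m.
  have [|u uI uP] := @lift_leading_coefs I m s.
    by move=> a /sI [f [j [If -> szf fm]]]; exists f, m.
  exists (u ++ t') => [f|f If szf]; first by rewrite mem_cat => /orP [/uI|/t'I].
  have [|g [ug szg gm]] := uP f`_m m _ (leqnn m); first by apply: sP; exists f, m.
  have Ig : I g by apply: gens_sub ug.
  have sub v : {subset v <= u ++ t'} -> forall x, gens v x -> gens (u ++ t') x.
    by move=> vut; apply: gens_sub (gens_ideal _) _ => x /vut /gens_mem.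
  rewrite -(subrK g f); have [_ + _] := gens_ideal (u ++ t'); apply; last first.
    by apply: sub ug => x; rewrite mem_cat => ->.
  apply: (sub t') => [x|]; first by rewrite mem_cat orbC => ->.
  apply: t'P; first exact: is_idealB.
  have szfg : (size (f - g)%R <= m.+1)%N.
    by rewrite (leq_trans (size_polyD _ _)) // geq_max szf size_polyN.
  apply/leq_sizeP => j; rewrite leq_eqVlt => /orP [/eqP <-|mj].
    by rewrite coefB gm subrr.
  by move/leq_sizeP: szfg; apply.
exists (t ++ t') => [f|]; first by rewrite mem_cat => /orP [/tI|/t'I].
have sub v : {subset v <= t ++ t'} -> forall x, gens v x -> gens (t ++ t') x.
  by move=> vut; apply: gens_sub (gens_ideal _) _ => x /vut /gens_mem.
move=> f; have [m] := ubnP (size f); elim: m f => // m IHm f /ltnSE-szf If.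
have [ltNf|leNf] := ltnP N (size f); last first.
  by apply: (sub t') => [x|]; [rewrite mem_cat orbC => -> | apply: t'P].
have szf' : size f = (size f).-1.+1 by rewrite (ltn_predK ltNf).
have [||g [tg szg gf]] := tP f (size f).-1 If; first by rewrite -szf'.
  by rewrite -ltnS -szf'.
have Ig : I g by apply: gens_sub tg.
rewrite -(subrK g f); have [_ + _] := gens_ideal (t ++ t'); apply; last first.
  by apply: sub tg => x; rewrite mem_cat => ->.
apply: IHm; last exact: is_idealB.
apply: leq_trans szf; rewrite szf' ltnS; apply/leq_sizeP => j.
rewrite leq_eqVlt => /orP [/eqP <-|jf]; first by rewrite coefB gf subrr.
have szfg : (size (f - g)%R <= (size f).-1.+1)%N.
  by rewrite (leq_trans (size_polyD _ _)) // geq_max size_polyN szg -szf' leqnn.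
by move/leq_sizeP: szfg; apply.
Qed.

End HilbertBasis.

Lemma noetherian_mpoly (k : fieldType) n : noetherian {mpoly k[n]}.
Proof.
elim: n => [|n /hilbert_basis noethS] I II; have [I0 ID IM] := II.
  have [[f [If f0]]|nof] := boolp.pselect (exists f, I f /\ f != 0).
    exists [:: f] => [g|g Ig]; first by rewrite inE => /eqP ->.
    have fE : f = (f@_0)%:MP by rewrite mpolyKC.
    exists (g * (f@_0)^-1%:MP), 0; rewrite addr0 -mulrA {2}fE -mpolyCM mulVf ?mulr1 //.
    by apply: contraNneq f0; rewrite {2}fE => ->; rewrite mpolyC0.
  exists [::] => // g Ig /=; have [//|g0] := eqVneq g 0.
  by case: nof; exists g.
pose h (j : 'I_n) : {poly k} := 0.
have [|s sI sP] := noethS (fun q => I (of_poly h q)).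
  split; first by rewrite (rmorph0 (of_poly h)).
    by move=> x y Ix Iy; rewrite (rmorphD (of_poly h)); exact: ID Ix Iy.
  by move=> a x Ix; rewrite (rmorphM (of_poly h)); exact: IM Ix.
exists (map (of_poly h) s) => [_ /mapP [q /sI Iq ->] //|x Ix].
rewrite -(to_polyK h x); apply: gens_rmorph; apply: sP.
by rewrite to_polyK.
Qed.

(** Induction on p: generators lifted from the ideal of first coordinates,
    together with generators of the submodule of vectors with first coordinate
    0. *)
Lemma submodule_fg (R : comNzRingType) p (Z : 'cV[R]_p -> Prop) :
  noetherian R -> is_submodule Z ->
  exists2 s, {in s, forall v, Z v} & forall v, Z v -> lspan s v.
Proof.
move=> noethR; elim: p Z => [|p IHp] Z ZM; have [Z0 ZD ZS] := ZM.
  by exists [::] => // v _; rewrite /= [v]flatmx0 flatmx0.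
have [|s sI sP] := noethR (fun c => exists2 v, Z v & v 0 0 = c).
  split; first by exists 0 => //; rewrite mxE.
    by move=> _ _ [v Zv <-] [w Zw <-]; exists (v + w); [apply: ZD | rewrite mxE].
  by move=> a _ [v Zv <-]; exists (a *: v); [apply: ZS | rewrite mxE].
have [t tZ tP] : exists2 t, {in t, forall v, Z v} &
    forall c, gens s c -> exists2 v, lspan t v & v 0 0 = c.
  elim: s sI {sP} => [|a s IHs] sI.
    by exists [::] => // c ->; exists 0; rewrite ?mxE.
  have [|t tZ tP] := IHs; first by move=> b bs; apply: sI; rewrite inE bs orbT.
  have [v Zv va] := sI a (mem_head _ _).
  exists (v :: t) => [w|]; first by rewrite inE => /orP [/eqP ->|/tZ].
  move=> _ [b [c [/tP [w tw wc] ->]]]; exists (b *: v + w); first by exists b, w.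
  by rewrite !mxE va wc.
have [|u uZ uP] := IHp (fun w => Z (col_mx (0 : 'M_1) w)).
  split.
  - by rewrite col_mx0.
  - by move=> x y Zx Zy; rewrite -[0]addr0 -add_col_mx; apply: ZD.
  - by move=> a x Zx; rewrite -[0](scaler0 _ a) -scale_col_mx; apply: ZS.
pose u' := map (fun w => col_mx (0 : 'M_1) w) u.
exists (t ++ u') => [v|v Zv].
  by rewrite mem_cat => /orP [/tZ //|/mapP [w /uZ Zw ->]].
have sub w : {subset w <= t ++ u'} -> forall x, lspan w x -> lspan (t ++ u') x.
  by move=> wtu; apply: lspan_sub (lspan_submodule _) _ => x /wtu /lspan_mem.
have [|w tw wv] := tP (v 0 0); first by apply: sP; exists v.
rewrite -(subrK w v); have [_ + _] := lspan_submodule (t ++ u'); apply; last first.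
  by apply: sub tw => x; rewrite mem_cat => ->.
have Zw : Z w by apply: lspan_sub tw.
have Zvw : Z (v - w) by apply: ZD => //; rewrite -scaleN1r; apply: ZS.
have vwE : v - w = col_mx (0 : 'M_1) (@dsubmx _ 1 p 1 (v - w)).
  have vw0 : @usubmx _ 1 p 1 (v - w) = 0.
    apply/matrixP => i j.
    by rewrite !ord1 !mxE (_ : lshift p 0 = 0) ?wv ?subrr //; apply: val_inj.
  by rewrite -{1}[v - w](@vsubmxK _ 1 p) vw0.
apply: (sub u') => [x|]; first by rewrite mem_cat orbC => ->.
rewrite vwE in Zvw *; move: (dsubmx _) (uP _ Zvw) => x.
rewrite /u'; elim: (u) x => [x ->|a l IHl x [b [y [/IHl ly ->]]]] /=.
  by rewrite col_mx0.
exists b, (col_mx (0 : 'M_1) y); split=> //.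
have E : col_mx 0 (b *: a + y) = b *: col_mx 0 a + col_mx 0 y :> 'cV[R]_(1 + p).
  by rewrite scale_col_mx add_col_mx scaler0 addr0.
exact: E.
Qed.

(** A prime P minimal over Q is associated to Q. Every x in P has a power
    killed modulo Q by an element outside P, for otherwise a prime over Q
    missing x would lie inside P. Multiplying suitable powers of the
    generators of P gives an element z outside Q that multiplies each of them
    into Q. *)
Lemma minimal_prime_annihilator (R : comNzRingType) (P : prime_idealr R) (Q : R -> Prop) :
  noetherian R -> is_ideal Q -> (forall x, Q x -> x \in P) ->
  (forall P' : prime_idealr R, (forall x, Q x -> x \in P') -> ~ strict_subset P' P) ->
  exists2 z, ~ Q z & forall x, x \in P -> Q (z * x).
Proof.
move=> noethR QI QP Pmin; have [Q0 QD QM] := QI.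
have [s sP sgen] := noethR _ (prime_is_ideal P).
have nilp x : x \in P -> exists j t, t \notin P /\ Q (t * x ^+ j).
  move=> xP; apply: boolp.contrapT => nox.
  pose T y := exists j t, t \notin P /\ y = t * x ^+ j.
  have [|||P' [QP' TP']] := @prime_disjoint R Q T QI.
  - by exists 0%N, 1; rewrite prime1 mulr1.
  - move=> _ _ [i [t [tP ->]]] [j [u [uP ->]]]; exists (i + j)%N, (t * u).
    by rewrite prime_idealrM negb_or tP uP exprD mulrACA.
  - by move=> _ [j [t [tP ->]]] Qt; apply: nox; exists j, t.
  case: (Pmin P' QP'); split=> [y|].
    by apply: contraLR => yP; apply: TP'; exists 0%N, y; rewrite mulr1.
  by exists x => //; apply: TP'; exists 1%N, 1; rewrite prime1 mul1r.
have [z zP zs] : exists2 z, (forall t, t \notin P -> ~ Q (t * z)) &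
    {in s, forall x, Q (z * x)}.
  elim: s sP {sgen} => [|x s IHs] sP.
    by exists 1 => // t tP; rewrite mulr1 => /QP; apply/negP.
  have [|z zP zs] := IHs; first by move=> y ys; apply: sP; rewrite inE ys orbT.
  have [j [t [tP Qt]]] := nilp x (sP x (mem_head _ _)).
  pose bad j := boolp.asbool (exists2 t, t \notin P & Q (t * z * x ^+ j)).
  have exj : exists j, bad j.
    by exists j; apply/boolp.asboolP; exists t => //; rewrite mulrAC mulrC; apply: QM.
  case: (ex_minnP exj) => m /boolp.asboolP [u uP Qu] mmin.
  case: m Qu mmin => [|m] Qu mmin; first by case: (zP u uP); rewrite mulr1 in Qu.
  exists (u * z * x ^+ m).
    move=> v vP Qv; have : bad m.
      apply/boolp.asboolP; exists (v * u); last by rewrite -!mulrA in Qv *.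
      by rewrite prime_idealrM negb_or vP.
    by move/mmin; rewrite ltnn.
  move=> y; rewrite inE => /orP [/eqP ->|/zs Qzy]; first by rewrite -mulrA -exprSr.
  have -> : u * z * x ^+ m * y = u * x ^+ m * (z * y) by ring.
  exact: QM.
exists z => [Qz|x /sgen]; first by apply: (zP 1 (prime1 P)); rewrite mul1r.
apply: (@gens_sub _ _ (fun y => Q (z * y))) => //; split; first by rewrite mulr0.
  by move=> a b Qa Qb; rewrite mulrDr; apply: QD.
by move=> a b Qb; rewrite mulrCA; apply: QM.
Qed.

(** * Minimal homogeneous generators *)

Section MinimalGenerators.
Variables (k : fieldType) (n : nat).
Local Notation R := {mpoly k[n]}.

(** The condition on an entry of a homogeneous map R(-e) -> R(-a): degree e -
    a, and zero when this is negative. The truncated subtraction is exact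
    where it is used. *)
Definition graded_entry (a e : nat) (x : R) : Prop :=
  ((a <= e)%N -> x \is (e - a).-homog) /\ ((e < a)%N -> x = 0).

Lemma pihomog_mulr t e (p q : R) : q \is e.-homog ->
  pihomog mdeg t (p * q) = if (e <= t)%N then pihomog mdeg (t - e) p * q else 0.
Proof.
move=> qe; pose K := (msize p + t).+1.
rewrite {1}(@pihomog_partitionE _ _ mdeg K p); last by rewrite /K leqW ?leq_addr.
rewrite mulr_suml raddf_sum /=.
have term d : pihomog mdeg t (pihomog mdeg d p * q) =
    if (d + e == t)%N then pihomog mdeg d p * q else 0.
  have pq : pihomog mdeg d p * q \is (d + e).-homog.
    by apply: dhomogM => //; apply: pihomogP.
  by case: eqVneq => [<-|ne]; [rewrite pihomog_dE | rewrite (pihomog_ne0 ne)].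
rewrite (eq_bigr _ (fun (d : 'I_K) _ => term d)) -big_mkcond /=.
case: leqP => [et|te]; last first.
  by apply: big1 => d /eqP dt; move: te; rewrite -dt ltnNge leq_addl.
have ltK : (t - e < K)%N by rewrite /K ltnS (leq_trans (leq_subr _ _)) // leq_addl.
rewrite (big_pred1 (Ordinal ltK)) // => d /=.
by rewrite -val_eqE /= -[in RHS](eqn_add2r e) subnK.
Qed.

Lemma pihomog0E (p : R) : pihomog mdeg 0 p = (p@_0)%:MP.
Proof.
apply/mpolyP => m; rewrite mcoeffC pihomogE raddf_sum /=.
rewrite (eq_bigr (fun m' => p@_m' * (m' == m)%:R)); last first.
  by move=> m' _; rewrite mcoeffZ mcoeffX.
have [->|m0] := eqVneq m 0%MM.
  rewrite mulr1; have [p0|] := boolP (0%MM \in msupp p).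
    rewrite big_mkcond (bigD1_seq 0%MM) ?msupp_uniq //= mdeg0 !eqxx mulr1.
    by rewrite big1 ?addr0 // => m' /negPf ->; rewrite mulr0 if_same.
  rewrite mcoeff_msupp negbK => /eqP p0; rewrite p0 big1 // => m' _.
  by case: eqVneq => [->|_]; rewrite ?p0 ?mul0r ?mulr0.
rewrite mulr0 big1 // => m'; rewrite mdeg_eq0 => /eqP ->.
by rewrite eq_sym (negPf m0) mulr0.
Qed.

Variables (p : nat) (a : 'I_p -> nat).
Implicit Types (v : 'cV[R]_p) (s : seq (nat * 'cV[R]_p)).

(** The component of degree t in the graded module that is the direct sum of
    the R(-a_i). *)
Definition component t v : 'cV[R]_p :=
  \col_i (if (a i <= t)%N then pihomog mdeg (t - a i) (v i 0) else 0).

Definition homog_vec e v := forall i, graded_entry (a i) e (v i 0).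

Lemma componentD t u v : component t (u + v) = component t u + component t v.
Proof.
by apply/matrixP => i j; rewrite !mxE; case: ifP => _; rewrite ?addr0 // raddfD.
Qed.

Lemma component0 t : component t 0 = 0.
Proof. by apply/matrixP => i j; rewrite !mxE; case: ifP => _; rewrite ?raddf0. Qed.

Lemma component_sum t (I : Type) (r : seq I) (F : I -> 'cV[R]_p) :
  component t (\sum_(i <- r) F i) = \sum_(i <- r) component t (F i).
Proof. exact: (big_morph _ (componentD t) (component0 t)). Qed.

Lemma component_scale t e c v : homog_vec e v ->
  component t (c *: v) = (if (e <= t)%N then pihomog mdeg (t - e) c else 0) *: v.
Proof.
move=> ve; apply/matrixP => i j; rewrite [j]ord1 !mxE.
have [leai|ltai] := leqP (a i) e; last first.
  by have [_ ->] := ve i; rewrite // !mulr0 raddf0 if_same.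
have [/(_ leai) vi _] := ve i; have [leait|ltait] := leqP (a i) t; last first.
  by rewrite leqNgt (leq_trans ltait leai) mul0r.
rewrite (pihomog_mulr _ _ vi) leq_sub2rE // subnBA // addnBAC // addnK.
by case: ifP => _; rewrite ?mul0r // -addnBA ?leqnn // subnn addn0.
Qed.

Lemma component_homog t v : homog_vec t (component t v).
Proof.
move=> i; rewrite mxE; split=> [->|]; first exact: pihomogP.
by rewrite ltnNge => /negPf ->.
Qed.

Lemma sum_components v : exists T, v = \sum_(t < T) component t v.
Proof.
pose T := (\max_i (a i + msize (v i 0%R)))%N; exists T.
apply/matrixP => i j; rewrite [j]ord1 summxE.
under eq_bigr => t _ do rewrite mxE.
have leT : (a i + msize (v i 0%R) <= T)%N by rewrite /T (bigmax_sup i).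
have leaT : (a i <= T)%N := leq_trans (leq_addr _ _) leT.
rewrite -(big_mkord predT (fun t => if (a i <= t)%N then
  pihomog mdeg (t - a i) (v i 0) else 0)) (big_cat_nat _ leaT) //=.
rewrite big1_seq ?add0r; last first.
  by move=> t; rewrite mem_index_iota /= => lt_t; rewrite leqNgt lt_t.
have -> : \sum_(a i <= t < T) (if (a i <= t)%N then pihomog mdeg (t - a i) (v i 0) else 0) =
    \sum_(0 <= t < T - a i) pihomog mdeg t (v i 0).
  rewrite -{1}[a i]add0n big_addn; apply: eq_bigr => t _.
  by rewrite leq_addl addnK.
rewrite big_mkord -pihomog_partitionE //.
by rewrite leq_subRL.
Qed.

(** A list of homogeneous generators of least size, sorted by degree. If a
    relation among them had a coefficient w_j with nonzero constant term, the
    homogeneous component of the relation in the degree of the j-th generator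
    would express that generator by the others. *)
Theorem minimal_homogeneous_generators (Z : 'cV[R]_p -> Prop) :
  is_submodule Z -> (forall t v, Z v -> Z (component t v)) ->
  exists q (Phi : 'M[R]_(p, q)) (e : nat -> nat),
  [/\ forall (i : 'I_p) (j : 'I_q), graded_entry (a i) (e j) (Phi i j),
      forall i j, (i <= j < q)%N -> (e i <= e j)%N,
      forall w : 'cV_q, Z (Phi *m w),
      forall v, Z v -> exists w : 'cV_q, v = Phi *m w
    & forall w : 'cV_q, Phi *m w = 0 -> forall j, (w j 0)@_0 = 0].
Proof.
move=> ZM Zgr; have [Z0 ZD ZS] := ZM.
pose generating s := (forall x, x \in s -> homog_vec x.1 x.2 /\ Z x.2) /\
  (forall v, Z v -> lspan (map snd s) v).
have [s0 s0gen] : exists s, generating s.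
  have [s sZ sgen] := submodule_fg (@noetherian_mpoly k n) ZM.
  have [s' [s'h s'gen]] : exists s', (forall x, x \in s' -> homog_vec x.1 x.2 /\ Z x.2) /\
      forall v, v \in s -> lspan (map snd s') v.
    elim: s sZ {sgen} => [_|v s IHs sZ]; first by exists [::].
    have [|s' [s'h s'gen]] := IHs; first by move=> u us; apply: sZ; rewrite inE us orbT.
    have [T vE] := sum_components v.
    exists ([seq (t, component t v) | t <- iota 0 T] ++ s'); split=> [x|u].
      rewrite mem_cat => /orP [/mapP [t _ ->] /=|/s'h //].
      by split; [apply: component_homog | apply/Zgr/sZ/mem_head].
    rewrite inE map_cat => /orP [/eqP ->|us]; last first.
      apply: lspan_sub (lspan_submodule _) _ _ (s'gen u us) => x xs'.
      by apply: lspan_mem; rewrite mem_cat xs' orbT.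
    rewrite [X in lspan _ X]vE; apply: submodule_sum (lspan_submodule _) _ => t _.
    apply: lspan_mem; rewrite mem_cat -map_comp; apply/orP; left.
    by apply/mapP; exists (t : nat); [rewrite mem_iota add0n ltn_ord |].
  exists s'; split=> // v /sgen; apply: lspan_sub (lspan_submodule _) s'gen v.
pose P q := boolp.asbool (exists s, generating s /\ size s = q).
have exP : exists q, P q by exists (size s0); apply/boolp.asboolP; exists s0.
case: (ex_minnP exP) => q /boolp.asboolP [s1 [s1gen s1q]] qmin.
pose s := sort (fun x y => x.1 <= y.1)%N s1.
have perm_s : perm_eq s s1 by apply/permPl/perm_sort.
have [sh sgen] : generating s.
  have [s1h s1g] := s1gen; split=> [x|v /s1g]; first by rewrite (perm_mem perm_s) => /s1h.
  apply: lspan_sub (lspan_submodule _) _ v => x xs1; apply: lspan_mem.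
  by rewrite (perm_mem (perm_map _ perm_s)).
have szs : size s = q by rewrite (perm_size perm_s).
have s_sorted : sorted leq (map fst s).
  by rewrite sorted_map; apply: sort_sorted => x y; apply: leq_total.
pose x0 : nat * 'cV[R]_p := (0%N, 0); pose e j := (nth x0 s j).1.
pose Phi : 'M[R]_(p, q) := \matrix_(i, j) (nth x0 s j).2 i 0.
have ins (j : 'I_q) : nth x0 s j \in s by rewrite mem_nth ?szs.
have PhiE w : Phi *m w = \sum_j w j 0 *: (nth x0 s j).2.
  apply/matrixP => i j; rewrite [j]ord1 summxE mxE.
  by apply: eq_bigr => l _; rewrite !mxE mulrC.
exists q, Phi, e; split.
- by move=> i j; rewrite mxE; have [/(_ i)] := sh _ (ins j).
- move=> i j /andP [ij jq].
  rewrite /e -!(nth_map x0 0%N) ?szs ?(leq_ltn_trans ij) //.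
  by apply: (sorted_leq_nth leq_trans leqnn) => //; rewrite inE size_map szs ?(leq_ltn_trans ij).
- move=> w; rewrite PhiE; apply: submodule_sum => // j _; apply: ZS.
  by have [] := sh _ (ins j).
- move=> v /sgen; apply: (lspan_sub (Z := fun v => exists w, v = Phi *m w)).
    split; first by exists 0; rewrite mulmx0.
      by move=> _ _ [w ->] [w' ->]; exists (w + w'); rewrite mulmxDr.
    by move=> c _ [w ->]; exists (c *: w); rewrite scalemxAr.
  move=> _ /mapP [x xs ->]; have jq : (index x s < q)%N by rewrite -szs index_mem.
  exists (delta_mx (Ordinal jq) 0); rewrite PhiE (bigD1 (Ordinal jq)) //= big1.
    by rewrite addr0 mxE !eqxx scale1r nth_index.
  by move=> i /negPf ij; rewrite mxE ij scale0r.
move=> w Phiw j; apply/eqP; apply: contraT => wj.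
pose c (i : 'I_q) := if (e i <= e j)%N then pihomog mdeg (e j - e i) (w i 0) else 0.
have rel : \sum_i c i *: (nth x0 s i).2 = 0.
  have : component (e j) (Phi *m w) = 0 by rewrite Phiw component0.
  rewrite PhiE component_sum => E; rewrite -[RHS]E.
  apply: eq_bigr => i _; have [sih _] := sh _ (ins i).
  by rewrite (component_scale _ _ sih).
pose rest := map (fun i : 'I_q => nth x0 s i) (enum (predC1 j)).
have : P (size rest).
  apply/boolp.asboolP; exists rest; split=> //; split=> [_ /mapP [i _ ->]|v /sgen].
    exact: sh.
  apply: lspan_sub (lspan_submodule _) _ v => _ /mapP [x xs ->].
  have jq : (index x s < q)%N by rewrite -szs index_mem.
  have other i : i != j -> lspan (map snd rest) (nth x0 s i).2.
    move=> ij; apply: lspan_mem; apply: map_f; apply/mapP; exists i => //.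
    by rewrite mem_enum inE.
  rewrite -(nth_index x0 xs) -[index x s]/(nat_of_ord (Ordinal jq)).
  have [->|] := eqVneq (Ordinal jq) j; last exact: other.
  have cjE : c j = ((w j 0)@_0)%:MP by rewrite /c leqnn subnn pihomog0E.
  have [_ _ lspanS] := lspan_submodule (map snd rest).
  have -> : (nth x0 s j).2 = (- ((w j 0)@_0)^-1)%:MP *: \sum_(i | i != j) c i *: (nth x0 s i).2.
    move: rel; rewrite (bigD1 j) //= => /eqP; rewrite addrC addr_eq0 => /eqP ->.
    by rewrite scalerN cjE scalerA -scaleNr -mpolyCM -rmorphN /= mulNr opprK mulVf // scale1r.
  apply: lspanS; apply: submodule_sum (lspan_submodule _) _ => i ij.
  have [_ _ lspanS'] := lspan_submodule (map snd rest).
  by apply: lspanS'; apply: other.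
move/qmin; rewrite size_map -cardE cardC1 card_ord.
by rewrite leqNgt -subn1 ltn_subrL (leq_ltn_trans _ (ltn_ord j)).
Qed.

End MinimalGenerators.

(** * Projective resolutions against matrix resolutions *)

Section Lifting.
Variable R : nzRingType.

Section Pullback.
Variables (P M N : lmodType R) (f : {linear P -> N}) (g : {linear M -> N}).

Definition in_pullback : {pred P * M} := fun x => f x.1 == g x.2.

Lemma in_pullback_submod : submod_closed in_pullback.
Proof.
split=> [|a x y]; rewrite !unfold_in /=; first by rewrite !linear0.
by rewrite !linearP => /eqP -> /eqP ->.
Qed.

HB.instance Definition _ :=
  GRing.isSubmodClosed.Build R (P * M)%type in_pullback in_pullback_submod.

Definition pullback : Type := {x : P * M | x \in in_pullback}.

HB.instance Definition _ := [isSub of pullback for @sval _ _].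
HB.instance Definition _ := [Choice of pullback by <:].
HB.instance Definition _ := [SubChoice_isSubLmodule of pullback by <:].

End Pullback.

Lemma linear_of (V W : lmodType R) (f : V -> W) :
  linear f -> exists h : {linear V -> W}, h =1 f.
Proof.
move=> lf; pose h : {linear V -> W} :=
  HB.pack f (GRing.isLinear.Build R V W *:%R f lf).
by exists h.
Qed.

(** Projectivity is stated for surjections only. For a map g whose image
    merely contains that of f, one lifts the identity of P along the
    projection of the pullback, which is surjective. *)
Lemma projective_lift (P M N : lmodType R) (f : {linear P -> N}) (g : {linear M -> N}) :
  projective P -> (forall x, exists y, g y = f x) ->
  exists h : {linear P -> M}, forall x, g (h x) = f x.
Proof.
move=> Pproj fg; pose Q : lmodType R := pullback f g.
have [pi1 pi1E] : exists pi1 : {linear Q -> P}, forall z, pi1 z = (val z).1.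
  by apply: linear_of => a x y; rewrite linearP.
have [|h hE] := @Pproj Q P pi1 idfun.
  move=> x; have [y gy] := fg x.
  have xy : (x, y) \in in_pullback f g by rewrite unfold_in /= gy.
  by exists (exist _ (x, y) xy); rewrite pi1E.
have [h' h'E] : exists h' : {linear P -> M}, forall x, h' x = (val (h x)).2.
  by apply: linear_of => a x y; rewrite !linearP.
exists h' => x; rewrite h'E; have := valP (h x); rewrite unfold_in => /eqP <-.
by rewrite -pi1E hE.
Qed.

Variables (M : lmodType R) (l : nat).
Variables (P : nat -> lmodType R) (dP : forall i, {linear P i.+1 -> P i}).
Variable (eP : {linear P 0%N -> M}).
Hypothesis Pproj : forall i, projective (P i).
Hypothesis Plength : forall i, (l < i)%N -> forall x : P i, x = 0.
Hypothesis eP_surj : forall y, exists x, eP x = y.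
Hypothesis P_exact0 : forall x, eP x = 0 <-> exists z, dP 0%N z = x.
Hypothesis P_exact : forall i x, dP i x = 0 <-> exists z, dP i.+1 z = x.

Variables (F0 F1 : lmodType R) (e : {linear F0 -> M}) (d1 : {linear F1 -> F0}).
Hypothesis F0proj : projective F0.
Hypothesis F1proj : projective F1.
Hypothesis e_surj : forall y, exists x, e x = y.
Hypothesis F_exact0 : forall x, e x = 0 <-> exists z, d1 z = x.

Let step1 : exists (a1 : {linear F1 -> P 1%N}) (b1 : {linear P 1%N -> F1})
    (s0 : {linear F0 -> F1}),
  [/\ forall x, d1 x = 0 -> dP 0%N (a1 x) = 0,
      forall x, d1 (x - b1 (a1 x) - s0 (d1 x)) = 0
    & forall x, dP 0%N x = 0 -> d1 (b1 x) = 0].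
Proof.
have [a0 a0E] := projective_lift (f := e) F0proj (fun x => eP_surj (e x)).
have [b0 b0E] := projective_lift (f := eP) (@Pproj 0%N) (fun x => e_surj (eP x)).
have [s0 s0E] : exists s0 : {linear F0 -> F1}, forall x, d1 (s0 x) = x - b0 (a0 x).
  apply: (@projective_lift _ _ _ (idfun \- (b0 \o a0))) => // x.
  by apply/F_exact0; rewrite linearB /= b0E a0E subrr.
have [a1 a1E] : exists a1 : {linear F1 -> P 1%N}, forall x, dP 0%N (a1 x) = a0 (d1 x).
  apply: (@projective_lift _ _ _ (a0 \o d1)) => // x.
  by apply/P_exact0; rewrite /= a0E; apply/F_exact0; exists x.
have [b1 b1E] : exists b1 : {linear P 1%N -> F1}, forall x, d1 (b1 x) = b0 (dP 0%N x).
  apply: (@projective_lift _ _ _ (b0 \o dP 0%N)) => // x.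
  by apply/F_exact0; rewrite /= b0E; apply/P_exact0; exists x.
exists a1, b1, s0; split=> x.
- by move=> dx; rewrite a1E dx linear0.
- by rewrite !linearB /= b1E s0E a1E opprB addrA subrK subrr.
- by move=> dx; rewrite b1E dx linear0.
Qed.

(** A comparison with the resolution P and back, a and b, is homotopic to the
    identity; the difference 1 - b a - s d maps into the kernel, and it is the
    identity on the kernel because a sends the kernel to the image of the
    module of P in degree 2, which is 0. *)
Lemma kernel_splits1 : (l <= 1)%N ->
  exists rho : {linear F1 -> F1},
    (forall x, d1 (rho x) = 0) /\ (forall x, d1 x = 0 -> rho x = x).
Proof.
move=> l1; have [a1 [b1 [s0 [a1k rho0 _]]]] := step1.
exists ((idfun \- (b1 \o a1)) \- (s0 \o d1)); split=> x; first exact: rho0.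
move=> dx; have a1x : a1 x = 0.
  by have /P_exact [z <-] := a1k x dx; rewrite (Plength _ z) ?linear0.
by rewrite /= a1x dx !linear0 !addr0.
Qed.

Variables (F2 : lmodType R) (d2 : {linear F2 -> F1}).
Hypothesis F2proj : projective F2.
Hypothesis F_exact1 : forall x, d1 x = 0 <-> exists z, d2 z = x.

(** The same argument one step further to the left. *)
Lemma kernel_splits2 : (l <= 2)%N ->
  exists rho : {linear F2 -> F2},
    (forall x, d2 (rho x) = 0) /\ (forall x, d2 x = 0 -> rho x = x).
Proof.
move=> l2; have [a1 [b1 [s0 [a1k rho0 b1k]]]] := step1.
have [s1 s1E] : exists s1 : {linear F1 -> F2},
    forall x, d2 (s1 x) = x - b1 (a1 x) - s0 (d1 x).
  apply: (@projective_lift _ _ _ ((idfun \- (b1 \o a1)) \- (s0 \o d1))) => // x.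
  by apply/F_exact1; apply: rho0.
have dd x : d1 (d2 x) = 0 by apply/F_exact1; exists x.
have ddP i x : dP i (dP i.+1 x) = 0 by apply/P_exact; exists x.
have [a2 a2E] : exists a2 : {linear F2 -> P 2%N}, forall x, dP 1%N (a2 x) = a1 (d2 x).
  apply: (@projective_lift _ _ _ (a1 \o d2)) => // x.
  by apply/P_exact; apply: a1k; apply: dd.
have [b2 b2E] : exists b2 : {linear P 2%N -> F2}, forall x, d2 (b2 x) = b1 (dP 1%N x).
  apply: (@projective_lift _ _ _ (b1 \o dP 1%N)) => // x.
  by apply/F_exact1; apply: b1k; apply: ddP.
exists ((idfun \- (b2 \o a2)) \- (s1 \o d2)); split=> x /=.
  by rewrite !linearB /= b2E s1E a2E dd linear0 subr0 opprB addrA subrK subrr.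
move=> dx; have a2x : a2 x = 0.
  have /P_exact [z <-] : dP 1%N (a2 x) = 0 by rewrite a2E dx linear0.
  by rewrite (Plength _ z) ?linear0.
by rewrite a2x dx !linear0 !addr0.
Qed.

End Lifting.

Section MatrixResolutions.
Variable R : comNzRingType.

Lemma projective_cV p : projective ('cV[R]_p : lmodType R).
Proof.
move=> M N g f g_surj.
have [m mE] := boolp.choice (fun i : 'I_p => g_surj (f (delta_mx i 0))).
have [h hE] : exists h : {linear 'cV[R]_p -> M}, forall v : 'cV_p, h v = \sum_i v i 0 *: m i.
  apply: linear_of => a x y; rewrite scaler_sumr -big_split; apply: eq_bigr => i _.
  by rewrite !mxE scalerDl scalerA.
exists h => x; rewrite hE linear_sum /= {2}(matrix_sum_delta x) linear_sum /=.
by apply: eq_bigr => i _; rewrite big_ord1 !linearZ /= mE.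
Qed.

Lemma linear_cV p q (rho : {linear 'cV[R]_p -> 'cV[R]_q}) :
  exists T, forall x, rho x = T *m x.
Proof.
exists (\matrix_(i, j) rho (delta_mx j 0) i 0) => x.
rewrite {1}(matrix_sum_delta x) linear_sum /=; apply/matrixP => i j.
rewrite [j]ord1 summxE !mxE; apply: eq_bigr => l _.
by rewrite big_ord1 linearZ !mxE mulrC.
Qed.

Variable J : ideal R.

Definition generates p (f : 'M[R]_(1, p)) : Prop :=
  forall x, x \in J <-> exists c : 'cV_p, x = (f *m c) 0 0.

Definition exact_at p q r (A : 'M[R]_(p, q)) (B : 'M[R]_(q, r)) : Prop :=
  forall x : 'cV_q, A *m x = 0 <-> exists z, B *m z = x.

Lemma ideal_cover p (f : 'M[R]_(1, p)) : generates f ->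
  exists e : {linear 'cV[R]_p -> ideal_mod J}, forall c, val (e c) = (f *m c) 0 0.
Proof.
move=> fJ; have fcJ (c : 'cV_p) : (f *m c) 0 0 \in J by apply/fJ; exists c.
pose e0 c : ideal_mod J := exist (fun x : R^o => x \in J) _ (fcJ c).
have [|e eE] := @linear_of R 'cV[R]_p (ideal_mod J) e0.
  by move=> a x y; apply: val_inj; rewrite /= mulmxDr -scalemxAr !mxE.
by exists e => c; rewrite eE.
Qed.

Lemma ideal_cover_surj p (f : 'M[R]_(1, p)) (e : {linear 'cV[R]_p -> ideal_mod J}) :
  generates f -> (forall c, val (e c) = (f *m c) 0 0) ->
  forall y, exists x, e x = y.
Proof.
move=> fJ eE y; have /fJ [c yc] := valP y.
by exists c; apply: val_inj; rewrite eE.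
Qed.

Lemma ideal_cover_eq0 p (f : 'M[R]_(1, p)) (e : {linear 'cV[R]_p -> ideal_mod J}) :
  (forall c, val (e c) = (f *m c) 0 0) -> forall c, e c = 0 <-> f *m c = 0.
Proof.
move=> eE c; split=> [ec|fc].
  by apply/matrixP => i j; rewrite !ord1 -eE ec mxE.
by apply: val_inj; rewrite eE fc mxE.
Qed.

(** The second case of the last hypothesis covers the resolution of length 1
    obtained when the module at the left end vanishes. *)
Lemma matrix_resolution p0 p1 p2 (f : 'M[R]_(1, p0)) (A : 'M[R]_(p0, p1))
    (B : 'M[R]_(p1, p2)) l :
  generates f -> exact_at f A -> exact_at A B -> (forall x : 'cV_p2, B *m x = 0 -> x = 0) ->
  (l = 2 \/ p2 = 0 /\ l = 1)%N -> proj_resolution (ideal_mod J) l.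
Proof.
move=> fJ fA AB Binj lp; have [e eE] := ideal_cover fJ.
pose dims i := match i with 0 => p0 | 1 => p1 | 2 => p2 | _ => 0%N end.
pose D i : 'M[R]_(dims i, dims i.+1) :=
  match i return 'M[R]_(dims i, dims i.+1) with 0 => A | 1 => B | _ => 0 end.
exists (fun i => 'cV[R]_(dims i) : lmodType R), (fun i => mulmx (D i)), e; split.
  by move=> i; apply: projective_cV.
split=> [i li x|].
  have : dims i = 0%N.
    by case: lp li => [->|[p20 ->]]; case: i x => [|[|[|]]].
  by move=> d0; move: x; rewrite /= d0 => x; rewrite [x]flatmx0 flatmx0.
split; first exact: ideal_cover_surj.
split=> [x|i].
  by rewrite (ideal_cover_eq0 eE); apply: fA.
case: i => [|[|i]] x /=; first exact: AB.
  split=> [/Binj ->|[z <-]]; first by exists 0; rewrite mulmx0.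
  by rewrite mul0mx mulmx0.
split=> [_|_]; last by rewrite mul0mx.
by exists 0; apply/matrixP => j; case: i x j => [|i] x [].
Qed.

Lemma matrix_kernel_splits1 l p0 p1 (f : 'M[R]_(1, p0)) (A : 'M[R]_(p0, p1)) :
  proj_resolution (ideal_mod J) l -> (l <= 1)%N -> generates f -> exact_at f A ->
  exists T : 'M_p1, A *m T = 0 /\ forall x : 'cV_p1, A *m x = 0 -> T *m x = x.
Proof.
move=> [P [dP [eP [Pproj [Pl [eP_surj [P0 Pi]]]]]]] l1 fJ fA.
have [e eE] := ideal_cover fJ.
have [|rho [rho0 rhoid]] := @kernel_splits1 _ _ _ P dP eP Pproj Pl eP_surj P0 Pi
    _ _ e (mulmx A) (projective_cV (p := p0)) (projective_cV (p := p1))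
    (ideal_cover_surj fJ eE) _ l1.
  by move=> x; rewrite (ideal_cover_eq0 eE); apply: fA.
have [T TE] := linear_cV rho; exists T; split=> [|x Ax].
  apply/matrixP => i j; have := rho0 (delta_mx j 0).
  by rewrite TE /= mulmxA => /matrixP /(_ i 0); rewrite -colE !mxE.
by rewrite -TE rhoid.
Qed.

Lemma matrix_kernel_splits2 l p0 p1 p2 (f : 'M[R]_(1, p0)) (A : 'M[R]_(p0, p1))
    (B : 'M[R]_(p1, p2)) :
  proj_resolution (ideal_mod J) l -> (l <= 2)%N -> generates f -> exact_at f A ->
  exact_at A B ->
  exists T : 'M_p2, B *m T = 0 /\ forall x : 'cV_p2, B *m x = 0 -> T *m x = x.
Proof.
move=> [P [dP [eP [Pproj [Pl [eP_surj [P0 Pi]]]]]]] l1 fJ fA AB.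
have [e eE] := ideal_cover fJ.
have [|rho [rho0 rhoid]] := @kernel_splits2 _ _ _ P dP eP Pproj Pl eP_surj P0 Pi
    _ _ e (mulmx A) (projective_cV (p := p0)) (projective_cV (p := p1))
    (ideal_cover_surj fJ eE) _ _ (mulmx B) (projective_cV (p := p2)) AB l1.
  by move=> x; rewrite (ideal_cover_eq0 eE); apply: fA.
have [T TE] := linear_cV rho; exists T; split=> [|x Ax].
  apply/matrixP => i j; have := rho0 (delta_mx j 0).
  by rewrite TE /= mulmxA => /matrixP /(_ i 0); rewrite -colE !mxE.
by rewrite -TE rhoid.
Qed.

End MatrixResolutions.

(** * Cofactors and McCoy's theorem *)

Section MonotoneSelections.

Lemma ltn_lift n (p : 'I_n.+1) (i j : 'I_n) : (lift p i < lift p j)%N = (i < j)%N.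
Proof. by rewrite !ltnNge /= leq_bump2. Qed.

Lemma increasing_inj a b (g : 'I_a -> 'I_b) : increasing g -> injective g.
Proof.
move=> gi i j gij; apply: val_inj; case: (ltngtP i j) => //.
  by move=> lt_ij; have := gi _ _ lt_ij; rewrite gij ltnn.
by move=> lt_ij; have := gi _ _ lt_ij; rewrite gij ltnn.
Qed.

Lemma inj_lift a b (g : 'I_a -> 'I_b.+1) : injective g -> (a <= b)%N ->
  exists (p : 'I_b.+1) (g' : 'I_a -> 'I_b), injective g' /\ forall i, g i = lift p (g' i).
Proof.
move=> ginj ab; have [p pg] : exists p, p \notin codom g.
  apply/existsP; rewrite -negb_forall; apply/negP => /forallP allg.
  have : (#|'I_b.+1| <= #|codom g|)%N by apply/subset_leq_card/subsetP => x _; apply: allg.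
  by rewrite card_codom // !card_ord leqNgt ltnS ab.
have pne i : p != g i by apply: contraNneq pg => ->; apply: codom_f.
exists p, (fun i => s2val (unlift_some (pne i))).
have gE i : g i = lift p (s2val (unlift_some (pne i))) by case: (unlift_some _).
by split=> // i j ij; apply: ginj; rewrite !gE ij.
Qed.

Lemma increasing_lift a b (g : 'I_a -> 'I_b.+1) : increasing g -> (a <= b)%N ->
  exists (p : 'I_b.+1) (g' : 'I_a -> 'I_b), increasing g' /\ forall i, g i = lift p (g' i).
Proof.
move=> gi ab; have [p [g' [_ gE]]] := inj_lift (increasing_inj gi) ab.
by exists p, g'; split=> // i j /gi; rewrite !gE ltn_lift.
Qed.

Lemma increasing_id a (g : 'I_a -> 'I_a) : increasing g -> g =1 id.
Proof.
have ge (h : 'I_a -> 'I_a) : increasing h -> forall i : 'I_a, (i <= h i)%N.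
  move=> hi i; have [m] := ubnP (i : nat); elim: m i => // m IHm i im.
  case: (posnP i) => [-> //|i0]; have lti : (i.-1 < a)%N by rewrite (leq_ltn_trans (leq_pred _)).
  have ltii : (Ordinal lti < i)%N by rewrite /= ltn_predL.
  rewrite -(ltn_predK i0) (leq_ltn_trans _ (hi _ _ ltii)) //.
  by apply: (IHm (Ordinal lti)); rewrite /= -ltnS (ltn_predK i0).
move=> gi i; apply: val_inj; apply/eqP; rewrite eqn_leq (ge g gi) andbT.
have := ge (fun i => rev_ord (g (rev_ord i))) _ (rev_ord i); rewrite rev_ordK /=.
have lt_rev (j l : 'I_a) : (j < l)%N -> (rev_ord l < rev_ord j)%N.
  by move=> jl; rewrite /= ltn_sub2lE.
rewrite leq_sub2lE //; apply => j l jl.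
by apply (lt_rev _ _ (gi _ _ (lt_rev _ _ jl))).
Qed.

Lemma increasing_lift0 n (p : 'I_n.+1) : increasing (lift p).
Proof. by move=> i j; rewrite ltn_lift. Qed.

End MonotoneSelections.

Section Cofactors.
Variable R : comNzRingType.

Definition cons_row m n (u : 'rV[R]_n) (X : 'M[R]_(m, n)) : 'M[R]_(m.+1, n) :=
  \matrix_(i, j) if unlift ord0 i is Some i' then X i' j else u 0 j.

Definition cons_col m n (x : 'cV[R]_m) (X : 'M[R]_(m, n)) : 'M[R]_(m, n.+1) :=
  \matrix_(i, j) if unlift ord0 j is Some j' then X i j' else x i 0.

Lemma cons_row0 m n u (X : 'M_(m, n)) j : cons_row u X ord0 j = u 0 j.
Proof. by rewrite mxE unlift_none. Qed.

Lemma cons_rowS m n u (X : 'M_(m, n)) i j : cons_row u X (lift ord0 i) j = X i j.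
Proof. by rewrite mxE liftK. Qed.

Lemma cons_col0 m n x (X : 'M_(m, n)) i : cons_col x X i ord0 = x i 0.
Proof. by rewrite mxE unlift_none. Qed.

Lemma cons_colS m n x (X : 'M_(m, n)) i j : cons_col x X i (lift ord0 j) = X i j.
Proof. by rewrite mxE liftK. Qed.

Lemma row'0_cons_row m n u (X : 'M_(m, n)) : row' ord0 (cons_row u X) = X.
Proof. by apply/matrixP => i j; rewrite mxE cons_rowS. Qed.

Lemma row'S_cons_row m n u (X : 'M_(m.+1, n)) i :
  row' (lift ord0 i) (cons_row u X) = cons_row u (row' i X).
Proof.
apply/matrixP => l j; rewrite mxE; case: (unliftP ord0 l) => [l'|] ->.
  have -> : lift (lift ord0 i) (lift ord0 l') = lift ord0 (lift i l').
    by apply: val_inj; rewrite /= /bump !leq0n !add1n ltnS addnS.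
  by rewrite !cons_rowS mxE.
have -> : lift (lift ord0 i) ord0 = ord0 by apply: val_inj.
by rewrite !cons_row0.
Qed.

Lemma row_cons_row0 m n u (X : 'M_(m, n)) : row ord0 (cons_row u X) = u.
Proof. by apply/rowP => j; rewrite mxE cons_row0. Qed.

Lemma row_cons_rowS m n u (X : 'M_(m, n)) i : row (lift ord0 i) (cons_row u X) = row i X.
Proof. by apply/rowP => j; rewrite !mxE liftK. Qed.

Lemma col'0_cons_col m n x (X : 'M_(m, n)) : col' ord0 (cons_col x X) = X.
Proof. by apply/matrixP => i j; rewrite mxE cons_colS. Qed.

Lemma det_cons_row_delta m (X : 'M_(m, m.+1)) p :
  \det (cons_row (delta_mx 0 p) X) = (-1) ^+ p * \det (col' p X).
Proof.
rewrite (expand_det_row _ ord0) (bigD1 p) //= big1 ?addr0 => [|q /negPf qp].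
  rewrite cons_row0 mxE !eqxx mul1r /cofactor add0n; congr (_ * \det _).
  by apply/matrixP => i j; rewrite !mxE liftK.
by rewrite cons_row0 mxE qp andbF mul0r.
Qed.

(** With this sign, signed_minor N i is the cofactor of the i-th entry of a
    column put in front of N. *)
Definition signed_minor m (N : 'M[R]_(m.+1, m)) (i : 'I_m.+1) : R :=
  (-1) ^+ i * \det (row' i N).

Lemma cofactor_cons_col m (N : 'M_(m.+1, m)) x i :
  cofactor (cons_col x N) i ord0 = signed_minor N i.
Proof.
rewrite /cofactor addn0; congr (_ * \det _); rewrite -[in RHS](col'0_cons_col x N).
by apply/matrixP => l j; rewrite !mxE.
Qed.

Lemma det_cons_col m (N : 'M_(m.+1, m)) x :
  \det (cons_col x N) = \sum_i x i 0 * signed_minor N i.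
Proof.
rewrite (expand_det_col _ ord0); apply: eq_bigr => i _.
by rewrite cofactor_cons_col cons_col0.
Qed.

(** Expand the determinant of N preceded by one of its own columns. *)
Lemma signed_minor_relation m (N : 'M_(m.+1, m)) :
  \sum_i signed_minor N i *: row i N = 0.
Proof.
apply/rowP => j; rewrite summxE mxE.
have: \det (cons_col (col j N) N) = 0.
  rewrite -det_tr; apply: (determinant_alternate (i1 := ord0) (i2 := lift ord0 j)) => // i.
  by rewrite ![_^T _ _]mxE cons_col0 cons_colS mxE.
rewrite det_cons_col => E; rewrite -[RHS]E; apply: eq_bigr => i _.
by rewrite !mxE mulrC.
Qed.

(** If x is orthogonal to the signed minors, the square matrix of x and N is
    singular, and its product with its adjugate, being 0, solves for x up to
    the signed minor. *)
Lemma signed_minor_exact m (N : 'M[R]_(m.+1, m)) (x : 'cV_(m.+1)) i :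
  \sum_i x i 0 * signed_minor N i = 0 ->
  exists w : 'cV_m, signed_minor N i *: x = N *m w.
Proof.
rewrite -det_cons_col => det0; have := mul_mx_adj (cons_col x N).
rewrite det0 => /matrixP adj0.
exists (\col_j - (\adj (cons_col x N)) (lift ord0 j) i).
apply/colP => l; rewrite !mxE; have := adj0 l i.
rewrite mxE big_ord_recl cons_col0 [X in _ * X]mxE cofactor_cons_col.
rewrite [RHS]mxE mul0rn mulrC => /eqP; rewrite addr_eq0 => /eqP ->.
rewrite -sumrN; apply: eq_bigr => j _.
by rewrite cons_colS [in RHS]mxE mulrN.
Qed.

(** Cramer's rule: the left kernel of N consists of multiples of the vector of
    signed minors, up to denominators. *)
Lemma signed_minor_parallel m (N : 'M_(m.+1, m)) (a : 'rV_(m.+1)) p q :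
  a *m N = 0 -> a 0 p * signed_minor N q = a 0 q * signed_minor N p.
Proof.
move=> aN; pose M := cons_col (delta_mx p 0) N.
have detM : \det M = signed_minor N p.
  rewrite det_cons_col (bigD1 p) //= big1 ?addr0 ?mxE ?eqxx ?mul1r // => i /negPf ip.
  by rewrite mxE ip mul0r.
have aM : a *m M = delta_mx 0 ord0 *m (a 0 p)%:M.
  apply/rowP => j; rewrite mul_mx_scalar !mxE; case: (unliftP ord0 j) => [j'|] ->.
    rewrite (eq_bigr (fun i => a 0 i * N i j')) => [|i _]; last by rewrite cons_colS.
    by move/matrixP: aN => /(_ 0 j'); rewrite !mxE => ->; rewrite mulr0.
  rewrite !eqxx mulr1 (bigD1 p) //= big1 ?addr0 => [|i /negPf ip].
    by rewrite cons_col0 mxE !eqxx mulr1.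
  by rewrite cons_col0 mxE ip mulr0.
have : a *m (M *m \adj M) = a *m (\det M)%:M by rewrite mul_mx_adj.
rewrite mulmxA aM mul_mx_scalar -scalemxAl -rowE mul_mx_scalar detM.
move=> /rowP /(_ q); rewrite !mxE cofactor_cons_col => ->.
by rewrite mulrC.
Qed.

End Cofactors.

Section McCoy.
Variables (R : comNzRingType) (Q : R -> Prop).
Hypothesis QI : is_ideal Q.

(** McCoy's theorem modulo Q: if M is injective modulo Q and s multiplies all
    maximal minors into Q, then s is in Q. Descending induction on t shows
    that s multiplies all minors of size t on the first t columns into Q: on t
    + 1 columns and t fixed rows, the vector of s times the cofactors along an
    additional row is mapped by M to s times minors of size t + 1. *)
Lemma mccoy p r (M : 'M[R]_(p, r)) s :
  (forall w : 'cV_r, (forall i, Q ((M *m w) i 0)) -> forall j, Q (w j 0)) ->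
  (forall f : 'I_r -> 'I_p, Q (s * \det (rowsub f M))) -> Q s.
Proof.
move=> Minj Qdet; have [Q0 QD QM] := QI.
suff minors d t (tr : (t <= r)%N) (f : 'I_t -> 'I_p) : (t + d = r)%N ->
    Q (s * \det (mxsub f (widen_ord tr) M)).
  have := minors r 0%N (leq0n r) (fun i : 'I_0 => False_rect _ (notF (ltn_ord i))) (add0n r).
  by rewrite det_mx00 mulr1.
elim: d t tr f => [|d IHd] t tr f tdr.
  rewrite addn0 in tdr; subst t; have := Qdet f; congr (Q (s * \det _)).
  by apply/matrixP => i j; rewrite !mxE; congr (M _ _); apply: val_inj.
have tr' : (t < r)%N by rewrite -tdr addnS ltnS leq_addr.
pose c := \col_(j < t.+1) (s * ((-1) ^+ (t + j) *
  \det (mxsub f (fun l => widen_ord tr' (lift j l)) M))).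
pose w : 'cV_r := colsub (widen_ord tr') 1%:M *m c.
have wE j : w (widen_ord tr' j) 0 = c j 0.
  rewrite mxE (bigD1 j) //= big1 ?addr0 => [|i ij]; first by rewrite !mxE eqxx mul1r.
  by rewrite !mxE -val_eqE /= eq_sym val_eqE (negPf ij) mul0r.
have := Minj w _ (widen_ord tr' ord_max); rewrite wE mxE /=.
rewrite -signr_odd oddD addbb mul1r; have -> : mxsub f (fun l => widen_ord tr' (lift ord_max l)) M = mxsub f (widen_ord tr) M.
  by apply/matrixP => i j; rewrite !mxE; congr (M _ _); apply: val_inj; exact: lift_max.
apply=> x; rewrite /w mulmxA.
have -> : M *m colsub (widen_ord tr') 1%:M = colsub (widen_ord tr') M.
  by rewrite mulmx_colsub mulmx1.
pose fx (i : 'I_t.+1) := if unlift ord_max i is Some i' then f i' else x.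
have := IHd t.+1 tr' fx _; rewrite addSn -addnS => /(_ tdr).
congr Q; rewrite (expand_det_row _ ord_max) mulr_sumr mxE; apply: eq_bigr => j _.
rewrite !mxE /fx unlift_none mulrCA; congr (_ * (_ * _)).
rewrite /cofactor; congr (_ * \det _); apply/matrixP => i l.
by rewrite !mxE liftK.
Qed.

End McCoy.

(** * Grade and the Buchsbaum-Rim complex *)

Lemma subr_exchange (V : zmodType) (x y z t : V) : x - y = z - t -> y - t = x - z.
Proof.
by move=> E; rewrite -[x in RHS](subrK y) E addrAC [z - t]addrC addrK addrC.
Qed.

Section Grade.
Variable R : idomainType.

Lemma matrix_choice p q (Pr : 'I_p -> 'I_q -> R -> Prop) :
  (forall i j, exists z, Pr i j z) -> exists Z : 'M[R]_(p, q), forall i j, Pr i j (Z i j).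
Proof.
move=> PrE; have [z zP] := boolp.choice (fun ij : 'I_p * 'I_q => PrE ij.1 ij.2).
by exists (\matrix_(i, j) z (i, j)) => i j; rewrite mxE; apply: (zP (i, j)).
Qed.

Lemma regular2_neq0 (u v : R) : regular [:: v; u] -> u != 0.
Proof.
move=> [[_ u0] _]; apply/eqP => uE; have := u0 1.
by rewrite uE mul0r => /(_ erefl) /eqP; rewrite oner_eq0.
Qed.

Lemma regular2_dvd (u v x y : R) : regular [:: v; u] -> v * x = u * y ->
  exists z, x = u * z.
Proof.
move=> [_ vP] vx; have [|a [_ [-> ->]]] := vP x.
  by exists y, 0; rewrite addr0 vx mulrC.
by exists a; rewrite addr0 mulrC.
Qed.

Lemma regular2_mx p q (u v : R) (X Y : 'M_(p, q)) : regular [:: v; u] ->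
  v *: X = u *: Y -> exists Z, X = u *: Z.
Proof.
move=> reg XY; have [|Z ZE] := @matrix_choice p q (fun i j z => X i j = u * z).
  move=> i j; apply: (@regular2_dvd u v _ (Y i j)) => //.
  by move/matrixP/(_ i j): XY; rewrite !mxE.
by exists Z; apply/matrixP => i j; rewrite mxE.
Qed.

Lemma scaler_mxI p q (u : R) : u != 0 -> injective ( *:%R u : 'M[R]_(p, q) -> 'M[R]_(p, q)).
Proof.
move=> u0 X Y /matrixP XY; apply/matrixP => i j.
by have := XY i j; rewrite !mxE; apply: mulfI.
Qed.

(** Exactness of the Koszul complex on a regular sequence of length three. *)
Lemma koszul3 p q (u v w : R) (X Y Z : 'M_(p, q)) : regular [:: w; v; u] ->
  u *: X + v *: Y + w *: Z = 0 ->
  exists a b c, [/\ X = v *: c - w *: b, Y = w *: a - u *: c & Z = u *: b - v *: a].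
Proof.
move=> [reg wP] E; have u0 := regular2_neq0 reg.
have [|a aP] := @matrix_choice p q (fun i j z => exists b c,
    [/\ X i j = v * c - w * b, Y i j = w * z - u * c & Z i j = u * b - v * z]).
  move=> i j; have Eij : u * X i j + v * Y i j + w * Z i j = 0.
    by move/matrixP/(_ i j): E; rewrite !mxE.
  have [|al [_ [[be [_ [-> ->]]]]]] := wP (Z i j).
    exists (- Y i j), (- X i j * u); split; first by exists (- X i j), 0; rewrite addr0.
    by apply/eqP; rewrite -subr_eq0; apply/eqP; rewrite -[RHS]Eij; ring.
  rewrite addr0 => ZE.
  have vY : v * (Y i j + w * al) = u * (- (X i j + w * be)).
    by apply/eqP; rewrite -subr_eq0 -[X in _ == X]Eij ZE; apply/eqP; ring.
  have [ga gaE] := regular2_dvd reg vY.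
  have xE : X i j + w * be = - (v * ga).
    apply: (mulfI u0); have -> : u * - (v * ga) = - (v * (u * ga)) by ring.
    by rewrite -gaE vY; ring.
  exists (- al), be, (- ga); split.
  - by rewrite mulrN -xE addrK.
  - by rewrite mulrN mulrN opprK -gaE; ring.
  - by rewrite ZE; ring.
have [b bP] := @matrix_choice p q (fun i j z => exists c,
    [/\ X i j = v * c - w * z, Y i j = w * a i j - u * c & Z i j = u * z - v * a i j]) aP.
have [c cP] := @matrix_choice p q (fun i j z =>
    [/\ X i j = v * z - w * b i j, Y i j = w * a i j - u * z & Z i j = u * b i j - v * a i j]) bP.
exists a, b, c; split; apply/matrixP => i j; rewrite !mxE; by case: (cP i j).
Qed.

(** As I is an ideal in all uses, this bounds its grade from below. *)
Definition grade_ge h (I : R -> Prop) : Prop :=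
  exists s, [/\ regular s, {in s, forall x, I x} & size s = h].

Lemma grade_ge_le h h' I : (h <= h')%N -> grade_ge h' I -> grade_ge h I.
Proof.
move=> hh' [s [sreg sI sh]]; exists (drop (h' - h) s); split.
- exact: regular_drop.
- by move=> x /mem_drop /sI.
- by rewrite size_drop sh subKn.
Qed.

Lemma grade_ge_sub h (I I' : R -> Prop) :
  (forall x, I x -> I' x) -> grade_ge h I -> grade_ge h I'.
Proof. by move=> II' [s [sreg sI sh]]; exists s; split=> // x /sI /II'. Qed.

Lemma grade_ge2P I : grade_ge 2 I ->
  exists u v, [/\ regular [:: v; u], I u & I v].
Proof.
case=> s [reg sI sz]; case: s reg sI sz => [|v [|u [|? ?]]] // reg sI _.
by exists u, v; split=> //; apply: sI; rewrite !inE eqxx ?orbT.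
Qed.

Lemma grade_ge3P I : grade_ge 3 I ->
  exists u v w, [/\ regular [:: w; v; u], I u, I v & I w].
Proof.
case=> s [reg sI sz]; case: s reg sI sz => [|w [|v [|u [|? ?]]]] // reg sI _.
by exists u, v, w; split=> //; apply: sI; rewrite !inE eqxx ?orbT.
Qed.

Lemma grade_ge4P I : grade_ge 4 I ->
  exists u v w t, [/\ regular [:: t; w; v; u], I u, I v, I w & I t].
Proof.
case=> s [reg sI sz]; case: s reg sI sz => [|t [|w [|v [|u [|? ?]]]]] // reg sI _.
by exists u, v, w, t; split=> //; apply: sI; rewrite !inE eqxx ?orbT.
Qed.

(** If u x = M s and v x = M t, then v s = u t by injectivity of M, so s is
    divisible by u because v is regular modulo u. *)
Lemma grade2_image I p q (M : 'M[R]_(p, q)) (x : 'cV_p) : grade_ge 2 I ->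
  (forall w : 'cV_q, M *m w = 0 -> w = 0) ->
  (forall b, I b -> exists w : 'cV_q, b *: x = M *m w) -> exists w, x = M *m w.
Proof.
move=> /grade_ge2P [u [v [reg Iu Iv]]] Minj IP.
have [s us] := IP u Iu; have [t vt] := IP v Iv.
have u0 := regular2_neq0 reg.
have [|z sz] := @regular2_mx _ _ u v s t reg.
  apply/eqP; rewrite -subr_eq0; apply/eqP/Minj.
  by rewrite mulmxBr -!scalemxAr -us -vt !scalerA mulrC subrr.
by exists z; apply: (scaler_mxI u0); rewrite us sz scalemxAr.
Qed.

(** If u = sum_j a_j f_j, then u y_i = (sum_j a_j y_j) f_i. Two such u and v
    forming a regular sequence force the factor sum_j a_j y_j to be divisible
    by u. *)
Lemma grade2_parallel p (f y : 'I_p -> R) :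
  grade_ge 2 (fun x => exists a : 'I_p -> R, x = \sum_i a i * f i) ->
  (forall i j, y i * f j = y j * f i) -> exists h, forall i, y i = h * f i.
Proof.
move=> /grade_ge2P [u [v [reg [a uE] [b vE]]]] par.
have u0 := regular2_neq0 reg.
pose U := \sum_i a i * y i; pose V := \sum_i b i * y i.
have uy i : u * y i = U * f i.
  by rewrite uE !mulr_suml; apply: eq_bigr => j _; rewrite -!mulrA [f j * _]mulrC par.
have [|z UE] := @regular2_dvd u v U V reg.
  rewrite mulrC vE !mulr_sumr; apply: eq_bigr => i _.
  by rewrite mulrCA -uy mulrCA.
by exists z => i; apply: (mulfI u0); rewrite uy UE mulrA.
Qed.

End Grade.

Section Skew.
Variables (R : idomainType) (r : nat) (B : 'M[R]_(r, r.+2)).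

Definition det2 (u v : 'rV[R]_(r.+2)) : R := \det (cons_row u (cons_row v B)).

(** The middle map of the Buchsbaum-Rim complex of B; its entries are the
    signed maximal minors of B, indexed by the pair of omitted columns. *)
Definition skewm : 'M[R]_(r.+2) :=
  \matrix_(p, q) det2 (delta_mx 0 p) (delta_mx 0 q).

Lemma det_cons_row_linear m (X : 'M[R]_(m, m.+1)) u :
  \det (cons_row u X) = \sum_j u 0 j * \det (cons_row (delta_mx 0 j) X).
Proof.
rewrite (expand_det_row _ ord0); apply: eq_bigr => j _.
rewrite cons_row0 det_cons_row_delta /cofactor add0n; congr (_ * (_ * \det _)).
by apply/matrixP => i l; rewrite !mxE liftK.
Qed.

Lemma det2_anti u v : det2 u v = - det2 v u.
Proof.
pose i1 : 'I_r.+2 := lift ord0 ord0; rewrite /det2.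
have -> : cons_row u (cons_row v B) = xrow ord0 i1 (cons_row v (cons_row u B)).
  apply/matrixP => i j; rewrite [RHS]mxE; case: (unliftP ord0 i) => [i'|] ->; last first.
    by rewrite tpermL cons_row0 cons_rowS cons_row0.
  case: (unliftP ord0 i') => [i''|] ->; last first.
    by rewrite -/i1 tpermR cons_row0 cons_rowS cons_row0.
  rewrite tpermD; last by rewrite /i1 (inj_eq lift_inj).
    by rewrite !cons_rowS.
  by [].
by rewrite xrowE det_mulmx det_perm odd_tperm mulN1r.
Qed.

Lemma det2E u v : det2 u v = (u *m skewm *m v^T) 0 0.
Proof.
rewrite /det2 det_cons_row_linear mxE.
under [RHS]eq_bigr => q _ do rewrite !mxE mulr_suml.
rewrite exchange_big; apply: eq_bigr => p _ /=.
rewrite -/(det2 _ _) det2_anti /det2 det_cons_row_linear -sumrN mulr_sumr.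
apply: eq_bigr => q _; rewrite -/(det2 _ _) det2_anti mxE; ring.
Qed.

Lemma skew_anti p q : skewm p q = - skewm q p.
Proof. by rewrite !mxE det2_anti. Qed.

Lemma tr_skew : skewm^T = - skewm.
Proof. by apply/matrixP => p q; rewrite mxE skew_anti [RHS]mxE. Qed.

Lemma det2_diag u : det2 u u = 0.
Proof.
apply: (determinant_alternate (i1 := ord0) (i2 := lift ord0 ord0)) => // j.
by rewrite cons_rowS !cons_row0.
Qed.

Lemma skew_diag p : skewm p p = 0.
Proof. by rewrite mxE det2_diag. Qed.

Lemma det2_row u i : det2 u (row i B) = 0.
Proof.
apply: (determinant_alternate (i1 := lift ord0 ord0) (i2 := lift ord0 (lift ord0 i))) => // j.
by rewrite !cons_rowS cons_row0 mxE.
Qed.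

Lemma mul_skew_tr : skewm *m B^T = 0.
Proof.
apply/matrixP => p i; rewrite [RHS]mxE -(det2_row (delta_mx 0 p) i) det2E.
by rewrite -rowE tr_row colE mulmxA -colE !mxE; apply: eq_bigr => j _; rewrite !mxE.
Qed.

Lemma mul_B_skew : B *m skewm = 0.
Proof.
apply: trmx_inj; rewrite trmx_mul tr_skew mulNmx mul_skew_tr trmx0.
exact: oppr0.
Qed.

(** The r + 3 rows u, v, x and those of B have only r + 2 entries; this is the
    linear relation among them given by their signed minors. *)
Lemma det2_relation (u v x : 'rV_(r.+2)) :
  exists w : 'rV_r, det2 u v *: x = det2 u x *: v - det2 v x *: u + w *m B.
Proof.
pose N := cons_row u (cons_row v (cons_row x B)).
have := signed_minor_relation N; rewrite !big_ord_recl.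
rewrite /N !row_cons_rowS !row_cons_row0 /signed_minor !row'S_cons_row !row'0_cons_row.
rewrite -!/(det2 _ _) expr0 mul1r expr1 mulN1r.
have -> : (-1) ^+ lift ord0 (lift ord0 (ord0 : 'I_r.+1)) = 1 :> R by rewrite expr2 mulrNN mul1r.
rewrite mul1r => E.
set T := \sum_(i < r) _ in E; exists (- \row_i signed_minor N (lift ord0 (lift ord0 (lift ord0 i)))).
rewrite mulNmx; have -> : (\row_i signed_minor N (lift ord0 (lift ord0 (lift ord0 i)))) *m B = T.
  apply/rowP => j; rewrite mxE summxE; apply: eq_bigr => i _.
  by rewrite !row_cons_rowS !mxE.
apply/eqP; rewrite -subr_eq0; apply/eqP; rewrite -[RHS]E.
by rewrite scaleNr; apply/rowP => j; rewrite !mxE; ring.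
Qed.

(** Multiplying det2_relation by a vector killed by B shows that every minor
    of B multiplies it into the image of S. *)
Lemma kernel_B_skew (y : 'cV_(r.+2)) p q : B *m y = 0 ->
  skewm p q *: y = skewm *m (y p 0 *: delta_mx q 0 - y q 0 *: delta_mx p 0).
Proof.
move=> By; apply/colP => i; rewrite mulmxBr -!scalemxAr -!colE !mxE.
have [w] := det2_relation (delta_mx 0 p) (delta_mx 0 q) (delta_mx 0 i).
move/(congr1 (mulmx^~ y)); rewrite mulmxDl mulmxBl -mulmxA By mulmx0 addr0.
rewrite -!scalemxAl -!rowE => /matrixP /(_ 0 0); rewrite !mxE => ->.
rewrite (det2_anti _ (delta_mx 0 i)) [det2 (delta_mx 0 q) _]det2_anti; ring.
Qed.

Lemma kernel_skew_B (x : 'cV_(r.+2)) p q : skewm *m x = 0 ->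
  exists w : 'cV_r, skewm p q *: x = B^T *m w.
Proof.
move=> Sx; have dx u : det2 u x^T = 0 by rewrite det2E trmxK -mulmxA Sx mulmx0 mxE.
have [w wE] := det2_relation (delta_mx 0 p) (delta_mx 0 q) x^T.
exists w^T; apply: trmx_inj; rewrite linearZ /= trmx_mul !trmxK mxE wE.
by rewrite !dx !scale0r subrr add0r.
Qed.

Definition skew_ideal : R -> Prop := ideal_gen (fun x => exists p q, x = skewm p q).

Lemma skew_ideal_mem p q : skew_ideal (skewm p q).
Proof. by apply: ideal_gen_sub; exists p, q. Qed.

Lemma image_conductor p q (M : 'M[R]_(p, q)) (x : 'cV_p) :
  is_ideal (fun b => exists w : 'cV_q, b *: x = M *m w).
Proof.
split.
- by exists 0; rewrite scale0r mulmx0.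
- by move=> b c [w bw] [z cz]; exists (w + z); rewrite scalerDl bw cz mulmxDr.
- by move=> a b [w bw]; exists (a *: w); rewrite -scalerA bw scalemxAr.
Qed.

Lemma skew_ideal_kernel_B (y : 'cV_(r.+2)) b : B *m y = 0 -> skew_ideal b ->
  exists w : 'cV_(r.+2), b *: y = skewm *m w.
Proof.
move=> By; apply: ideal_gen_min (image_conductor _ _) _ => _ [p [q ->]].
by rewrite (kernel_B_skew p q By); eexists.
Qed.

Lemma skew_ideal_kernel_skew (x : 'cV_(r.+2)) b : skewm *m x = 0 -> skew_ideal b ->
  exists w : 'cV_r, b *: x = B^T *m w.
Proof.
move=> Sx; apply: ideal_gen_min (image_conductor _ _) _ => _ [p [q ->]].
exact: kernel_skew_B.
Qed.

Hypothesis BTinj : forall w : 'cV_r, B^T *m w = 0 -> w = 0.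

(** The minors of B multiply the kernel of S into the image of B^T, and grade
    two is enough to divide since B^T is injective. *)
Lemma exact_skew_B (x : 'cV_(r.+2)) : grade_ge 2 skew_ideal ->
  skewm *m x = 0 -> exists w : 'cV_r, x = B^T *m w.
Proof.
move=> gr Sx; apply: grade2_image gr BTinj _ => b Ib.
exact: skew_ideal_kernel_skew.
Qed.

(** Three minors g_i give g_i x = S a_i. The differences g_i a_j - g_j a_i lie
    in the kernel of S, hence are B^T p for vectors p that satisfy the Koszul
    relation; solving it corrects the a_i by multiples of B^T so that g_1
    divides a_1. *)
Lemma exact_B_skew (x : 'cV_(r.+2)) : grade_ge 3 skew_ideal ->
  B *m x = 0 -> exists w : 'cV_(r.+2), x = skewm *m w.
Proof.
move=> gr3 Bx; have gr2 := grade_ge_le (leqnSn 2) gr3.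
have [u [v [w [reg Iu Iv Iw]]]] := grade_ge3P gr3.
have u0 : u != 0 by case: reg => /regular2_neq0.
have [a1 a1E] := skew_ideal_kernel_B Bx Iu.
have [a2 a2E] := skew_ideal_kernel_B Bx Iv.
have [a3 a3E] := skew_ideal_kernel_B Bx Iw.
have comm (c d : R) (s t : 'cV_(r.+2)) : c *: x = skewm *m s -> d *: x = skewm *m t ->
    exists z : 'cV_r, c *: t - d *: s = B^T *m z.
  move=> cs dt; apply: exact_skew_B => //.
  by rewrite mulmxBr -!scalemxAr -cs -dt !scalerA mulrC subrr.
have [p pE] := comm _ _ _ _ a2E a3E; have [q qE] := comm _ _ _ _ a3E a1E.
have [t tE] := comm _ _ _ _ a1E a2E.
have [|a [b [c [_ _ tE']]]] := @koszul3 _ _ _ u v w p q t reg.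
  apply: BTinj; rewrite !mulmxDr -!scalemxAr -pE -qE -tE.
  by apply/colP => i; rewrite !mxE; ring.
have [|z zE] := @regular2_mx _ _ _ u v (a1 - B^T *m a) (a2 - B^T *m b) reg.1.
  rewrite !scalerBr; apply: subr_exchange.
  by rewrite tE tE' mulmxBr -!scalemxAr.
exists z; apply: (scaler_mxI u0); rewrite a1E scalemxAr -zE mulmxBr.
by rewrite mulmxA mul_skew_tr mul0mx subr0.
Qed.

End Skew.

(** * The ideal of maximal minors of the lower block *)

Section SkewIdeal.
Variables (R : idomainType) (r : nat) (B : 'M[R]_(r, r.+2)).

Lemma skew_lift (p : 'I_r.+2) (q : 'I_r.+1) :
  skewm B p (lift p q) = (-1) ^+ (p + q) * \det (colsub (fun j => lift p (lift q j)) B).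
Proof.
rewrite mxE /det2 det_cons_row_delta exprD -mulrA; congr (_ * _).
have -> : col' p (cons_row (delta_mx 0 (lift p q)) B) = cons_row (delta_mx 0 q) (col' p B).
  apply/matrixP => i j; rewrite !mxE; case: unliftP => [i'|] _; rewrite ?mxE //=.
  by rewrite (inj_eq lift_inj).
rewrite det_cons_row_delta; congr (_ * \det _).
by apply/matrixP => i j; rewrite !mxE.
Qed.

Lemma det_colsub_skew_ideal (f : 'I_r -> 'I_r.+2) : skew_ideal B (\det (colsub f B)).
Proof.
have [I0 _ IM] := ideal_gen_is_ideal (fun x => exists p q, x = skewm B p q).
have [finj|] := boolP (injectiveb f); last first.
  move/injectivePn => [i [j ij fij]]; suff -> : \det (colsub f B) = 0 by [].
  by rewrite -det_tr; apply: (determinant_alternate ij) => l; rewrite !mxE fij.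
have [p [f' [f'inj fE]]] := inj_lift (injectiveP _ finj) (leqnSn r).
have [q [f'' [f''inj f'E]]] := inj_lift f'inj (leqnn r).
have -> : colsub f B = col_perm (perm f''inj) (colsub (fun j => lift p (lift q j)) B).
  by apply/matrixP => i j; rewrite !mxE permE fE f'E.
rewrite col_permE det_mulmx det_perm mulrC; apply: (IM).
have -> : \det (colsub (fun j => lift p (lift q j)) B) = (-1) ^+ (p + q) * skewm B p (lift p q).
  by rewrite skew_lift mulrA -exprD -signr_odd oddD addbb mul1r.
by apply: IM; apply: skew_ideal_mem.
Qed.

Lemma skew_idealP x : minors_ideal r B x <-> skew_ideal B x.
Proof.
split; apply: ideal_gen_min (ideal_gen_is_ideal _) _.
  move=> _ [f [g [/increasing_id fid gi ->]]].
  by rewrite (mxsub_eq_colsub _ fid); apply: det_colsub_skew_ideal.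
move=> _ [p [q ->]]; case: (unliftP p q) => [q'|] ->; last first.
  by rewrite skew_diag; case: (ideal_gen_is_ideal (is_minor r B)).
rewrite skew_lift; have [_ _] := ideal_gen_is_ideal (is_minor r B); apply.
apply: ideal_gen_sub; exists id, (fun j => lift p (lift q' j)); split=> //.
by move=> i j ij; rewrite !ltn_lift.
Qed.

(** For a single maximal minor L is an adjugate, extended by zero rows. *)
Lemma skew_ideal_splits b : skew_ideal B b -> exists L, B *m L = b%:M.
Proof.
pose I c := exists L, B *m L = c%:M.
have II : is_ideal I.
  split.
  - by exists 0; rewrite mulmx0 raddf0.
  - by move=> x y [L LE] [L' LE']; exists (L + L'); rewrite mulmxDr LE LE' raddfD.
  - by move=> a x [L LE]; exists (a *: L); rewrite -scalemxAr LE scale_scalar_mx.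
move/skew_idealP; apply: ideal_gen_min II _ => _ [f [g [/increasing_id fid _ ->]]].
rewrite (mxsub_eq_colsub _ fid); exists (colsub g 1%:M *m \adj (colsub g B)).
by rewrite mulmxA mulmx_colsub mulmx1 mul_mx_adj.
Qed.

Lemma trmx_injective_of_skew b : skew_ideal B b -> b != 0 ->
  forall w : 'cV_r, B^T *m w = 0 -> w = 0.
Proof.
move=> /skew_ideal_splits [L LE] b0 w Bw; apply: (scaler_mxI b0).
by rewrite scaler0 -mul_scalar_mx -tr_scalar_mx -LE trmx_mul -mulmxA Bw mulmx0.
Qed.

(** McCoy's theorem for B^T, with the maximal minors of B read off S. *)
Lemma mccoy_skew (Q : R -> Prop) s : is_ideal Q ->
  (forall w : 'cV_r, (forall i, Q ((B^T *m w) i 0)) -> forall j, Q (w j 0)) ->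
  (forall b, skew_ideal B b -> Q (s * b)) -> Q s.
Proof.
move=> QI BT sQ; apply: (mccoy QI BT) => f; apply: sQ.
rewrite -det_tr; have -> : (rowsub f B^T)^T = colsub f B.
  by apply/matrixP => i j; rewrite !mxE.
exact: det_colsub_skew_ideal.
Qed.

(** The cokernel of B has projective dimension at most three and is killed by
    a regular sequence of length four, so it vanishes. Explicitly, g_i y = B
    a_i for three of the elements, the differences g_i a_j - g_j a_i are S p,
    and g_1 p + g_2 q + g_3 t = B^T w; the fourth element shows that w has
    entries in (g_1, g_2, g_3), after which p, q, t solve a Koszul relation
    and y can be divided. *)
Lemma grade4_surjective : grade_ge 4 (skew_ideal B) ->
  forall y : 'cV_r, exists z, y = B *m z.
Proof.
move=> gr4 y; have gr3 := grade_ge_le (leqnSn 3) gr4.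
have [g1 [g2 [g3 [g4 [reg I1 I2 I3 I4]]]]] := grade_ge4P gr4.
have g10 : g1 != 0 by case: reg => [[/regular2_neq0]].
have BTinj := trmx_injective_of_skew I1 g10.
have lift_y b : skew_ideal B b -> exists a : 'cV_(r.+2), b *: y = B *m a.
  move=> /skew_ideal_splits [L LE]; exists (L *m y).
  by rewrite mulmxA LE mul_scalar_mx.
have [a1 a1E] := lift_y g1 I1; have [a2 a2E] := lift_y g2 I2.
have [a3 a3E] := lift_y g3 I3.
have comm (c d : R) (s t : 'cV_(r.+2)) : c *: y = B *m s -> d *: y = B *m t ->
    exists z : 'cV_(r.+2), c *: t - d *: s = skewm B *m z.
  move=> cs dt; apply: exact_B_skew => //.
  by rewrite mulmxBr -!scalemxAr -cs -dt !scalerA mulrC subrr.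
have [p pE] := comm _ _ _ _ a2E a3E; have [q qE] := comm _ _ _ _ a3E a1E.
have [t tE] := comm _ _ _ _ a1E a2E.
have [|w wE] := @exact_skew_B _ _ _ BTinj (g1 *: p + g2 *: q + g3 *: t) (grade_ge_le (leqnSn 2) gr3).
  rewrite !mulmxDr -!scalemxAr -pE -qE -tE.
  by apply/colP => i; rewrite !mxE; ring.
have [|w1 w1P] := @matrix_choice R r 1 (fun i j z => exists b c,
    w i j = g1 * z + g2 * b + g3 * c).
  move=> i j; have [_ /(_ (w i j))] := reg; rewrite [j]ord1; case.
    have [L LE] := skew_ideal_splits I4.
    have g4w : g4 *: w = L^T *m (g1 *: p + g2 *: q + g3 *: t).
      by rewrite wE mulmxA -trmx_mul LE tr_scalar_mx mul_scalar_mx.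
    have -> : g4 * w i 0 = (g4 *: w) i 0 by rewrite mxE.
    rewrite g4w !mulmxDr -!scalemxAr.
    exists ((L^T *m t) i 0), (g2 * (L^T *m q) i 0 + g1 * (L^T *m p) i 0); split.
      exists ((L^T *m q) i 0), (g1 * (L^T *m p) i 0); split; last by ring.
      by exists ((L^T *m p) i 0), 0; rewrite addr0 mulrC.
    by move: (L^T *m t) (L^T *m q) (L^T *m p) => T Q P; rewrite !mxE; ring.
  move=> c [_ [[b [_ [[a [_ [-> ->]]] ->]] ->]]].
  by exists a, b, c; ring.
have [w2 w2P] := @matrix_choice R r 1 (fun i j z => exists c,
    w i j = g1 * w1 i j + g2 * z + g3 * c) w1P.
have [w3 w3P] := @matrix_choice R r 1 (fun i j z =>
    w i j = g1 * w1 i j + g2 * w2 i j + g3 * z) w2P.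
have {w3P w2P w1P} wE' : w = g1 *: w1 + g2 *: w2 + g3 *: w3.
  by apply/matrixP => i j; rewrite w3P !mxE.
have [|a [b [c [_ _ tE']]]] := @koszul3 _ _ _ g1 g2 g3 (p - B^T *m w1) (q - B^T *m w2)
    (t - B^T *m w3) reg.1.
  have E : g1 *: p + g2 *: q + g3 *: t - B^T *m w = 0 by rewrite wE subrr.
  rewrite wE' !mulmxDr -!scalemxAr in E; rewrite -[RHS]E.
  by apply/colP => i; rewrite !mxE; ring.
have tS : g1 *: a2 - g2 *: a1 = g1 *: (skewm B *m b) - g2 *: (skewm B *m a).
  have := congr1 (mulmx (skewm B)) tE'; rewrite mulmxBr mulmxA mul_skew_tr mul0mx subr0.
  by rewrite -tE mulmxBr -!scalemxAr.
have [|z zE] := @regular2_mx _ _ _ g1 g2 (a1 - skewm B *m a) (a2 - skewm B *m b) reg.1.1.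
  by rewrite !scalerBr; apply: subr_exchange.
exists z; apply: (scaler_mxI g10); rewrite a1E scalemxAr -zE mulmxBr.
by rewrite mulmxA mul_B_skew mul0mx subr0.
Qed.

End SkewIdeal.

(** * Graded determinants and the Hilbert-Burch theorem *)

Section GradedDeterminants.
Variables (k : fieldType) (n : nat).
Local Notation R := {mpoly k[n]}.

Lemma graded_entryM a e a' e' (x y : R) : graded_entry a e x -> graded_entry a' e' y ->
  graded_entry (a + a') (e + e') (x * y).
Proof.
move=> [xh x0] [yh y0].
have [ea|ae] := ltnP e a; first by rewrite x0 // mul0r; split=> // _; apply: dhomog0.
have [ea'|ae'] := ltnP e' a'; first by rewrite y0 // mulr0; split=> // _; apply: dhomog0.
split=> [_|]; last by rewrite ltnNge leq_add.
have -> : (e + e' - (a + a') = e - a + (e' - a'))%N.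
  by rewrite subnDA -addnBAC // -addnBA.
by apply: dhomogM; [apply: xh | apply: yh].
Qed.

Lemma graded_entryD a e (x y : R) : graded_entry a e x -> graded_entry a e y ->
  graded_entry a e (x + y).
Proof.
move=> [xh x0] [yh y0]; split=> [ae|ea]; last by rewrite x0 // y0 // addr0.
by apply: rpredD; [apply: xh | apply: yh].
Qed.

Lemma graded_entry0 a e : graded_entry a e (0 : R).
Proof. by split=> // _; apply: dhomog0. Qed.

Lemma graded_entry_shift b a e (x : R) :
  graded_entry (a + b) (e + b) x <-> graded_entry a e x.
Proof. by rewrite /graded_entry leq_add2r ltn_add2r subnDr. Qed.

Lemma graded_entry_const a (x : R) : graded_entry a a x <-> x \is 0.-homog.
Proof. by rewrite /graded_entry leqnn ltnn subnn; split=> [[-> //]|]. Qed.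

Lemma graded_entry_sum (I : Type) (s : seq I) (P : pred I) a e (F : I -> R) :
  (forall i, P i -> graded_entry a e (F i)) ->
  graded_entry a e (\sum_(i <- s | P i) F i).
Proof.
move=> Fh; apply: big_ind => //; first exact: graded_entry0.
by move=> x y; apply: graded_entryD.
Qed.

Lemma graded_entryN1 j : graded_entry 0 0 ((-1) ^+ j : R).
Proof.
apply/graded_entry_const; rewrite -signr_odd; case: (odd j).
  by rewrite expr1 rpredN dhomog1.
by rewrite expr0 dhomog1.
Qed.

(** All terms of the expansion have the same degree, the sum of the row
    degrees minus that of the column degrees. *)
Lemma graded_entry_det m (M : 'M[R]_m) (c e : 'I_m -> nat) :
  (forall i j, graded_entry (e j) (c i) (M i j)) ->
  graded_entry (\sum_j e j) (\sum_i c i) (\det M).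
Proof.
move=> Mh; apply: graded_entry_sum => s _.
rewrite -[X in graded_entry X]add0n -[X in graded_entry _ X]add0n.
apply: graded_entryM; first exact: graded_entryN1.
rewrite [X in graded_entry X](reindex_inj (@perm_inj _ s)) /=.
elim: (index_enum _) => [|i l IHl]; first by rewrite !big_nil; apply/graded_entry_const/dhomog1.
by rewrite !big_cons; apply: graded_entryM.
Qed.

Lemma dhomog_pos_coeff0 d (p : R) : (0 < d)%N -> p \is d.-homog -> p@_0 = 0.
Proof.
move=> d0 ph; apply: (dhomog_nemf_coeff ph).
by rewrite /= mdeg0 neq_ltn d0.
Qed.

Lemma unit_coeff0 (p q : R) : p * q = 1 -> p@_0 != 0.
Proof.
move=> pq; apply/eqP => p0; have := congr1 (mcoeff 0%MM) pq.
by rewrite rmorphM /= p0 mul0r mcoeff1 eqxx => /esym/eqP; rewrite oner_eq0.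
Qed.

Lemma is_unitP (p q : R) : p * q = 1 -> p = (p@_0)%:MP.
Proof. by rewrite mulrC => /mpoly_intro_unit /andP [/eqP]. Qed.

End GradedDeterminants.

Section HilbertBurch.
Variables (R : idomainType) (r : nat) (eta : 'M[R]_(3 + r, r.+2)).
Local Notation A := (usubmx eta).
Local Notation B := (dsubmx eta).

Definition upper_minors : 'rV[R]_3 := \row_(i < 3) signed_minor eta (lshift r i : 'I_(3 + r)).
(** The minors that omit a row of B complete the upper ones to the full
    Hilbert-Burch relation. *)
Definition lower_minors : 'rV[R]_r := \row_(i < r) signed_minor eta (rshift 3 i : 'I_(3 + r)).

Lemma fixing_minorP x : is_fixing_minor eta x <->
  exists i : 'I_3, x = \det (row' (lshift r i : 'I_(3 + r)) eta).
Proof.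
split=> [[f [finc fB ->]]|[i ->]].
  have [p [f' [/increasing_id f'id fE]]] := increasing_lift finc (leqnn _).
  have {f'id} fE j : f j = lift p j by rewrite fE f'id.
  have [i pE] : exists i : 'I_3, p = (lshift r i : 'I_(3 + r)).
    case: (splitP (p : 'I_(3 + r))) => i pi; first by exists i; apply: val_inj.
    have [j fj] := fB i; have : f j = p by rewrite fj; apply: val_inj.
    by rewrite fE => /eqP; rewrite eq_sym (negPf (neq_lift _ _)).
  exists i; congr (\det _); apply/matrixP => a b; rewrite !mxE fE pE; congr (eta _ _).
exists (lift (lshift r i : 'I_(3 + r))); split=> //; first exact: increasing_lift0.
move=> l; have /unlift_some [j jE _] : (lshift r i : 'I_(3 + r)) != rshift 3 l.
  by rewrite -val_eqE /= neq_ltn (leq_trans (ltn_ord i)) // leq_addr.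
by exists j; rewrite -jE.
Qed.

Lemma maximal_minors_idealP x : minors_ideal r.+2 eta x <->
  ideal_gen (fun y => exists i, y = signed_minor eta i) x.
Proof.
split; apply: ideal_gen_min (ideal_gen_is_ideal _) _.
  move=> _ [f [g [finc /increasing_id gid ->]]].
  have [p [f' [/increasing_id f'id fE]]] := increasing_lift finc (leqnn _).
  have -> : \det (mxsub f g eta) = (-1) ^+ p * signed_minor eta p.
    rewrite /signed_minor mulrA -exprD -signr_odd oddD addbb mul1r; congr (\det _).
    by apply/matrixP => i j; rewrite !mxE fE f'id gid.
  have [_ _] := ideal_gen_is_ideal (fun y => exists i, y = signed_minor eta i); apply.
  by apply: ideal_gen_sub; exists p.
move=> _ [i ->]; have [_ _] := ideal_gen_is_ideal (is_minor r.+2 eta); apply.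
apply: ideal_gen_sub; exists (lift i), id; split=> //; exact: increasing_lift0.
Qed.

Lemma fixing_minors_generate x :
  ideal_gen (is_fixing_minor eta) x <-> exists c : 'cV_3, x = (upper_minors *m c) 0 0.
Proof.
split.
  apply: (@ideal_gen_min _ _ (fun x => exists c : 'cV_3, x = (upper_minors *m c) 0 0))
    => [|_ /fixing_minorP [i ->]].
    split; first by exists 0; rewrite mulmx0 mxE.
      by move=> _ _ [c ->] [c' ->]; exists (c + c'); rewrite mulmxDr !mxE.
    by move=> a _ [c ->]; exists (a *: c); rewrite -scalemxAr !mxE.
  exists ((-1) ^+ i *: delta_mx i 0).
  rewrite -scalemxAr -colE !mxE /signed_minor mulrA /= -exprD -signr_odd oddD addbb.
  by rewrite mul1r.
move=> [c ->]; rewrite mxE; apply: is_ideal_sum (ideal_gen_is_ideal _) _ => i _.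
have [_ _ IM] := ideal_gen_is_ideal (is_fixing_minor eta); rewrite mulrC mxE.
apply: (IM); apply: (IM); apply: ideal_gen_sub; apply/fixing_minorP; by exists i.
Qed.

Lemma minors_relation : upper_minors *m A + lower_minors *m B = 0.
Proof.
have := signed_minor_relation (eta : 'M_(r.+3, r.+2)).
rewrite (@big_split_ord _ _ _ 3 r) /= => E; rewrite -[RHS]E.
congr (_ + _); apply/rowP => j; rewrite mxE summxE; apply: eq_bigr => i _;
  by rewrite !mxE.
Qed.

(** That is, I_r(B) I_m(eta) is contained in the ideal of the minors fixing B.
    If B L = b, multiplying minors_relation by L expresses b times the minors
    omitting a row of B through the upper ones. *)
Lemma conductor_upper_minors b x : skew_ideal B b -> minors_ideal r.+2 eta x ->
  exists c : 'cV_3, b * x = (upper_minors *m c) 0 0.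
Proof.
move=> /skew_ideal_splits [L LE] /maximal_minors_idealP.
pose I x := exists c : 'cV_3, b * x = (upper_minors *m c) 0 0.
have II : is_ideal I.
  split; first by exists 0; rewrite mulmx0 mulr0 mxE.
    by move=> y z [c cE] [c' c'E]; exists (c + c'); rewrite mulmxDr mulrDr cE c'E [RHS]mxE.
  by move=> a y [c cE]; exists (a *: c); rewrite -scalemxAr mulrCA cE [RHS]mxE.
apply: ideal_gen_min II _ => _ [i ->]; case: (splitP (i : 'I_(3 + r))) => l il.
  exists (b *: delta_mx l 0); rewrite -scalemxAr -colE !mxE; congr (_ * signed_minor _ _).
  exact: val_inj.
have gE : b *: lower_minors = - (upper_minors *m (A *m L)).
  rewrite -mul_mx_scalar -LE !mulmxA -mulNmx; congr (_ *m _).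
  by apply/eqP; rewrite -addr_eq0 addrC minors_relation.
exists (- (A *m L *m delta_mx l 0)); rewrite mulmxN mulmxA -mulNmx -gE -colE !mxE.
congr (_ * signed_minor _ _); exact: val_inj.
Qed.

Lemma maximal_minors_inj b : minors_ideal r.+2 eta b -> b != 0 ->
  forall v : 'cV_(r.+2), eta *m v = 0 -> v = 0.
Proof.
move=> Ib b0 v ev; suff bv : b *: v = 0 by apply: (scaler_mxI b0); rewrite bv scaler0.
move/maximal_minors_idealP: Ib; pose I x := x *: v = 0.
apply: (@ideal_gen_min _ _ I) => [|_ [i ->]].
  split; rewrite /I; first by rewrite scale0r.
    by move=> x y xv yv; rewrite scalerDl xv yv addr0.
  by move=> a x xv; rewrite -scalerA xv scaler0.
have rv : row' i eta *m v = 0.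
  have -> : row' i eta = rowsub (lift i) eta by rewrite row'Esub.
  by rewrite mul_rowsub_mx ev; apply/matrixP => a c; rewrite !mxE.
by rewrite /I /signed_minor -scalerA -[X in _ *: X]mul_scalar_mx -mul_adj_mx -mulmxA rv mulmx0 scaler0.
Qed.

(** A syzygy of the upper minors, extended by zeros, is a syzygy of all
    maximal minors of eta, hence a combination of the columns of eta. *)
Lemma hilbert_burch_exact (c : 'cV_3) : grade_ge 2 (minors_ideal r.+2 eta) ->
  upper_minors *m c = 0 -> exists v : 'cV_(r.+2), c = A *m v /\ B *m v = 0.
Proof.
move=> gr fc; have [u [v [reg Iu _]]] := grade_ge2P gr.
have inj := maximal_minors_inj Iu (regular2_neq0 reg).
have [|w wE] := @grade2_image _ _ _ _ eta (col_mx c 0) gr inj.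
  move=> b /maximal_minors_idealP; apply: ideal_gen_min (image_conductor _ _) _ => _ [i ->].
  apply: signed_minor_exact; rewrite (@big_split_ord _ _ _ 3 r) /= [X in _ + X]big1.
    move/matrixP: fc => /(_ 0 0); rewrite addr0 !mxE => E; rewrite -[RHS]E.
    by apply: eq_bigr => l _; rewrite !mxE (unsplitK (inl _)) mulrC.
  by move=> l _; rewrite !mxE (unsplitK (inr _)) mxE mul0r.
exists w; move: wE; rewrite -{1}[eta]vsubmxK mul_col_mx => /eq_col_mx [-> <-].
by [].
Qed.

Lemma eta_rows : eta =
  cons_row (row 0 A) (cons_row (row 1 A) (cons_row (row 2 A) B)).
Proof.
apply/matrixP => s t; case: (unliftP (ord0 : 'I_(r.+3)) s) => [s1|] ->; last first.
  by rewrite cons_row0 !mxE; congr (eta _ _); apply: val_inj.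
rewrite cons_rowS; case: (unliftP ord0 s1) => [s2|] ->; last first.
  by rewrite cons_row0 !mxE; congr (eta _ _); apply: val_inj.
rewrite cons_rowS; case: (unliftP ord0 s2) => [s3|] ->; last first.
  by rewrite cons_row0 !mxE; congr (eta _ _); apply: val_inj.
by rewrite cons_rowS !mxE; congr (eta _ _); apply: val_inj.
Qed.

(** The minor omitting one row of A is the determinant of the two other rows
    of A on top of B, which is the value on them of the alternating form S. *)
Lemma upper_minors_skew (i j l : 'I_3) :
  (i, j, l) \in [:: (1, 2, 0); (2, 0, 1); (0, 1, 2)] ->
  upper_minors 0 l = (A *m skewm B *m A^T) i j.
Proof.
have ASA a b : (A *m skewm B *m A^T) a b = det2 B (row a A) (row b A).
  by rewrite det2E tr_row -row_mul !mxE; apply: eq_bigr => s _; rewrite !mxE.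
have lsE : [/\ (lshift r (0 : 'I_3) : 'I_(3 + r)) = ord0 :> 'I_(r.+3),
    (lshift r (1 : 'I_3) : 'I_(3 + r)) = lift ord0 ord0 :> 'I_(r.+3)
  & (lshift r (2 : 'I_3) : 'I_(3 + r)) = lift ord0 (lift ord0 ord0) :> 'I_(r.+3)].
  by split; apply: val_inj.
have [l0 l1 l2] := lsE.
rewrite ASA !inE => /or3P [] /eqP [-> -> ->]; rewrite mxE /signed_minor ?l0 ?l1 ?l2.
- by rewrite expr0 mul1r {1}eta_rows row'0_cons_row.
- by rewrite expr1 mulN1r {1}eta_rows row'S_cons_row row'0_cons_row det2_anti.
- by rewrite expr2 mulrNN !mul1r {1}eta_rows !row'S_cons_row row'0_cons_row.
Qed.

End HilbertBurch.

(** * From a level matrix to an almost Cohen-Macaulay ideal *)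

Section LevelToIdeal.
Variables (k : fieldType) (n : nat).
Local Notation R := {mpoly k[n]}.

Lemma ideal_is_ideal (A : comNzRingType) (J : ideal A) : is_ideal (fun x => x \in J).
Proof.
split=> [|x y Jx Jy|a x Jx]; [exact: rpred0 | exact: rpredD |].
exact: (rpredZ a (Jx : (x : A^o) \in J)).
Qed.

Lemma has_height_grade (I : R -> Prop) h :
  is_ideal I -> has_height I h -> grade_ge h I.
Proof. by move=> II /(has_height_seq II) [s]; exists s. Qed.

Lemma minors_is_ideal (A : comNzRingType) t p q (M : 'M[A]_(p, q)) :
  is_ideal (minors_ideal t M).
Proof. exact: ideal_gen_is_ideal. Qed.

Variables (d t : nat) (delta eps : nat -> nat) (eta : 'M[R]_(3 + t.+1, t.+3)).
Local Notation A := (usubmx eta).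
Local Notation B := (dsubmx eta).
Variable J : ideal R.
Hypothesis J_gen : forall x, x \in J <-> ideal_gen (is_fixing_minor eta) x.
Hypothesis ht_eta : has_height (minors_ideal t.+3 eta) 2.
Hypothesis ht_B : has_height (minors_ideal t.+1 B) 3.

Let f := upper_minors eta.

Let fJ : generates J f.
Proof. by move=> x; rewrite J_gen; apply: fixing_minors_generate. Qed.

Let grade_eta : grade_ge 2 (minors_ideal t.+3 eta).
Proof. exact: has_height_grade (minors_is_ideal _ _) ht_eta. Qed.

Let grade_B : grade_ge 3 (skew_ideal B).
Proof.
apply: grade_ge_sub (has_height_grade (minors_is_ideal _ _) ht_B).
by move=> x /skew_idealP.
Qed.

Let B_inj (w : 'cV_(t.+1)) : B^T *m w = 0 -> w = 0.
Proof.
have [u [v [reg Iu _]]] := grade_ge2P (grade_ge_le (leqnSn 2) grade_B).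
exact: trmx_injective_of_skew Iu (regular2_neq0 reg) w.
Qed.

Let eta_inj (v : 'cV_(t.+3)) : eta *m v = 0 -> v = 0.
Proof.
have [u [w [reg Iu _]]] := grade_ge2P grade_eta.
exact: maximal_minors_inj Iu (regular2_neq0 reg) v.
Qed.

Let f_syzygy (c : 'cV_3) : f *m c = 0 -> exists z : 'cV_(t.+3), A *m skewm B *m z = c.
Proof.
move=> /(hilbert_burch_exact grade_eta) [v [-> /(exact_B_skew B_inj grade_B) [z ->]]].
by exists z; rewrite mulmxA.
Qed.

Let exact_f : exact_at f (A *m skewm B).
Proof.
move=> c; split=> [/f_syzygy //|[z <-]].
have /eqP := minors_relation eta; rewrite addr_eq0 => /eqP fA.
by rewrite !mulmxA fA !mulNmx -(mulmxA _ B) mul_B_skew mulmx0 mul0mx oppr0.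
Qed.

Let exact_A : exact_at (A *m skewm B) B^T.
Proof.
move=> z; split=> [ASz|[w <-]]; last by rewrite -mulmxA [_ *m (_ *m w)]mulmxA mul_skew_tr mul0mx mulmx0.
have [|w ->] := exact_skew_B B_inj (grade_ge_le (leqnSn 2) grade_B) (x := z).
  apply: eta_inj; rewrite -{1}[eta]vsubmxK mul_col_mx !mulmxA ASz.
  by rewrite mul_B_skew mul0mx col_mx0.
by exists w.
Qed.

(** A prime over J either contains I_m(eta) or, by conductor_upper_minors,
    contains the minors of B, and then has height at least 3. *)
Lemma level_ideal_height : has_height (fun x => x \in J) 2.
Proof.
have [[P [IP Ph]] hmin] := ht_eta; split.
  exists P; split=> // x /J_gen; apply: ideal_gen_min (prime_is_ideal P) _ => y.
  move=> /fixing_minorP [i ->]; apply: IP; apply/maximal_minors_idealP.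
  pose p := (lshift t.+1 i : 'I_(3 + t.+1)) : 'I_(t.+4).
  have -> : \det (row' p eta) = (-1) ^+ p * signed_minor eta p.
    by rewrite /signed_minor mulrA -exprD -signr_odd oddD addbb mul1r.
  have [_ _] := ideal_gen_is_ideal (fun y => exists i, y = signed_minor eta i); apply.
  by apply: ideal_gen_sub; exists p.
move=> P' h' JP' P'h'.
have [IP'|] := boolp.pselect (forall x, minors_ideal t.+3 eta x -> x \in P').
  exact: hmin IP' P'h'.
move=> nIP'; apply: (leq_trans (leqnSn 2)); case: ht_B => _; apply; last exact: P'h'.
move=> b /skew_idealP Ib; apply: boolp.contrapT => bP'; apply: nIP' => x Ix.
have [c cE] := conductor_upper_minors Ib Ix.
have : b * x \in P' by apply: JP'; apply/fJ; exists c.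
by rewrite prime_idealrM => /orP [].
Qed.

(** A shorter resolution would split B^T, which would then remain injective
    modulo a prime containing all maximal minors of B, against McCoy's
    theorem. *)
Lemma level_pdim : has_pdim (ideal_mod J) 2.
Proof.
split; first by apply: matrix_resolution fJ exact_f exact_A B_inj _; left.
move=> l res; rewrite ltnNge; apply/negP => l1.
have [T [AT Tid]] := matrix_kernel_splits1 res l1 fJ exact_f.
have [W WE] : exists W, T = B^T *m W.
  have /boolp.choice [w wE] : forall j, exists w : 'cV_(t.+1), B^T *m w = col j T.
    by move=> j; apply/exact_A; rewrite colE mulmxA AT mul0mx.
  exists (\matrix_(i, j) w j i 0); apply/matrixP => i j.
  have /matrixP /(_ i 0) := wE j; rewrite !mxE => <-.
  by apply: eq_bigr => s _; rewrite !mxE.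
have Wid (w : 'cV_(t.+1)) : W *m (B^T *m w) = w.
  apply/eqP; rewrite -subr_eq0; apply/eqP; apply: B_inj; rewrite mulmxBr [B^T *m (W *m _)]mulmxA.
  by rewrite -WE Tid ?subrr //; apply/exact_A; exists w.
have [[P [IP _]] _] := ht_B.
suff : 1 \in P by apply/negP; apply: prime1.
apply: (@mccoy_skew _ _ B (fun x => x \in P) 1 (prime_is_ideal P)).
  move=> w wP j; rewrite -(Wid w) mxE; apply: rpred_sum => i _; exact: idealMr.
by move=> b Ib; rewrite mul1r; apply: IP; apply/skew_idealP.
Qed.

Hypothesis lat : latent_data d t.+3 delta eps.
Hypothesis A_graded : forall (i : 'I_3) (j : 'I_(t.+3)), graded_entry (delta j.+1) d (A i j).
Hypothesis B_graded : forall (i : 'I_(t.+1)) (j : 'I_(t.+3)),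
  graded_entry (delta j.+1) (delta (i + 3) + eps i.+1) (B i j).

(** By the latent data the rows of eta other than one row of A have degrees
    adding up to d plus the sum of all the delta_j. *)
Lemma level_homog i : f 0 i \is d.-homog.
Proof.
pose rho (s : 'I_(3 + t.+1)) := match split s with
  | inl _ => d | inr l => (delta (l + 3) + eps l.+1)%N end.
have eta_graded s (j : 'I_(t.+3)) : graded_entry (delta j.+1) (rho s) (eta s j).
  rewrite -[eta]vsubmxK mxE /rho; case: split => l; [exact: A_graded | exact: B_graded].
pose p := (lshift t.+1 i : 'I_(3 + t.+1)) : 'I_(t.+4).
have det_graded : graded_entry (\sum_(j < t.+3) delta j.+1)
    (\sum_(s < t.+3) rho (lift p s)) (\det (row' p eta)).
  by apply: graded_entry_det => s j; rewrite mxE.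
have sum_delta : (\sum_(j < t.+3) delta j.+1 =
    0 + (d + (\sum_(1 <= j < t.+2) eps j + \sum_(i < t.+1) delta (i + 3))))%N.
  rewrite 2!big_ord_recl /= addnA (latent_sum lat) -addnA; congr (_ + (_ + _))%N.
  by apply: eq_bigr => l _; rewrite addn3.
have sum_rho : (\sum_(s < t.+3) rho (lift p s) =
    d + (d + (\sum_(1 <= j < t.+2) eps j + \sum_(i < t.+1) delta (i + 3))))%N.
  have rhop : rho p = d by rewrite /rho (unsplitK (inl i)).
  have : (\sum_(s < t.+4) rho s = d + \sum_(s < t.+3) rho (lift p s))%N.
    by rewrite (bigD1_ord p) //= rhop.
  rewrite (@big_split_ord _ _ _ 3 t.+1) /=.
  have -> : (\sum_(s < 3) rho (lshift t.+1 s) = 3 * d)%N.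
    rewrite (eq_bigr (fun=> d)); first by rewrite sum_nat_const card_ord.
    by move=> s _; rewrite /rho (unsplitK (inl s)).
  have -> : (\sum_(s < t.+1) rho (rshift 3 s) =
      \sum_(i < t.+1) delta (i + 3) + \sum_(1 <= j < t.+2) eps j)%N.
    rewrite big_add1 big_mkord -big_split; apply: eq_bigr => s _.
    by rewrite /rho (unsplitK (inr s)).
  move: (\sum_(i < t.+1) delta (i + 3))%N (\sum_(1 <= j < t.+2) eps j)%N => X Y.
  set Z := (\sum_(s < _) _)%N. lia.
rewrite sum_delta sum_rho in det_graded; move/graded_entry_shift: det_graded => [+ _].
rewrite subn0 => /(_ isT) det_homog; rewrite mxE /signed_minor -signr_odd.
by case: (odd _); rewrite ?expr1 ?mulN1r ?rpredN ?expr0 ?mul1r.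
Qed.

Let grade_J : grade_ge 2 (fun x => x \in J).
Proof. exact: has_height_grade (ideal_is_ideal J) level_ideal_height. Qed.

(** If u = L u' and v = L v' form a regular sequence, then v u' = u v' makes
    u' a multiple of u, so L is a unit. *)
Lemma grade2_not_principal (I : R -> Prop) L : grade_ge 2 I ->
  (forall x, I x -> exists y, x = L * y) -> exists z, L * z = 1.
Proof.
move=> /grade_ge2P [u [v [reg Iu Iv]]] IL.
have u0 := regular2_neq0 reg.
have [u' uE] := IL u Iu; have [v' vE] := IL v Iv.
have [|z u'E] := @regular2_dvd _ u v u' v' reg; first by rewrite uE vE; ring.
exists z; apply: (mulfI u0); rewrite mulr1 {2}uE u'E; ring.
Qed.

(** If d = 1, then all delta_j are 1 and m = 3, so A is a 3 x 3 matrix of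
    constants. It is singular, since eta would otherwise have a unit minor; a
    constant row lam with lam A = 0 also annihilates the syzygies of f, which
    forces the three forms to be multiples of one of them. *)
Lemma level_degree : (1 < d)%N.
Proof.
rewrite ltnNge; apply/negP => d1.
have dE : d = 1%N by apply/eqP; rewrite eqn_leq d1 (latent_d lat).
have [de1 de2 de3] : [/\ delta 1 = 1%N, delta 2 = 1%N & delta 3 = 1%N].
  have := latent_delta1 lat; have := latent_delta_le lat (i := 1) isT.
  have := latent_delta_le lat (i := 2) isT; have := latent_delta3 lat.
  by rewrite dE => *; split; lia.
have t0 : t = 0%N.
  have := latent_sum lat; rewrite de1 de2 dE big_add1 /= => /eqP.
  rewrite [X in X == _]/= addn1 => E.
  have : (\sum_(0 <= j < t.+1) 1 <= \sum_(0 <= j < t.+1) eps j.+1)%N.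
    rewrite !big_nat; apply: leq_sum => j jt; apply: (latent_eps lat).
    by move: jt; rewrite subSS subn1.
  by rewrite sum_nat_const_nat subn0 muln1; move: E; set X := (\sum_(_ <= _ < _) _)%N; lia.
have deltaE (j : 'I_(t.+3)) : delta j.+1 = d.
  rewrite dE; have : (j < 3)%N by rewrite -[X in (_ < X)%N](congr1 (fun x => x.+3) t0).
  by case: (j : nat) => [|[|[|]]].
have A_const i j : A i j = ((A i j)@_0)%:MP.
  have [+ _] := A_graded i j; rewrite deltaE leqnn subnn => /(_ isT) h.
  by rewrite -{1}(pihomog_dE h) pihomog0E.
have [lam lam0 lamA] : exists2 lam : 'rV[k]_3, lam != 0 & map_mx (@mpolyC n k) lam *m A = 0.
  have e3 : t.+3 = 3 by rewrite t0.
  pose p := (rshift 3 (ord0 : 'I_(t.+1)) : 'I_(3 + t.+1)) : 'I_(t.+4).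
  have ME s j : row' p eta s j = A (cast_ord e3 s) j.
    rewrite !mxE; congr (eta _ _); apply: val_inj; rewrite /= /bump leqNgt.
    by rewrite (_ : (s < _)%N) //= -[X in (_ < X)%N]e3.
  pose M0 : 'M[k]_(t.+3) := map_mx (mcoeff 0%MM) (row' p eta).
  have M0E : row' p eta = map_mx (@mpolyC n k) M0.
    by apply/matrixP => s j; rewrite ![in RHS]mxE -/(row' p eta s j) ME {1}A_const -ME mxE.
  have [/eqP/det0P [v v0 vM]|detM] := eqVneq (\det M0) 0.
    exists (\row_i v 0 (cast_ord (esym e3) i)).
      apply: contraNneq v0 => l0; apply/eqP/rowP => s.
      by have /rowP /(_ (cast_ord e3 s)) := l0; rewrite !mxE cast_ordK.
    apply/rowP => j; have /rowP /(_ j) := congr1 (map_mx (@mpolyC n k)) vM.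
    rewrite map_mxM -M0E !mxE mpolyC0 => E; rewrite -[RHS]E.
    rewrite (reindex (cast_ord e3)) /=; last first.
      by exists (cast_ord (esym e3)) => s _; rewrite ?cast_ordK ?cast_ordKV.
    by apply: eq_bigr => s _; rewrite ![map_mx _ _ _ _]mxE mxE cast_ordK ME.
  case: (has_height_proper (minors_is_ideal _ _) ht_eta); apply/maximal_minors_idealP.
  have [_ _ IM] := ideal_gen_is_ideal (fun y => exists i, y = signed_minor eta i).
  have -> : 1 = ((\det M0)^-1 * (-1) ^+ p)%:MP * signed_minor eta p.
    have sgnE : (-1) ^+ p = ((-1) ^+ p)%:MP :> R by rewrite rmorphXn rmorphN1.
    have detE : \det (row' p eta) = (\det M0)%:MP by rewrite {1}M0E; apply: det_map_mx.
    rewrite /signed_minor detE sgnE -!mpolyCM -mulrA [_ ^+ _ * (_ * _)]mulrA.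
    by rewrite -exprD -signr_odd oddD addbb mul1r mulVf.
  by apply: (IM); apply: ideal_gen_sub; exists p.
have [i0 lami0] : exists i, lam 0 i != 0 by apply/rV0Pn.
(* Two entries of f have the obvious syzygy, which lam must kill. *)
have par j : f 0 j = f 0 i0 * ((lam 0 i0)^-1 * lam 0 j)%:MP.
  pose c : 'cV[R]_3 := f 0 i0 *: delta_mx j 0 - f 0 j *: delta_mx i0 0.
  have row_delta (v : 'rV[R]_3) l : v *m delta_mx l 0 = (v 0 l)%:M :> 'M_1.
    by rewrite -colE; apply/rowP => s; rewrite [s]ord1 !mxE mulr1n.
  have [|z zE] := f_syzygy (c := c).
    by rewrite mulmxBr -!scalemxAr !row_delta !scale_scalar_mx mulrC subrr.
  have : map_mx (@mpolyC n k) lam *m c = 0 by rewrite -zE !mulmxA lamA !mul0mx.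
  have scalar_inj (x y : R) : x%:M - y%:M = 0 :> 'M_1 -> x = y.
    by move/matrixP/(_ 0 0); rewrite !mxE !mulr1n => /eqP; rewrite subr_eq0 => /eqP.
  rewrite mulmxBr -!scalemxAr !row_delta !scale_scalar_mx => /scalar_inj.
  rewrite ![map_mx _ _ _ _]mxE; move: (f 0 i0) (f 0 j) => x y E.
  by rewrite mpolyCM mulrCA E mulrCA -mpolyCM mulVf // mulr1.
have [|z] := @grade2_not_principal _ (f 0 i0) grade_J.
  move=> x /fJ [c ->]; exists (\sum_j ((lam 0 i0)^-1 * lam 0 j)%:MP * c j 0).
  by rewrite mxE mulr_sumr; apply: eq_bigr => j _; rewrite [in LHS](par j) -mulrA.
move/unit_coeff0/eqP; apply; apply: dhomog_pos_coeff0 (level_homog i0).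
exact: latent_d lat.
Qed.

End LevelToIdeal.

(** * Ranks, reduction modulo regular sequences and cross products *)

Section ExactRank.
Variable R : idomainType.
Local Notation K := {fraction R}.
Local Notation frac_mx := (map_mx (@FracField.tofrac R)).

Lemma fracP (x : K) : exists a b : R, b != 0 /\ x * FracField.tofrac b = FracField.tofrac a.
Proof.
elim/quotW: x => y; exists (frac y).1, (frac y).2; split; first exact: denom_ratioP.
unlock FracField.tofrac; rewrite -[LHS]FracField.pi_mul; apply/eqmodP.
rewrite /= FracField.equivfE /FracField.mulf !numden_Ratio ?(mulf_neq0, oner_neq0, denom_ratioP) //.
by rewrite !mulr1 mulrC.
Qed.

Lemma clear_denominators p (v : 'cV[K]_p) :
  exists (b : R) (w : 'cV[R]_p), b != 0 /\ FracField.tofrac b *: v = frac_mx w.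
Proof.
have [a aP] := boolp.choice (fun i : 'I_p => fracP (v i 0)).
have [b bP] := boolp.choice aP.
exists (\prod_i b i), (\col_i (a i * \prod_(j | j != i) b j)); split.
  by apply/prodf_neq0 => i _; have [] := bP i.
apply/colP => i; rewrite !mxE (bigD1 i) //= !rmorphM /= mulrAC.
by have [_ <-] := bP i; rewrite [_ * v i 0]mulrC.
Qed.

Lemma frac_mx_eq0 p q (M : 'M[R]_(p, q)) : frac_mx M = 0 -> M = 0.
Proof.
move=> /matrixP M0; apply/matrixP => i j; have := M0 i j; rewrite !mxE => /eqP.
by rewrite tofrac_eq0 => /eqP.
Qed.

(** Exactness over R passes to the fraction field by clearing denominators,
    where the kernel has complementary rank. *)
Lemma exact_rank p q r (A : 'M[R]_(p, q)) (B : 'M[R]_(q, r)) : exact_at A B ->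
  (\rank (frac_mx A) + \rank (frac_mx B) = q)%N.
Proof.
move=> AB; rewrite -(mxrank_tr (frac_mx A)) -(mxrank_tr (frac_mx B)).
suff kerE : (kermx (frac_mx A)^T :=: (frac_mx B)^T)%MS.
  by rewrite -kerE mxrank_ker subnKC // rank_leq_row.
apply/eqmxP/andP; split.
  apply/rV_subP => v /sub_kermxP vA.
  have [b [w [b0 bw]]] := clear_denominators v^T.
  have [|z zE] := (AB w).1.
    by apply: frac_mx_eq0; rewrite map_mxM -bw -scalemxAr -[_ *m _]trmxK trmx_mul trmxK vA trmx0 scaler0.
  have b0' : FracField.tofrac b != 0 by rewrite tofrac_eq0.
  have -> : v = ((FracField.tofrac b)^-1 *: (frac_mx z)^T) *m (frac_mx B)^T.
    rewrite -scalemxAl -trmx_mul -map_mxM zE -bw linearZ /= trmxK scalerA mulVf //.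
    by rewrite scale1r.
  exact: submxMl.
apply/sub_kermxP; rewrite -trmx_mul -map_mxM; suff -> : A *m B = 0.
  by rewrite map_mx0 trmx0.
apply/matrixP => i j; have /matrixP /(_ i 0) : A *m col j B = 0.
  by apply/AB; exists (delta_mx j 0); rewrite -colE.
by rewrite colE mulmxA -colE !mxE.
Qed.

End ExactRank.

Section FirstRows.
Variable R : comNzRingType.

(** Laplace expansion along the other rows. *)
Lemma det_first_rows q r (qr : (q <= r)%N) (M : 'M[R]_r) (I : R -> Prop) : is_ideal I ->
  (forall g : 'I_q -> 'I_r, I (\det (mxsub (widen_ord qr) g M))) -> I (\det M).
Proof.
move=> II; have [u rE] : exists u, r = (u + q)%N by exists (r - q)%N; rewrite subnK.
elim: u r rE qr M => [|u IHu] r rE qr M Ig.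
  rewrite add0n in rE; subst r; have := Ig id; congr (I (\det _)).
  by apply/matrixP => i j; rewrite mxE; congr (M _ _); apply: val_inj.
rewrite addSn in rE; subst r; rewrite (expand_det_row _ ord_max).
apply: is_ideal_sum => // j _; rewrite /cofactor mulrA; case: (II) => _ _; apply.
apply: (IHu _ erefl (leq_addl u q)) => g.
have := Ig (fun l => lift j (g l)); congr (I (\det _)).
apply/matrixP => a b; rewrite !mxE; congr (M _ _); apply: val_inj.
by rewrite [RHS]lift_max.
Qed.

(** A selection of m among the m + 1 rows has a repetition or is a permutation
    of the rows left by omitting one. *)
Lemma det_rowsub_signed_minor m (N : 'M[R]_(m.+1, m)) (g : 'I_m -> 'I_m.+1) :
  exists a : 'I_m.+1 -> R, \det (rowsub g N) = \sum_i a i * signed_minor N i.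
Proof.
have [ginj|] := boolP (injectiveb g); last first.
  move/injectivePn => [i [j ij gij]]; exists (fun=> 0).
  rewrite big1 ?(determinant_alternate ij) // => [l|l _]; last by rewrite mul0r.
  by rewrite !mxE gij.
have [p [g' [g'inj gE]]] := inj_lift (injectiveP _ ginj) (leqnn m).
exists (fun i => if i == p then (-1) ^+ perm g'inj * (-1) ^+ p else 0).
rewrite (bigD1 p) //= eqxx big1 ?addr0 => [|i /negPf ->]; last by rewrite mul0r.
have -> : rowsub g N = row_perm (perm g'inj) (row' p N).
  by apply/matrixP => i j; rewrite !mxE permE gE.
rewrite row_permE det_mulmx det_perm /signed_minor -mulrA; congr (_ * _).
by rewrite mulrA -exprD -signr_odd oddD addbb mul1r.
Qed.

End FirstRows.

Section RegularInjectivity.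
Variables (R : idomainType) (p q r : nat).
Variables (f : 'M[R]_(1, p)) (A : 'M[R]_(p, q)) (B : 'M[R]_(q, r)).
Hypothesis exact_f : exact_at f A.
Hypothesis exact_A : exact_at A B.
Hypothesis B_inj : forall w : 'cV_r, B *m w = 0 -> w = 0.

(** The maps f, A and B resolve the cokernel of f, and the claim is that its
    Tor_3 against R/(s) vanishes; R/(s) has projective dimension size s. The
    chase divides by the elements of s one at a time. *)
Lemma injective_mod_regular s : regular s -> (size s <= 2)%N ->
  forall w : 'cV_r, (forall i, gens s ((B *m w) i 0)) -> forall j, gens s (w j 0).
Proof.
have AB (z : 'cV_r) : A *m (B *m z) = 0 by apply/exact_A; exists z.
have fA (z : 'cV_q) : f *m (A *m z) = 0 by apply/exact_f; exists z.
case: s => [|x [|y [|? ?]]] //= reg _ w Bw j.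
- by rewrite (B_inj (w := w)) ?mxE //; apply/colP => i; rewrite Bw mxE.
- rename x into u; have u0 : u != 0.
    by case: reg => _ u0; apply/eqP => uE; have := u0 1; rewrite uE mul0r => /(_ erefl) /eqP; rewrite oner_eq0.
  have [a aE] : exists a : 'cV_q, B *m w = u *: a.
    have [a aP] := boolp.choice (fun i => Bw i).
    exists (\col_i a i); apply/colP => i; rewrite !mxE.
    by have [z [-> ]] := aP i; rewrite addr0 mxE => ->; rewrite mulrC.
  have [|a' a'E] := (exact_A a).1.
    by apply: (scaler_mxI u0); rewrite scalemxAr -aE AB scaler0.
  have -> : w = u *: a'.
    apply/eqP; rewrite -subr_eq0; apply/eqP/B_inj.
    by rewrite mulmxBr aE -scalemxAr a'E subrr.
  by exists (a' j 0), 0; rewrite mxE addr0 mulrC.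
- rename x into v, y into u; have u0 : u != 0 := regular2_neq0 reg.
  have [a [b abE]] : exists a b : 'cV_q, B *m w = u *: a + v *: b.
    have [b bP] := boolp.choice (fun i => Bw i).
    have [y yP] := boolp.choice bP.
    have [a aP] := boolp.choice (fun i => (yP i).1).
    exists (\col_i a i), (\col_i b i); apply/colP => i; rewrite ![RHS]mxE.
    have [_ ->] := yP i; have [z [-> ->]] := aP i.
    by rewrite !mxE addr0 addrC mulrC [u * _]mulrC.
  have rel : v *: (A *m b) = u *: (- (A *m a)).
    rewrite scalerN; apply/eqP; rewrite -addr_eq0 addrC; apply/eqP.
    by rewrite !scalemxAr -mulmxDr -abE AB.
  have [z zE] := regular2_mx reg rel.
  have Aa : A *m a = - (v *: z).
    apply: (scaler_mxI u0); rewrite -[LHS]opprK -scalerN -rel zE scalerN.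
    by rewrite !scalerA mulrC.
  have [|y yE] := (exact_f z).1.
    by apply: (scaler_mxI u0); rewrite scalemxAr -zE fA scaler0.
  have [|b' b'E] := (exact_A (b - u *: y)).1.
    by rewrite mulmxBr -scalemxAr yE zE subrr.
  have [|a' a'E] := (exact_A (a + v *: y)).1.
    by rewrite mulmxDr -scalemxAr yE Aa addNr.
  have -> : w = u *: a' + v *: b'.
    apply/eqP; rewrite -subr_eq0; apply/eqP/B_inj.
    rewrite mulmxBr mulmxDr -!scalemxAr a'E b'E abE.
    by apply/colP => i; rewrite !mxE; ring.
  exists (b' j 0), (u * a' j 0); split; first by exists (a' j 0), 0; rewrite addr0 mulrC.
  by rewrite !mxE addrC [v * _]mulrC.
Qed.

End RegularInjectivity.

Section CrossProducts.
Variable R : comNzRingType.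
Implicit Types (x y f : 'cV[R]_3) (X : 'M[R]_3).

(** The vector of an alternating 3 x 3 matrix; on x *m y^T - y *m x^T it is the
    cross product of x and y. *)
Definition axial X (l : 'I_3) : R :=
  match val l with 0 => X 1 2 | 1 => X 2 0 | _ => X 0 1 end.

Definition wedge x y := x *m y^T - y *m x^T.

Lemma wedgeE x y i j : wedge x y i j = x i 0 * y j 0 - y i 0 * x j 0.
Proof. by rewrite !mxE !big_ord1 !mxE. Qed.

Lemma ord3_ind (P : 'I_3 -> Prop) : P 0 -> P 1 -> P 2 -> forall l, P l.
Proof.
move=> P0 P1 P2; case=> [[|[|[|//]]]] l.
- by rewrite (_ : Ordinal l = 0) //; apply: val_inj.
- by rewrite (_ : Ordinal l = 1) //; apply: val_inj.
- by rewrite (_ : Ordinal l = 2) //; apply: val_inj.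
Qed.

Lemma axial0 X : axial X 0 = X 1 2. Proof. by []. Qed.
Lemma axial1 X : axial X 1 = X 2 0. Proof. by []. Qed.
Lemma axial2 X : axial X 2 = X 0 1. Proof. by []. Qed.
Definition axialE := (axial0, axial1, axial2).

Lemma big_ord3 (F : 'I_3 -> R) : \sum_i F i = F 0 + F 1 + F 2.
Proof.
rewrite !big_ord_recl big_ord0 addr0 addrA.
by congr (_ + F _ + F _); apply: val_inj.
Qed.

Lemma axial_wedge_parallel f x y i j :
  \sum_i f i 0 * x i 0 = 0 -> \sum_i f i 0 * y i 0 = 0 ->
  axial (wedge x y) i * f j 0 = axial (wedge x y) j * f i 0.
Proof.
rewrite !big_ord3 => fx fy.
have x2 : f 2 0 * x 2 0 = - (f 0 0 * x 0 0 + f 1 0 * x 1 0).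
  by apply/eqP; rewrite -addr_eq0 addrC fx.
have y2 : f 2 0 * y 2 0 = - (f 0 0 * y 0 0 + f 1 0 * y 1 0).
  by apply/eqP; rewrite -addr_eq0 addrC fy.
have par01 : axial (wedge x y) 0 * f 1 0 = axial (wedge x y) 1 * f 0 0.
  rewrite !axialE !wedgeE; apply/eqP; rewrite -subr_eq0; apply/eqP.
  transitivity (y 2 0 * (f 0 0 * x 0 0 + f 1 0 * x 1 0 + f 2 0 * x 2 0) -
    x 2 0 * (f 0 0 * y 0 0 + f 1 0 * y 1 0 + f 2 0 * y 2 0)); first by ring.
  by rewrite fx fy !mulr0 subrr.
have par02 : axial (wedge x y) 0 * f 2 0 = axial (wedge x y) 2 * f 0 0.
  rewrite !axialE !wedgeE; apply/eqP; rewrite -subr_eq0; apply/eqP.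
  transitivity (x 1 0 * (f 0 0 * y 0 0 + f 1 0 * y 1 0 + f 2 0 * y 2 0) -
    y 1 0 * (f 0 0 * x 0 0 + f 1 0 * x 1 0 + f 2 0 * x 2 0)); first by ring.
  by rewrite fx fy !mulr0 subrr.
have par12 : axial (wedge x y) 1 * f 2 0 = axial (wedge x y) 2 * f 1 0.
  rewrite !axialE !wedgeE; apply/eqP; rewrite -subr_eq0; apply/eqP.
  transitivity (y 0 0 * (f 0 0 * x 0 0 + f 1 0 * x 1 0 + f 2 0 * x 2 0) -
    x 0 0 * (f 0 0 * y 0 0 + f 1 0 * y 1 0 + f 2 0 * y 2 0)); first by ring.
  by rewrite fx fy !mulr0 subrr.
by elim/ord3_ind: i; elim/ord3_ind: j.
Qed.

(** The Koszul syzygy of f in direction l, i.e. the cross product of the l-th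
    unit vector with f. *)
Definition koszul_syzygy f l : 'cV[R]_3 := \col_i axial (wedge (delta_mx l 0) f) i.

Lemma koszul_syzygyP f l : \sum_i f i 0 * koszul_syzygy f l i 0 = 0.
Proof.
rewrite big_ord3 !mxE !axialE !wedgeE.
by elim/ord3_ind: l; rewrite !mxE /=; ring.
Qed.

(** Through this identity, lifts of Koszul syzygies compute the coordinates of
    f. *)
Lemma axial_wedge_koszul f l i :
  axial (wedge (koszul_syzygy f (l + 1)) (koszul_syzygy f (l + 2))) i = f l 0 * f i 0.
Proof.
by elim/ord3_ind: l; elim/ord3_ind: i; rewrite !axialE !wedgeE !mxE !axialE !wedgeE !mxE /=; ring.
Qed.

Lemma axial_wedge_vector x f l i : \sum_i f i 0 * x i 0 = 0 ->
  axial (wedge x (koszul_syzygy f l)) i = - (x l 0 * f i 0).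
Proof.
rewrite big_ord3 => fx; apply/eqP; rewrite -subr_eq0 opprK; apply/eqP.
transitivity ((l == i)%:R * (f 0 0 * x 0 0 + f 1 0 * x 1 0 + f 2 0 * x 2 0)).
  by elim/ord3_ind: l; elim/ord3_ind: i; rewrite !axialE !wedgeE !mxE !axialE !wedgeE !mxE /=; ring.
by rewrite fx mulr0.
Qed.

End CrossProducts.

(** * The alternating form has rank two *)

Section SkewWedge.
Variables (R : idomainType) (r : nat) (B : 'M[R]_(r, r.+2)).
Local Notation S := (skewm B).

Lemma det2_relation_kernel (u v x : 'rV[R]_(r.+2)) (y : 'cV_(r.+2)) : B *m y = 0 ->
  det2 B u v * (x *m y) 0 0 = det2 B u x * (v *m y) 0 0 - det2 B v x * (u *m y) 0 0.
Proof.
move=> By; have [w] := det2_relation B u v x.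
move/(congr1 (mulmx^~ y)); rewrite mulmxDl mulmxBl -(mulmxA w) By mulmx0 addr0.
rewrite -!scalemxAl => /matrixP /(_ 0 0).
by move: (u *m y) (v *m y) (x *m y) => U V X; rewrite !mxE.
Qed.

(** Apply det2_relation to a column of S, which is killed by B: this is the
    Pluecker relation expressing that S is the value of a decomposable
    bivector. *)
Lemma skewm_rank2 (u v : 'rV_(r.+2)) :
  (u *m S *m v^T) 0 0 *: S = (u *m S)^T *m (v *m S) - (v *m S)^T *m (u *m S).
Proof.
have outerE (a b : 'rV[R]_(r.+2)) i l : (a^T *m b) i l = a 0 i * b 0 l.
  by rewrite mxE big_ord1 mxE.
apply/matrixP => i l; rewrite [LHS]mxE [RHS]mxE outerE [X in _ + X]mxE outerE -det2E.
have BS0 : B *m col l S = 0 by rewrite colE mulmxA mul_B_skew mul0mx.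
have := det2_relation_kernel u v (delta_mx 0 i) BS0.
have colS (x : 'rV_(r.+2)) : (x *m col l S) 0 0 = (x *m S) 0 l.
  by rewrite colE mulmxA -colE mxE.
have detd x : det2 B x (delta_mx 0 i) = (x *m S) 0 i.
  by rewrite det2E trmx_delta -colE mxE.
by rewrite !colS !detd -rowE [row _ _ _ _]mxE.
Qed.

(** The identity behind the reconstruction of A: the cross product of two
    columns of A S is a multiple of the axial vector of A S A^T, with the
    alternating form as factor. *)
Lemma wedge_skewm p (A : 'M[R]_(p, r.+2)) (u v : 'cV_(r.+2)) :
  (u^T *m S *m v) 0 0 *: (A *m S *m A^T) =
  (A *m S *m u) *m (A *m S *m v)^T - (A *m S *m v) *m (A *m S *m u)^T.
Proof.
have flip (x : 'cV_(r.+2)) : (x^T *m S)^T = - (S *m x).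
  by rewrite trmx_mul trmxK tr_skew mulNmx.
have flipA (x : 'cV_(r.+2)) : x^T *m S *m A^T = - (A *m S *m x)^T.
  by rewrite -[LHS]trmxK trmx_mul trmxK flip mulmxN mulmxA linearN.
have := skewm_rank2 u^T v^T; rewrite trmxK => /(congr1 (fun X => A *m X *m A^T)).
rewrite -scalemxAr -scalemxAl => ->; rewrite mulmxBr mulmxBl !flip.
rewrite !mulNmx !mulmxN !mulNmx -!mulmxA !(mulmxA _ S A^T) !flipA !mulmxN !opprK.
by rewrite !mulmxA.
Qed.

End SkewWedge.

(** * From a minimal resolution to a level matrix *)

Lemma axialZ (R : comNzRingType) (a : R) X l : axial (a *: X) l = a * axial X l.
Proof. by elim/ord3_ind: l; rewrite !axialE mxE. Qed.

Section GradedUniqueness.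
Variables (k : fieldType) (n : nat).
Local Notation R := {mpoly k[n]}.

(** The degree of a nonzero homogeneous entry is determined; this turns
    identities between entries into identities between shifts. *)
Lemma graded_entry_uniq a e a' e' (x : R) : x != 0 ->
  graded_entry a e x -> graded_entry a' e' x -> (e + a' = e' + a)%N.
Proof.
move=> x0 [xh xz] [xh' xz'].
have ae : (a <= e)%N by rewrite leqNgt; apply: contraNN x0 => /xz ->.
have ae' : (a' <= e')%N by rewrite leqNgt; apply: contraNN x0 => /xz' ->.
have := dhomog_uniq x0 (xh ae) (xh' ae'); lia.
Qed.

Lemma graded_entryN a e (x : R) : graded_entry a e x -> graded_entry a e (- x).
Proof.
move=> [xh x0]; split=> [ae|ea]; last by rewrite x0 // oppr0.
by rewrite rpredN; apply: xh.
Qed.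

Lemma koszul_homog d (f : 'cV[R]_3) l i : (forall j, f j 0 \is d.-homog) ->
  koszul_syzygy f l i 0 \is d.-homog.
Proof.
move=> fh; suff h a b : wedge (delta_mx l 0) f a b \is d.-homog.
  by rewrite mxE /axial; case: (val i) => [|[|]].
rewrite wedgeE !mxE !mulr_natl mulr_natr; apply: rpredB; exact: rpredMn.
Qed.

End GradedUniqueness.

Section ResolutionToLevel.
Variables (k : fieldType) (n : nat).
Local Notation R := {mpoly k[n]}.
Variables (J : ideal R) (d t : nat) (f : 'rV[R]_3).
Variables (Phi : 'M[R]_(3, t.+3)) (C : 'M[R]_(t.+3, t.+1)) (e c : nat -> nat).
Hypothesis J_height : has_height (fun x => x \in J) 2.
Hypothesis fJ : generates J f.
Hypothesis f_homog : forall i, f 0 i \is d.-homog.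
Hypothesis Phi_graded : forall i (j : 'I_(t.+3)), graded_entry 0 (e j) (Phi i j).
Hypothesis C_graded : forall (j : 'I_(t.+3)) (i : 'I_(t.+1)), graded_entry (e j) (c i) (C j i).
Hypothesis e_mono : forall i j, (i <= j < t.+3)%N -> (e i <= e j)%N.
Hypothesis c_mono : forall i j, (i <= j < t.+1)%N -> (c i <= c j)%N.
Hypothesis Phi_minimal : forall w : 'cV_(t.+3), Phi *m w = 0 -> forall j, (w j 0)@_0 = 0.
Hypothesis f_exact : exact_at f Phi.
Hypothesis Phi_exact : exact_at Phi C.
Hypothesis C_inj : forall w : 'cV_(t.+1), C *m w = 0 -> w = 0.

Local Notation B := C^T.
Local Notation S := (skewm B).

Let PhiC : Phi *m C = 0.
Proof.
apply/matrixP => i j; have /matrixP /(_ i 0) : Phi *m col j C = 0.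
  by apply/Phi_exact; exists (delta_mx j 0); rewrite -colE.
by rewrite colE mulmxA -colE !mxE.
Qed.

Let fPhi : f *m Phi = 0.
Proof.
apply/matrixP => i j; have /matrixP /(_ i 0) : f *m col j Phi = 0.
  by apply/f_exact; exists (delta_mx j 0); rewrite -colE.
by rewrite colE mulmxA -colE !mxE.
Qed.

(** The columns of C are relations among minimal generators. *)
Let C_coeff0 j i : (C j i)@_0 = 0.
Proof.
have := Phi_minimal (w := col i C) _ j; rewrite mxE; apply.
by rewrite colE mulmxA PhiC mul0mx.
Qed.

Let BT_inj (w : 'cV_(t.+1)) : B^T *m w = 0 -> w = 0.
Proof. by rewrite trmxK; apply: C_inj. Qed.

Let grade_J : grade_ge 2 (fun x => x \in J).
Proof. exact: has_height_grade (ideal_is_ideal J) J_height. Qed.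

Let grade_f : grade_ge 2 (fun x => exists a : 'I_3 -> R, x = \sum_i a i * f 0 i).
Proof.
apply: grade_ge_sub grade_J => x /fJ [a ->]; exists (fun i => a i 0).
by rewrite mxE; apply: eq_bigr => i _; rewrite mulrC.
Qed.

Let f_neq0 : exists i, f 0 i != 0.
Proof.
apply: boolp.contrapT => f0; have [u [v [reg Ju _]]] := grade_ge2P grade_J.
have /eqP := regular2_neq0 reg; apply; have /fJ [a ->] := Ju.
rewrite mxE big1 // => i _; have [->|fi] := eqVneq (f 0 i) 0; first by rewrite mul0r.
by case: f0; exists i.
Qed.

Lemma coeff0_sum (I : Type) (s : seq I) (F : I -> R) :
  (forall i, (F i)@_0 = 0) -> (\sum_(i <- s) F i)@_0 = 0.
Proof. by move=> F0; rewrite raddf_sum /= big1. Qed.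

Lemma coeff0M (x y : R) : (x * y)@_0 = x@_0 * y@_0.
Proof. exact: (rmorphM (mcoeff 0%MM)). Qed.

Let skew_coeff0 b : skew_ideal B b -> b@_0 = 0.
Proof.
move=> /skew_ideal_splits [L /matrixP /(_ 0 0)]; rewrite !mxE mulr1n => <-.
by apply: coeff0_sum => j; rewrite coeff0M mxE C_coeff0 mul0r.
Qed.

(** Height at most 3: otherwise B would be surjective by grade4_surjective,
    although its entries have no constant term. Height at least 3: let s be a
    regular sequence of length equal to the height, generating an ideal over
    which some prime P containing the minors is minimal. Then P is associated
    to (s), so some z outside (s) multiplies the minors into (s); if s had
    length at most 2, C would be injective modulo (s) and McCoy's theorem
    would put z into (s). *)
Lemma lower_block_height : has_height (skew_ideal B) 3.
Proof.
have SI : is_ideal (skew_ideal B) := ideal_gen_is_ideal _.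
have S1 : ~ skew_ideal B 1.
  by move/skew_coeff0; rewrite mcoeff1 eqxx => /eqP; rewrite oner_eq0.
have [s [sreg sS sht]] := has_height_regular SI S1.
suff s3 : size s = 3%N by rewrite -s3.
apply/eqP; rewrite eqn_leq; apply/andP; split; rewrite leqNgt; apply/negP => s_size.
  have [|z zE] := @grade4_surjective _ _ B _ (delta_mx 0 0).
    by apply: (grade_ge_le s_size); exists s.
  have /matrixP /(_ 0 0) := zE; rewrite !mxE !eqxx => /(congr1 (mcoeff 0%MM)).
  rewrite mcoeff1 eqxx coeff0_sum; first by move/eqP; rewrite oner_eq0.
  by move=> j; rewrite coeff0M mxE C_coeff0 mul0r.
have [[P [SP [sP Pmax]]] _] := sht.
have gensP x : gens s x -> x \in P.
  by apply: gens_sub (prime_is_ideal P) _ x => y /sS /SP.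
have [P' sP' P'P|z zs zP] := minimal_prime_annihilator (@noetherian_mpoly k n)
    (gens_ideal s) gensP.
  have := Pmax (size s).+1; rewrite ltnn => /(_ _); case/(_ _)/negP => //.
  apply: prime_chainS P'P; apply: prime_chain_regular => // x xs.
  by apply: sP'; apply: gens_mem.
apply: zs; apply: (@mccoy_skew _ _ B (gens s) z (gens_ideal s)).
  by rewrite trmxK; apply: (injective_mod_regular f_exact Phi_exact C_inj sreg).
by move=> b /SP /zP.
Qed.

Let grade_B : grade_ge 3 (skew_ideal B).
Proof. exact: has_height_grade (ideal_gen_is_ideal _) lower_block_height. Qed.

Let S_neq0 : exists p q, S p q != 0.
Proof.
apply: boolp.contrapT => S0.
have [u [v [reg Iu _]]] := grade_ge2P (grade_ge_le (leqnSn 2) grade_B).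
have /eqP := regular2_neq0 reg; apply.
apply: (@ideal_gen_min _ _ (fun x => x = 0) _ _ _ Iu) => [|_ [p [q ->]]].
  by split=> [|x y -> ->|a x ->]; rewrite ?addr0 ?mulr0.
by have [//|Spq] := eqVneq (S p q) 0; case: S0; exists p, q.
Qed.

(** The columns of Phi^T are killed by B, and exactness makes them multiples
    of S. *)
Lemma Phi_factors : exists A : 'M[R]_(3, t.+3), Phi = A *m S.
Proof.
have /boolp.choice [x xE] : forall i, exists x : 'cV_(t.+3), (row i Phi)^T = S *m x.
  move=> i; apply: (exact_B_skew BT_inj grade_B).
  by rewrite -trmx_mul -row_mul PhiC row0 trmx0.
exists (- \matrix_(i, j) x i j 0); apply/row_matrixP => i.
have rowE : row i (- \matrix_(i, j) x i j 0) = - (x i)^T.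
  by apply/rowP => j; rewrite !mxE.
by rewrite row_mul rowE -[row i Phi]trmxK xE trmx_mul tr_skew mulmxN mulNmx.
Qed.

Lemma S_graded (p q : 'I_(t.+3)) :
  graded_entry (\sum_(j < t.+3) e j) (e p + (e q + \sum_(i < t.+1) c i)) (S p q).
Proof.
(* The degrees of the rows of the matrix made of two unit rows and B. *)
pose rho (s : 'I_(t.+3)) := if unlift ord0 s is Some s1 then
  if unlift ord0 s1 is Some i then c i else e q else e p.
have -> : (e p + (e q + \sum_(i < t.+1) c i) = \sum_(s < t.+3) rho s)%N.
  rewrite [RHS]big_ord_recl [in RHS]big_ord_recl /rho unlift_none liftK unlift_none; congr (_ + (_ + _))%N.
  by apply: eq_bigr => i _; rewrite !liftK.
have delta_graded (a b : 'I_(t.+3)) : graded_entry (e b) (e a) ((delta_mx 0 a : 'rV[R]_(t.+3)) 0 b).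
  rewrite mxE eqxx /=; case: (b =P a) => [->|_]; last exact: graded_entry0.
  by apply/graded_entry_const; apply: dhomog1.
rewrite mxE /det2; apply: graded_entry_det => s j; rewrite /rho.
case: (unliftP ord0 s) => [s1|] ->; last by rewrite cons_row0.
rewrite cons_rowS; case: (unliftP ord0 s1) => [i|] ->; last by rewrite cons_row0.
by rewrite cons_rowS mxE; apply: C_graded.
Qed.

Section Pairing.
Variable A : 'M[R]_(3, t.+3).
Hypothesis PhiE : Phi = A *m S.

Let omega := A *m S *m A^T.
Let sigma (u v : 'cV_(t.+3)) := (u^T *m S *m v) 0 0.

Let wedge_sigma u v l :
  axial (wedge (Phi *m u) (Phi *m v)) l = sigma u v * axial omega l.
Proof. by rewrite -axialZ wedge_skewm -PhiE. Qed.

Lemma sigma_delta p q : sigma (delta_mx p 0) (delta_mx q 0) = S p q.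
Proof. by rewrite /sigma trmx_delta -rowE -colE !mxE. Qed.

Lemma sigma_coeff0 u v : (sigma u v)@_0 = 0.
Proof.
rewrite /sigma mxE; apply: coeff0_sum => q; rewrite coeff0M mxE coeff0_sum ?mul0r // => p.
by rewrite coeff0M [X in _ * X]skew_coeff0 ?mulr0 //; apply: skew_ideal_mem.
Qed.

Let f_Phi (w : 'cV_(t.+3)) : \sum_i f^T i 0 * (Phi *m w) i 0 = 0.
Proof.
have /matrixP /(_ 0 0) : f *m (Phi *m w) = 0 by rewrite mulmxA fPhi mul0mx.
rewrite [LHS]mxE [RHS]mxE => E; rewrite -[RHS]E.
by apply: eq_bigr => i _; rewrite [f^T _ _]mxE.
Qed.

Let axial_parallel : exists c0, forall l, axial omega l = c0 * f 0 l.
Proof.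
apply: (grade2_parallel grade_f) => i j; have [p [q Spq]] := S_neq0.
apply: (mulfI Spq); rewrite !mulrA -!sigma_delta -!wedge_sigma.
have := axial_wedge_parallel i j (f_Phi (delta_mx p 0)) (f_Phi (delta_mx q 0)).
by rewrite ![f^T _ _]mxE.
Qed.

Let koszul_lift l : exists u : 'cV_(t.+3), Phi *m u = koszul_syzygy f^T l.
Proof.
apply/f_exact; apply/matrixP => i j; rewrite !ord1 mxE [RHS]mxE.
by rewrite -[RHS](koszul_syzygyP f^T l); apply: eq_bigr => s _; rewrite [f^T _ _]mxE.
Qed.

(** The axial vector of A S A^T is parallel to f, since its multiple by a
    nonzero entry of S is a cross product of two columns of Phi; as J has
    grade 2, it is c0 f. Lifting two Koszul syzygies of f to vectors u and v
    gives f_l = (u^T S v) c0, so c0 divides an ideal of grade 2. *)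
Lemma axial_omega_unit : exists c0 z, c0 * z = 1 /\ forall l, axial omega l = c0 * f 0 l.
Proof.
have [c0 c0E] := axial_parallel; have [i fi] := f_neq0.
have [|z zE] := @grade2_not_principal _ _ _ c0 grade_J; last by exists c0, z.
suff fl l : exists y, f 0 l = c0 * y.
  move=> x /fJ [a ->]; have /boolp.choice [y yE] := fl.
  exists (\sum_l y l * a l 0); rewrite mxE mulr_sumr.
  by apply: eq_bigr => l _; rewrite yE mulrA.
have [u uE] := koszul_lift (l + 1); have [v vE] := koszul_lift (l + 2).
exists (sigma u v); apply: (mulIf fi); rewrite [c0 * _]mulrC -mulrA -c0E -wedge_sigma uE vE.
by rewrite axial_wedge_koszul ![f^T _ _]mxE.
Qed.

(** If the first column of Phi were constant, its cross product with Koszul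
    syzygies would express its entries as multiples of values of the
    alternating form, which have no constant term; the column would vanish. *)
Lemma first_degree_pos : (0 < e 0)%N.
Proof.
rewrite lt0n; apply/eqP => e0; have [c0 [z [c0z c0E]]] := axial_omega_unit.
have [i fi] := f_neq0.
have Phi0 l : Phi l 0 = 0.
  have [v vE] := koszul_lift l.
  pose d0 : 'cV[R]_(t.+3) := delta_mx 0 0.
  have : axial (wedge (Phi *m d0) (Phi *m v)) i = - ((Phi *m d0) l 0 * f 0 i).
    by rewrite vE axial_wedge_vector ?f_Phi // [f^T _ _]mxE.
  rewrite wedge_sigma c0E mulrA -mulNr => /(mulIf fi).
  rewrite -colE [col _ _ _ _]mxE => /(congr1 (mcoeff 0%MM)).
  rewrite coeff0M sigma_coeff0 mul0r => /esym; rewrite mcoeffN => /eqP; rewrite oppr_eq0 => /eqP P0.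
  have [+ _] := Phi_graded l 0; rewrite e0 subnn => /(_ isT) /pihomog_dE <-.
  by rewrite pihomog0E P0 mpolyC0.
have := Phi_minimal (w := delta_mx 0 0) _ 0; rewrite mxE !eqxx mcoeff1 eqxx.
move=> /(_ _)/eqP; rewrite oner_eq0 => H; suff: false by [].
by apply: H; rewrite -colE; apply/colP => l; rewrite !mxE Phi0.
Qed.

(** Koszul syzygies have degree d, so if e_2 > d they lift to vectors u and v
    supported on the first two generators; then u^T S v is a multiple of S_01
    and this nonunit divides all the f_l. *)
Lemma third_degree_le : (e 2 <= d)%N.
Proof.
rewrite leqNgt; apply/negP => e2; have [c0 [z [c0z c0E]]] := axial_omega_unit.
have [i fi] := f_neq0.
pose i1 : 'I_(t.+3) := lift ord0 ord0.
(* The part of degree d of a lift is again a lift, and it involves no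
   generator of degree above d. *)
have short l : exists u : 'cV_(t.+3), Phi *m u = koszul_syzygy f^T l /\
    forall j : 'I_(t.+3), (1 < j)%N -> u j 0 = 0.
  have [u uE] := koszul_lift l; exists (component (fun j : 'I_(t.+3) => e j) d u); split; last first.
    move=> j j1; rewrite mxE leqNgt (leq_trans e2) //; apply: e_mono.
    by rewrite j1 ltn_ord.
  apply/colP => s; rewrite -uE; have -> : (Phi *m u) s 0 = pihomog mdeg d ((Phi *m u) s 0).
    by rewrite uE pihomog_dE //; apply: koszul_homog => j; rewrite mxE.
  rewrite ![(_ *m _) s 0]mxE raddf_sum; apply: eq_bigr => j _ /=.
  have [+ _] := Phi_graded s j; rewrite subn0 => /(_ isT) Ph.
  rewrite [X in pihomog mdeg d X]mulrC (pihomog_mulr _ _ Ph) mxE; case: ifP => _.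
    by rewrite mulrC.
  by rewrite mulr0.
have sum2 (F : 'I_(t.+3) -> R) : (forall j : 'I_(t.+3), (1 < j)%N -> F j = 0) ->
    \sum_j F j = F 0 + F i1.
  by move=> F0; rewrite 2!big_ord_recl big1 ?addr0 // => j _; apply: F0.
have fl l : exists y, f 0 l = S 0 i1 * y.
  have [u [uE u0]] := short (l + 1); have [v [vE v0]] := short (l + 2).
  have sigE : sigma u v = S 0 i1 * (u 0 0 * v i1 0 - u i1 0 * v 0 0).
    rewrite /sigma mxE sum2 => [|j j1]; last by rewrite v0 // mulr0.
    have uS q : (u^T *m S) 0 q = u 0 0 * S 0 q + u i1 0 * S i1 q.
      by rewrite mxE sum2 => [|j j1]; rewrite ![u^T _ _]mxE // u0 // mul0r.
    rewrite !uS !skew_diag (skew_anti _ i1); ring.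
  exists ((u 0 0 * v i1 0 - u i1 0 * v 0 0) * c0); apply: (mulIf fi).
  rewrite mulrA -sigE -mulrA -c0E -wedge_sigma uE vE.
  by rewrite axial_wedge_koszul ![f^T _ _]mxE.
have [|y] := @grade2_not_principal _ _ _ (S 0 i1) grade_J.
  move=> x /fJ [a ->]; have /boolp.choice [y yE] := fl.
  exists (\sum_l y l * a l 0); rewrite mxE mulr_sumr.
  by apply: eq_bigr => l _; rewrite yE mulrA.
by move/unit_coeff0; rewrite skew_coeff0 ?eqxx //; apply: skew_ideal_mem.
Qed.

(** Compare the degrees of the two sides of the cross product identity for a
    pair of columns with S_pq nonzero. *)
Lemma degree_sum : (\sum_(j < t.+3) e j = d + \sum_(i < t.+1) c i)%N.
Proof.
have [c0 [z [c0z c0E]]] := axial_omega_unit.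
have [i fi] := f_neq0; have [p [q Spq]] := S_neq0.
have c00 : c0 != 0 by apply: contra_eq_neq c0z => ->; rewrite mul0r eq_sym oner_eq0.
have c0_graded : graded_entry 0 0 c0.
  rewrite (is_unitP c0z); apply/graded_entry_const; rewrite -[X in X \is _]mulr1 mul_mpolyC.
  by apply: dhomogZ; apply: dhomog1.
have f_graded : graded_entry 0 d (f 0 i) by split=> // _; rewrite subn0; apply: f_homog.
have := graded_entryM (S_graded p q) (graded_entryM c0_graded f_graded).
rewrite -c0E -sigma_delta -wedge_sigma => left_graded.
have right_graded : graded_entry (0 + 0) (e p + e q)
    (axial (wedge (Phi *m delta_mx p 0) (Phi *m delta_mx q 0)) i).
  have entry (a b : 'I_3) : graded_entry (0 + 0) (e p + e q)
      (wedge (Phi *m delta_mx p (0 : 'I_1)) (Phi *m delta_mx q 0) a b).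
    rewrite wedgeE -!colE !mxE; apply: graded_entryD; first exact: graded_entryM.
    by apply: graded_entryN; rewrite addnC; apply: graded_entryM.
  by rewrite /axial; case: (val i) => [|[|]].
have := graded_entry_uniq _ left_graded right_graded.
rewrite wedge_sigma sigma_delta c0E !mulf_neq0 // => /(_ isT); lia.
Qed.

(** The components of A of the expected degrees still satisfy Phi = A S since
    Phi and S are homogeneous. *)
Lemma graded_factor : exists A' : 'M[R]_(3, t.+3),
  Phi = A' *m S /\ forall i (j : 'I_(t.+3)), graded_entry (e j) d (A' i j).
Proof.
exists (\matrix_(i < 3, j < t.+3) if (e j <= d)%N then pihomog mdeg (d - e j) (A i j) else 0).
split=> [|i j]; last first.
  rewrite mxE; split=> [->|]; first exact: pihomogP.
  by rewrite ltnNge => /negPf ->.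
apply/matrixP => i j; have [+ _] := Phi_graded i j; rewrite subn0 => /(_ isT) /pihomog_dE <-.
rewrite PhiE !mxE raddf_sum; apply: eq_bigr => l _ /=; rewrite mxE.
have Sg : graded_entry d (e l + e j) (S l j).
  apply/(graded_entry_shift (\sum_(i < t.+1) c i)); have := S_graded l j.
  by rewrite degree_sum addnA.
have [dle|ltd] := leqP d (e l + e j); last by rewrite (Sg.2 ltd) !mulr0 raddf0.
rewrite (pihomog_mulr _ _ (Sg.1 dle)) leq_subLR addnC [(d + _)%N]addnC leq_add2l.
case: ifP => [eld|]; last by rewrite mul0r.
by congr (pihomog mdeg _ _ * _); lia.
Qed.

End Pairing.

Let N q (qt : (q <= t.+1)%N) (qt' : (q.+1 <= t.+3)%N) : 'M[R]_(q.+1, q) :=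
  mxsub (widen_ord qt') (widen_ord qt) C.

(** If c_i were at most e_(i+2), the first i + 1 columns of C would vanish
    below row i + 1, and every maximal minor of B would lie in the ideal of
    maximal minors of the block M of size (i + 2) x (i + 1) at the corner of
    C, which has therefore grade at least 2. Each row of Phi restricted to the
    first i + 2 columns is killed by M, so it is h_s times the vector of
    signed minors of M. The vector h is a syzygy of f, hence Phi w, and the
    first column of Phi would be Phi applied to a vector with entries in the
    maximal ideal, against minimality. *)
Lemma lower_degree_gt i : (i < t.+1)%N -> (e i.+2 < c i)%N.
Proof.
move=> it; rewrite ltnNge; apply/negP => ce.
pose q := i.+1; have qt : (q <= t.+1)%N by [].
have qt' : (q.+1 <= t.+3)%N by rewrite ltnS ltnW // ltnS.
pose M := N qt qt'.
have C_zero (j : 'I_(t.+3)) (l : 'I_(t.+1)) : (l < q)%N -> (q < j)%N -> C j l = 0.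
  move=> lq qj; have cl : (c l <= e j)%N.
    apply: leq_trans (leq_trans (c_mono _) ce) (e_mono _); first by rewrite -ltnS lq.
    by rewrite qj ltn_ord.
  have [h0 h1] := C_graded j l; move: cl; rewrite leq_eqVlt => /orP [/eqP ce'|/h1 //].
  move: h0; rewrite ce' leqnn subnn => /(_ isT) /pihomog_dE <-.
  by rewrite pihomog0E C_coeff0 mpolyC0.
pose I x := exists a : 'I_q.+1 -> R, x = \sum_j a j * signed_minor M j.
have II : is_ideal I.
  split; first by exists (fun=> 0); rewrite big1 // => j _; rewrite mul0r.
    move=> _ _ [a ->] [b ->]; exists (fun j => a j + b j).
    by rewrite -big_split; apply: eq_bigr => j _; rewrite mulrDl.
  by move=> b _ [a ->]; exists (fun j => b * a j); rewrite mulr_sumr; apply: eq_bigr => j _; rewrite mulrA.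
have SI b : skew_ideal B b -> I b.
  move/skew_idealP; apply: ideal_gen_min => // _ [g [h [/increasing_id gid _ ->]]].
  apply: (det_first_rows (qr := qt) II) => g'.
  have [big|] := boolP [exists l, q < h (g' l)]%N.
    case/existsP: big => l hl; suff -> : \det (mxsub (widen_ord qt) g' (mxsub g h B)) = 0.
      by case: II.
    rewrite (expand_det_col _ l) big1 // => s _.
    by rewrite !mxE gid C_zero ?mul0r //= ltn_ord.
  rewrite negb_exists => /forallP small.
  pose g'' l : 'I_q.+1 := inord (h (g' l)).
  have [a aE] := det_rowsub_signed_minor M g''; exists a; rewrite -aE -det_tr; congr (\det _).
  apply/matrixP => s l; rewrite !mxE gid; congr (C _ _); apply: val_inj => //=.
  by rewrite /g'' inordK // ltnS leqNgt small.
have grade_M : grade_ge 2 I := grade_ge_sub SI (grade_ge_le (leqnSn 2) grade_B).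
have [s|h hE] := @boolp.choice _ _ (fun (s : 'I_3) y => forall j : 'I_q.+1,
    Phi s (widen_ord qt' j) = y * signed_minor M j).
  apply: (grade2_parallel grade_M) => j l.
  have := @signed_minor_parallel _ _ M (\row_j Phi s (widen_ord qt' j)) j l; rewrite !mxE; apply.
  apply/rowP => r; rewrite !mxE.
  have /matrixP /(_ s (widen_ord qt r)) := PhiC; rewrite !mxE => E; rewrite -[RHS]E.
  rewrite [RHS](bigID (fun j : 'I_(t.+3) => (j < q.+1)%N)) /= [X in _ = _ + X]big1 ?addr0.
    rewrite (big_ord_narrow qt'); apply: eq_bigr => j' _; by rewrite !mxE.
  by move=> j'; rewrite -leqNgt => qj; rewrite C_zero ?mulr0 //= ltn_ord.
have [j0 Mj0] : exists j, signed_minor M j != 0.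
  apply: boolp.contrapT => M0; have [u [v [reg [a uE] _]]] := grade_ge2P grade_M.
  have /eqP := regular2_neq0 reg; apply; rewrite uE big1 // => j _.
  have [->|Mj] := eqVneq (signed_minor M j) 0; first by rewrite mulr0.
  by case: M0; exists j.
have [|w wE] := (f_exact (\col_s h s)).1.
  apply/matrixP => a b; rewrite !ord1 !mxE; apply: (mulIf Mj0); rewrite mul0r mulr_suml.
  have /matrixP /(_ 0 (widen_ord qt' j0)) := fPhi; rewrite !mxE => E; rewrite -[RHS]E.
  apply: eq_bigr => s _; have -> : (\col_s h s : 'cV[R]_3) s 0 = h s by rewrite mxE.
  by rewrite hE; exact/esym/mulrA.
pose z : 'cV[R]_(t.+3) := delta_mx (widen_ord qt' 0) 0 - signed_minor M 0 *: w.
have Phiz : Phi *m z = 0.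
  rewrite mulmxBr -scalemxAr wE -colE; apply/colP => s; rewrite !mxE hE.
  by rewrite mulrC subrr.
have := Phi_minimal Phiz (widen_ord qt' 0); rewrite !mxE !eqxx raddfB /= mcoeff1 eqxx coeff0M.
have -> : (signed_minor M 0)@_0 = 0.
  rewrite /signed_minor coeff0M -det_map_mx.
  have -> : map_mx (mcoeff 0%MM) (row' 0 M) = 0 :> 'M[k]_q.
    by apply/matrixP => a b; rewrite !mxE C_coeff0.
  by rewrite det0 mulr0.
by rewrite mul0r subr0 => /eqP; rewrite oner_eq0.
Qed.

(** The generator degrees e and c are indexed from 0: delta_i is e_(i-1) and
    delta_(i+2) + epsilon_i is c_(i-1). *)
Lemma resolution_level_matrix : (0 < d)%N ->
  exists (delta eps : nat -> nat) (eta : 'M[R]_(3 + t.+1, t.+3)),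
  [/\ latent_data d t.+3 delta eps, level_matrix (m := t.+3) d delta eps eta
    & generated_by J (is_fixing_minor eta)].
Proof.
move=> d0; have [A0 PhiE0] := Phi_factors.
have [A [PhiE A_graded]] := graded_factor PhiE0.
have [c0 [z [c0z c0E]]] := @axial_omega_unit A PhiE.
pose eta : 'M[R]_(3 + t.+1, t.+3) := col_mx A B.
have etaA : usubmx eta = A by rewrite col_mxKu.
have etaB : dsubmx eta = B by rewrite col_mxKd.
have upperE l : upper_minors eta 0 l = c0 * f 0 l.
  rewrite -c0E; elim/ord3_ind: l; rewrite axialE -{1}etaA -{1}etaB -{1}etaA;
    exact: upper_minors_skew.
have J_upper x : x \in J <-> exists a : 'cV_3, x = (upper_minors eta *m a) 0 0.
  have upper a : (upper_minors eta *m a) 0 0 = (f *m (c0 *: a)) 0 0.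
    by rewrite mxE [RHS]mxE; apply: eq_bigr => l _; rewrite upperE [(c0 *: a) _ _]mxE; ring.
  split=> [/fJ [a ->]|[a ->]]; last by apply/fJ; exists (c0 *: a); rewrite upper.
  by exists (z *: a); rewrite upper scalerA c0z scale1r.
have J_gen : generated_by J (is_fixing_minor eta).
  by move=> x; rewrite J_upper fixing_minors_generate.
pose delta i := e i.-1; pose eps i := (c i.-1 - e i.+1)%N.
have delta_eps i : (i < t.+1)%N -> (delta (i + 3) + eps i.+1 = c i)%N.
  by move=> it; rewrite /delta /eps addn3 /= subnKC // ltnW // lower_degree_gt.
have sumE : (e 0 + e 1 = d + \sum_(1 <= j < t.+2) eps j)%N.
  have := degree_sum PhiE; rewrite 2!big_ord_recl /= addnA big_add1 big_mkord.
  have -> : (\sum_(i < t.+1) c i = \sum_(i < t.+1) eps i.+1 + \sum_(i < t.+1) e i.+2)%N.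
    rewrite -big_split; apply: eq_bigr => i _ /=.
    by rewrite -(delta_eps i) // addnC /delta addn3.
  by rewrite addnA => /eqP; rewrite eqn_add2r => /eqP.
have eps_pos i : (1 <= i < t.+2)%N -> (0 < eps i)%N.
  by case: i => // i /andP [_ it]; rewrite subn_gt0 lower_degree_gt.
exists delta, eps, eta; split=> //.
  split=> //.
  - exact: first_degree_pos PhiE.
  - by case=> // i /andP [_ it]; apply: e_mono; rewrite leqnSn.
  - case=> // i /andP [_ it]; have it' : (i.+1 < t.+1)%N by [].
    rewrite addn1 (addSnnS i 2) delta_eps ?(ltnW it') // delta_eps //.
    by apply: c_mono; rewrite leqnSn.
  - move=> i j i1 ij jm; have : (d + 1 <= e 0 + e 1)%N.
      rewrite sumE leq_add2l big_ltn //; apply: leq_trans (leq_addr _ _).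
      exact: eps_pos.
    move/leq_trans; apply; rewrite /delta; apply: leq_add; apply: e_mono; lia.
  - exact: third_degree_le PhiE.
split=> [i j|i j||].
- rewrite etaA; exact: A_graded.
- rewrite etaB delta_eps // mxE; have [h0 h1] := C_graded j i.
  split=> [/ltnW //|]; rewrite leq_eqVlt => /orP [/eqP ce|/h1 //].
  move: h0; rewrite ce leqnn subnn => /(_ isT) /pihomog_dE <-.
  by rewrite pihomog0E C_coeff0 mpolyC0.
- have J_minors x : x \in J -> minors_ideal t.+3 eta x.
    move=> /J_upper [a ->]; apply/maximal_minors_idealP; rewrite mxE.
    apply: is_ideal_sum (ideal_gen_is_ideal _) _ => i _.
    have [_ _ IM] := ideal_gen_is_ideal (fun y => exists i, y = signed_minor eta i).
    by rewrite mulrC; apply: (IM); apply: ideal_gen_sub; rewrite mxE; eexists.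
  have [[P [JP Ph]] hmin] := J_height; split.
    exists P; split=> // x Ix.
    have [b [Bb bP]] : exists b, skew_ideal B b /\ b \notin P.
      apply: boolp.contrapT => nb; suff : (3 <= 2)%N by [].
      apply: (lower_block_height.2 P 2) Ph => b Bb.
      by apply: boolp.contrapT => /negP bP; case: nb; exists b.
    rewrite -etaB in Bb.
    have [a aE] := conductor_upper_minors Bb Ix.
    have : b * x \in P by apply: JP; apply/J_upper; exists a.
    by rewrite prime_idealrM (negPf bP).
  by move=> P' h' IP'; apply: hmin => x /J_minors; apply: IP'.
- rewrite etaB; apply: eq_has_height lower_block_height => x; split=> /skew_idealP //.
Qed.

End ResolutionToLevel.

(** * Existence of the minimal resolution, and the equivalence *)

Section MinimalResolution.
Variables (k : fieldType) (n : nat).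
Local Notation R := {mpoly k[n]}.

(** A homogeneous matrix commutes with taking homogeneous components, so its
    kernel contains the components of its elements. *)
Lemma mulmx_component p q (M : 'M[R]_(p, q)) (b : 'I_p -> nat) (a : 'I_q -> nat) :
  (forall i j, graded_entry (b i) (a j) (M i j)) ->
  forall t v, component b t (M *m v) = M *m component a t v.
Proof.
move=> Mh t v; have mulE (u : 'cV[R]_q) : M *m u = \sum_j u j 0 *: col j M.
  apply/colP => i; rewrite summxE mxE; apply: eq_bigr => j _.
  by rewrite mxE [col j M i 0]mxE mulrC.
rewrite !mulE component_sum; apply: eq_bigr => j _.
have -> : component a t v j 0 = if (a j <= t)%N then pihomog mdeg (t - a j) (v j 0) else 0.
  by rewrite mxE.
by apply: component_scale => i; rewrite mxE.
Qed.

Lemma kernel_component p q (M : 'M[R]_(p, q)) b a t (v : 'cV_q) :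
  (forall i j, graded_entry (b i) (a j) (M i j)) ->
  M *m v = 0 -> M *m component a t v = 0.
Proof. by move=> /mulmx_component <- ->; rewrite component0. Qed.

Lemma kernel_submodule p q (M : 'M[R]_(p, q)) : is_submodule (fun v : 'cV_q => M *m v = 0).
Proof.
split=> [|x y Mx My|a x Mx]; first exact: mulmx0.
  by rewrite mulmxDr Mx My addr0.
by rewrite -scalemxAr Mx scaler0.
Qed.

(** The projection T onto the kernel of C has entries without constant term by
    minimality, so 1 - T has determinant with constant term 1, although it
    kills the kernel of C. *)
Lemma minimal_kernel_inj q r (C : 'M[R]_(q, r)) (T : 'M_r) :
  C *m T = 0 -> (forall x : 'cV_r, C *m x = 0 -> T *m x = x) ->
  (forall w : 'cV_r, C *m w = 0 -> forall j, (w j 0)@_0 = 0) ->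
  forall w : 'cV_r, C *m w = 0 -> w = 0.
Proof.
move=> CT Tid Cmin w Cw.
have T0 i j : (T i j)@_0 = 0.
  have := Cmin (col j T) _ i; rewrite mxE; apply.
  by rewrite colE mulmxA CT mul0mx.
have det0 : \det (1%:M - T) != 0.
  suff /eqP d1 : (\det (1%:M - T))@_0 == 1.
    by apply: contra_eq_neq d1 => ->; rewrite mcoeff0 eq_sym oner_eq0.
  rewrite -det_map_mx (_ : map_mx _ _ = 1%:M) ?det1 //.
  apply/matrixP => i j; rewrite [LHS]mxE [(1%:M - T) i j]mxE [(- T) i j]mxE raddfB /= T0 subr0.
  by rewrite !mxE; case: (i == j); rewrite ?mcoeff1 ?mcoeff0 ?eqxx.
apply: (scaler_mxI det0); rewrite scaler0 -mul_scalar_mx -mul_adj_mx -mulmxA.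
by rewrite mulmxBl mul1mx Tid // subrr mulmx0.
Qed.

(** Minimal homogeneous generators of the syzygies of f, then of their
    relations. Projective dimension 2 makes the kernel of C a direct summand,
    which minimality reduces to 0. It also excludes r = 0, and the alternating
    sum of the ranks 1, 3, m, r vanishes. *)
Theorem minimal_resolution (J : ideal R) d (f : 'rV[R]_3) :
  almost_CM_codim2 J -> generates J f -> (forall i, f 0 i \is d.-homog) ->
  exists t (Phi : 'M[R]_(3, t.+3)) (C : 'M[R]_(t.+3, t.+1)) (e c : nat -> nat),
  [/\ [/\ forall i (j : 'I_(t.+3)), graded_entry 0 (e j) (Phi i j),
      forall (j : 'I_(t.+3)) (i : 'I_(t.+1)), graded_entry (e j) (c i) (C j i),
      forall i j, (i <= j < t.+3)%N -> (e i <= e j)%N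
    & forall i j, (i <= j < t.+1)%N -> (c i <= c j)%N],
      forall w : 'cV_(t.+3), Phi *m w = 0 -> forall j : 'I_(t.+3), (w j 0)@_0 = 0,
      exact_at f Phi, exact_at Phi C
    & forall w : 'cV_(t.+1), C *m w = 0 -> w = 0].
Proof.
move=> [Jht [Jres Jmin]] fJ fh.
have f_component t v : component (fun=> 0%N) t v = component (fun=> d) (t + d) v :> 'cV[R]_3.
  by apply/matrixP => i j; rewrite !mxE leq_addl addnK subn0.
have f_graded i j : graded_entry 0 d (f i j).
  by rewrite [i]ord1; split=> // _; rewrite subn0.
have [q [Phi [e [Phi_graded e_mono fPhi Phi_onto Phi_min]]]] :=
  minimal_homogeneous_generators (kernel_submodule f)
    (fun t v => etrans (congr1 (mulmx f) (f_component t v)) \o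
       kernel_component (b := fun=> 0%N) (a := fun=> d) (t + d) f_graded).
have fPhi_exact : exact_at f Phi.
  by move=> x; split=> [/Phi_onto [w ->]|[w <-]]; [exists w | exact: fPhi].
have [r [C [c [C_graded c_mono PhiC C_onto C_min]]]] :=
  minimal_homogeneous_generators (kernel_submodule Phi)
    (fun t v => kernel_component (b := fun=> 0%N) (a := e) t Phi_graded).
have PhiC_exact : exact_at Phi C.
  by move=> x; split=> [/C_onto [w ->]|[w <-]]; [exists w | exact: PhiC].
have [T [CT Tid]] := matrix_kernel_splits2 Jres (leqnn 2) fJ fPhi_exact PhiC_exact.
have C_inj := minimal_kernel_inj CT Tid C_min.
have C_exact : exact_at C (0 : 'M_(r, 0)).
  by move=> x; split=> [/C_inj ->|[z <-]]; [exists 0; rewrite mulmx0 | rewrite mul0mx mulmx0].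
have f_neq0 : f != 0.
  apply/eqP => f0.
  have [u [v [reg Ju _]]] := grade_ge2P (has_height_grade (ideal_is_ideal J) Jht).
  by have /eqP := regular2_neq0 reg; apply; have /fJ [a ->] := Ju; rewrite f0 mul0mx mxE.
have qE : q = r.+2.
  have := exact_rank C_exact; have := exact_rank PhiC_exact; have := exact_rank fPhi_exact.
  have -> : \rank (map_mx (@FracField.tofrac R) f) = 1%N.
    rewrite rank_rV; case: eqP => // /frac_mx_eq0 f0; by rewrite f0 eqxx in f_neq0.
  have := rank_leq_col (map_mx (@FracField.tofrac R) (0 : 'M[R]_(r, 0))).
  rewrite leqn0 => /eqP r0; rewrite add1n => -[->] qE; rewrite r0 addn0 => rE.
  by rewrite -[LHS]qE -[in RHS]rE add2n.
have [t rE] : exists t, r = t.+1.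
  case: (posnP r) => [r0|r0]; last by exists r.-1; rewrite prednK.
  suff : (2 <= 1)%N by [].
  by apply: Jmin; apply: matrix_resolution fJ fPhi_exact PhiC_exact C_inj _; right.
subst r; subst q.
by exists t, Phi, C, e, c.
Qed.

End MinimalResolution.

Lemma ideal_gen_row (R : comNzRingType) p (f : 'rV[R]_p) x :
  ideal_gen (fun y => exists i, y = f 0 i) x <-> exists c : 'cV_p, x = (f *m c) 0 0.
Proof.
split.
  apply: (@ideal_gen_min _ _ (fun x => exists c : 'cV_p, x = (f *m c) 0 0)) => [|_ [i ->]].
    split; first by exists 0; rewrite mulmx0 mxE.
      by move=> _ _ [c ->] [c' ->]; exists (c + c'); rewrite mulmxDr !mxE.
    by move=> a _ [c ->]; exists (a *: c); rewrite -scalemxAr !mxE.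
  by exists (delta_mx i 0); rewrite -colE mxE.
move=> [c ->]; rewrite mxE; apply: is_ideal_sum (ideal_gen_is_ideal _) _ => i _.
have [_ _ IM] := ideal_gen_is_ideal (fun y => exists i, y = f 0 i).
by rewrite mulrC; apply: (IM); apply: ideal_gen_sub; exists i.
Qed.

Theorem theorem1p3 (k : fieldType) (n : nat) (hn : (3 <= n)%N)
    (J : ideal {mpoly k[n]}) (d : nat) :
  [/\ (2 <= d)%N, almost_CM_codim2 J
    & exists f : 'I_3 -> {mpoly k[n]},
        (forall i, f i \is d.-homog) /\
        generated_by J (fun x => exists i, x = f i)]
  <->
  exists (m : nat) (delta eps : nat -> nat)
         (eta : 'M[{mpoly k[n]}]_(3 + (m - 2), m)),
    [/\ latent_data d m delta eps, level_matrix d delta eps eta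
      & generated_by J (is_fixing_minor eta)].
Proof.
split=> [[d2 aCM [f [fh J_f]]]|[m [delta [eps [eta [lat lev J_gen]]]]]].
  have [frow frowE] : exists frow : 'rV_3, f =1 frow 0.
    by exists (\row_i f i) => i; rewrite mxE.
  have fJ : generates J frow.
    move=> x; rewrite -ideal_gen_row J_f; split; apply: ideal_gen_min (ideal_gen_is_ideal _) _ => y;
      by move=> [i ->]; apply: ideal_gen_sub; exists i.
  have fh' i : frow 0 i \is d.-homog by rewrite -frowE.
  have [t [Phi [C [e [c [[Phi_graded C_graded e_mono c_mono] Phi_min fPhi PhiC C_inj]]]]]] :=
    minimal_resolution aCM fJ fh'.
  have [delta [eps [eta lev]]] := resolution_level_matrix aCM.1 fJ fh' Phi_graded C_graded
    e_mono c_mono Phi_min fPhi PhiC C_inj (ltnW d2).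
  by exists t.+3, delta, eps, eta.
case: m => [|[|[|t]]] in eta lat lev J_gen *; try by case: lat.
have A_graded : forall (i : 'I_3) (j : 'I_(t.+3)),
  graded_entry (delta j.+1) d (usubmx eta i j) := level_upper lev.
have B_graded (i : 'I_(t.+1)) (j : 'I_(t.+3)) :
    graded_entry (delta j.+1) (delta (i + 3)%N + eps i.+1) (dsubmx eta i j).
  have [h0 h1] := level_lower lev i j; split=> [|/ltnW //].
  rewrite leq_eqVlt => /orP [/eqP E|/h0 //]; rewrite h1 ?E //; exact: dhomog0.
have ht_eta := level_height lev; have ht_B := level_height_lower lev.
have Jht := level_ideal_height J_gen ht_eta ht_B.
split; first exact: level_degree J_gen ht_eta ht_B lat A_graded B_graded.
  by split=> //; exact: level_pdim J_gen ht_eta ht_B.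
exists (fun i => upper_minors (r := t.+1) eta 0 i); split.
  exact: level_homog lat A_graded B_graded.
by move=> x; rewrite J_gen (fixing_minors_generate (r := t.+1)) ideal_gen_row.
Qed.
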